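(* Let $k$ be an infinite field and $G$ a finite group. Assume that (i) $G$ contains an abelian normal subgroup $H$ such that $G/H$ is cyclic, and (ii) $\zeta_{e'}\in k$ where $e'=\operatorname{lcm}\{\exp(H),\operatorname{ord}(\tau)\}$ and $\tau$ is some element of $G$ whose image in $G/H$ generates the cyclic group $G/H$. If $G\to GL(V)$ is any finite-dimensional linear representation of $G$ over $k$, then $k(V)^G$ is retract $k$-rational. In particular, $k(G)$ is retract $k$-rational.
   Context: $\zeta_n$ denotes a primitive $n$-th root of unity; writing $\zeta_n\in k$ means that $\operatorname{char}k=0$ or $\operatorname{char}k=p>0$ with $p\nmid n$, and that $k$ contains a primitive $n$-th root of unity. $\exp(H)$ is the exponent of $H$ (the least common multiple of the orders of its elements) and $\operatorname{ord}(\tau)$ is the order of $\tau$. $k(V)$ is the rational function field of $V$, i.e. the quotient field of the symmetric algebra of the dual space $V^*$, with the induced action of $G$ by $k$-automorphisms; $k(V)^G$ is its fixed field. $k(G)=k(x_g:g\in G)^G$ is the fixed field of the rational function field in variables $x_g$ ($g\in G$), where $G$ acts by $k$-automorphisms with $h\cdot x_g=x_{hg}$ for $g,h\in G$. Retract rationality: a field $L\supset k$ ($k$ infinite) is called retract $k$-rational if there are an affine domain $A$ over $k$ (an integral domain finitely generated as a $k$-algebra), a polynomial ring $k[X_1,\ldots,X_n]$, a nonzero $f\in k[X_1,\ldots,X_n]$, and $k$-algebra morphisms $\varphi:A\to k[X_1,\ldots,X_n][1/f]$ and $\psi:k[X_1,\ldots,X_n][1/f]\to A$ such that (i) $L$ is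 the quotient field of $A$, and (ii) $\psi\circ\varphi=1_A$. *)

(* Defs.v *)
From HB Require Import structures.
From mathcomp Require Import all_boot all_order all_algebra.
From mathcomp Require Import all_fingroup all_solvable all_character.
From mathcomp Require Import boolp.
From mathcomp Require Import mpoly generic_quotient.

Set Implicit Arguments.
Unset Strict Implicit.
Unset Printing Implicit Defensive.

Import GRing.Theory.
Local Open Scope ring_scope.
Local Open Scope quotient_scope.

Definition infinite_field (k : fieldType) : Prop :=
  forall s : seq k, exists x : k, x \notin s.

Definition has_zeta (k : fieldType) (n : nat) : Prop :=
  (forall p : nat, p \in [pchar k] -> ~~ (p %| n)%N) /\
  exists z : k, n.-primitive_root z.

Section FracMap.
Variable R : idomainType.

Lemma fracE (x : {fraction R}) :
  x = tofrac (\n_(repr x)) / tofrac (\d_(repr x)).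
Proof.
have d0 := denom_ratioP (repr x).
apply: (canRL (mulfK _)); first by rewrite tofrac_eq0.
rewrite -{1}[x]reprK; set y := repr x in d0 *.
rewrite -[LHS]/(FracField.mul _ _) !piE; apply/eqP; rewrite FracField.equivf_def.
by rewrite /FracField.mulf !numden_Ratio ?mulr1 ?oner_eq0 // mulrC.
Qed.

Variables (s : {rmorphism R -> R}).

(* Injectivity makes this independent of the representative: see [frac_map_div]. *)
Definition frac_map of injective s := fun x : {fraction R} =>
  tofrac (s \n_(repr x)) / tofrac (s \d_(repr x)).

Hypothesis s_inj : injective s.
Local Notation fm := (frac_map s_inj).

Let s_neq0 a : a != 0 -> tofrac (s a) != 0.
Proof. by rewrite tofrac_eq0 raddf_eq0. Qed.

Lemma frac_map_div (a b : R) : b != 0 ->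
  fm (tofrac a / tofrac b) = tofrac (s a) / tofrac (s b).
Proof.
move=> b0; set x := _ / _; rewrite /frac_map.
have d0 := denom_ratioP (repr x); have := fracE x.
move: d0; set c := \n_ _; set d := \d_ _ => d0 /eqP.
rewrite /x eqr_div ?tofrac_eq0 // -!tofracM tofrac_eq => /eqP e.
by apply/eqP; rewrite eqr_div ?s_neq0 // -!tofracM -!rmorphM e.
Qed.

Lemma frac_map_tofrac (a : R) : fm (tofrac a) = tofrac (s a).
Proof.
have := frac_map_div a (oner_neq0 R).
by rewrite [s 1]rmorph1 [tofrac 1]rmorph1 !divr1.
Qed.

Lemma frac_map_is_zmod_morphism : zmod_morphism fm.
Proof.
move=> x y; rewrite (fracE x) (fracE y).
set a := \n_ _; set b := \d_ _; set c := \n_ _; set d := \d_ _.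
have b0 : b != 0 by exact: denom_ratioP.
have d0 : d != 0 by exact: denom_ratioP.
rewrite -mulNr addf_div ?tofrac_eq0 // -tofracN -!tofracM -tofracD.
rewrite !frac_map_div ?mulf_neq0 // -[in RHS]mulNr addf_div ?s_neq0 //.
by rewrite rmorphD !rmorphM rmorphN tofracD !tofracM tofracN.
Qed.

Lemma frac_map_is_monoid_morphism : monoid_morphism fm.
Proof.
split; first by rewrite -tofrac1 frac_map_tofrac rmorph1.
move=> x y; rewrite (fracE x) (fracE y).
set a := \n_ _; set b := \d_ _; set c := \n_ _; set d := \d_ _.
have b0 : b != 0 by exact: denom_ratioP.
have d0 : d != 0 by exact: denom_ratioP.
rewrite mulf_div -!tofracM !frac_map_div ?mulf_neq0 //.
by rewrite mulf_div -!tofracM !rmorphM.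
Qed.

HB.instance Definition _ :=
  GRing.isZmodMorphism.Build _ _ fm frac_map_is_zmod_morphism.
HB.instance Definition _ :=
  GRing.isMonoidMorphism.Build _ _ fm frac_map_is_monoid_morphism.
End FracMap.

(* [localization f] is R[1/f] (for f != 0), realised inside the fraction field. *)
Section Localization.
Variables (R : idomainType) (f : R).

Definition loc_pred : {pred {fraction R}} := fun x =>
  `[< exists (a : R) (m : nat), x = tofrac a / tofrac f ^+ m >].

Lemma loc_pred_subring : subring_closed loc_pred.
Proof.
have [f0|f0] := eqVneq f 0.
  have e (a : R) m : exists b, tofrac a / tofrac f ^+ m = tofrac b.
    case: m => [|m]; first by exists a; rewrite expr0 divr1.
    by exists 0; rewrite f0 tofrac0 expr0n invr0 mulr0.
  have i b : tofrac b \in loc_pred.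
    by apply/asboolP; exists b, 0; rewrite expr0 divr1.
  split; first by rewrite -tofrac1.
    move=> _ _ /asboolP[a [m ->]] /asboolP[b [l ->]].
    by have [? ->] := e a m; have [? ->] := e b l; rewrite -tofracB.
  move=> _ _ /asboolP[a [m ->]] /asboolP[b [l ->]].
  by have [? ->] := e a m; have [? ->] := e b l; rewrite -tofracM.
have fX m : tofrac f ^+ m != 0 by rewrite expf_neq0 // tofrac_eq0.
split; first by apply/asboolP; exists 1, 0; rewrite tofrac1 expr0 divr1.
  move=> _ _ /asboolP[a [m ->]] /asboolP[b [l ->]]; apply/asboolP.
  exists (a * f ^+ l - b * f ^+ m), (m + l)%N.
  by rewrite -mulNr addf_div // exprD tofracB !tofracM !tofracXn mulNr.
move=> _ _ /asboolP[a [m ->]] /asboolP[b [l ->]]; apply/asboolP.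
by exists (a * b), (m + l)%N; rewrite mulf_div exprD tofracM.
Qed.

HB.instance Definition _ :=
  GRing.isSubringClosed.Build _ loc_pred loc_pred_subring.

Record localization := Localization {
  loc_val :> {fraction R};
  loc_valP : loc_val \in loc_pred
}.

HB.instance Definition _ := [isSub for loc_val].
HB.instance Definition _ := [Choice of localization by <:].
HB.instance Definition _ := [SubChoice_isSubComNzRing of localization by <:].

Lemma loc_in_subproof (a : R) : tofrac a \in loc_pred.
Proof. by apply/asboolP; exists a, 0; rewrite expr0 divr1. Qed.

Definition loc_in (a : R) : localization := Localization (loc_in_subproof a).

Lemma loc_in_is_zmod_morphism : zmod_morphism loc_in.
Proof. by move=> a b; apply: val_inj; rewrite rmorphB /= tofracB. Qed.

Lemma loc_in_is_monoid_morphism : monoid_morphism loc_in.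
Proof.
by split=> [|a b]; apply: val_inj; rewrite ?rmorph1 ?rmorphM /= ?tofrac1 ?tofracM.
Qed.

HB.instance Definition _ :=
  GRing.isZmodMorphism.Build _ _ loc_in loc_in_is_zmod_morphism.
HB.instance Definition _ :=
  GRing.isMonoidMorphism.Build _ _ loc_in loc_in_is_monoid_morphism.
End Localization.

(* A commutative k-algebra is given by its structure morphism from k, and a
   k-algebra morphism is a ring morphism compatible with structure morphisms. *)

Definition finitely_generated (k : fieldType) (A : comNzRingType)
    (iA : {rmorphism k -> A}) : Prop :=
  exists (m : nat) (a : 'I_m -> A),
    forall x : A, exists p : {mpoly k[m]}, x = mmap iA a p.

Definition is_quotient_field (A : idomainType) (L : fieldType)
    (j : {rmorphism A -> L}) : Prop :=
  injective j /\
  forall x : L, exists a b : A, b != 0 /\ x = j a / j b.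

Definition retract_rational (k L : fieldType) (iL : {rmorphism k -> L}) : Prop :=
  exists (A : idomainType) (iA : {rmorphism k -> A}) (j : {rmorphism A -> L})
         (n : nat) (f : {mpoly k[n]})
         (phi : {rmorphism A -> localization f})
         (psi : {rmorphism localization f -> A}),
    [/\ finitely_generated iA,
        is_quotient_field j /\ (forall c : k, j (iA c) = iL c),
        f != 0,
        (forall c : k, phi (iA c) = loc_in f c%:MP) /\
        (forall c : k, psi (loc_in f c%:MP) = iA c)
      & forall a : A, psi (phi a) = a].

Section FixedField.
Variables (K : fieldType) (I : finType) (s : I -> {rmorphism K -> K}).

Definition fixed_pred : {pred K} := fun x => [forall i, s i x == x].

Lemma fixed_predP x : reflect (forall i, s i x = x) (x \in fixed_pred).
Proof. exact: 'forall_eqP. Qed.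

Lemma fixed_pred_divring : divring_closed fixed_pred.
Proof.
split; first by apply/fixed_predP => i; rewrite rmorph1.
  by move=> x y /fixed_predP hx /fixed_predP hy; apply/fixed_predP => i;
    rewrite rmorphB hx hy.
by move=> x y /fixed_predP hx /fixed_predP hy; apply/fixed_predP => i;
  rewrite fmorph_div hx hy.
Qed.

HB.instance Definition _ :=
  GRing.isDivringClosed.Build _ fixed_pred fixed_pred_divring.

Record fixed_field := FixedField {
  fixed_val :> K;
  fixed_valP : fixed_val \in fixed_pred
}.

HB.instance Definition _ := [isSub for fixed_val].
HB.instance Definition _ := [Choice of fixed_field by <:].
HB.instance Definition _ := [SubChoice_isSubIntegralDomain of fixed_field by <:].
HB.instance Definition _ := [SubIntegralDomain_isSubField of fixed_field by <:].
End FixedField.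

(* [t i] lists the images of the variables under the i-th substitution of
   k[X_1,..,X_n], which then acts on k(X_1,..,X_n) through [frac_map]. *)
Section RatFunField.
Variables (k : fieldType) (n : nat).

Lemma comp_mpolyA (p : {mpoly k[n]}) (t u : n.-tuple {mpoly k[n]}) :
  (p \mPo t) \mPo u = p \mPo [tuple tnth t i \mPo u | i < n].
Proof.
elim/mpolyind: p => [|c m p _ _ ih]; first by rewrite !raddf0.
rewrite !raddfD /= ih !comp_mpolyZ; congr (_ *: _ + _).
rewrite !comp_mpolyX rmorph_prod; apply: eq_bigr => i _.
by rewrite rmorphXn tnth_mktuple.
Qed.

Definition cst (c : k) : {fraction {mpoly k[n]}} := tofrac c%:MP.

Variables (I : finType) (t : I -> n.-tuple {mpoly k[n]}).
Hypothesis t_inj : forall i, injective (comp_mpoly (t i)).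

Definition ratfun_act (i : I) :
    {rmorphism {fraction {mpoly k[n]}} -> {fraction {mpoly k[n]}}} :=
  frac_map (@t_inj i).

Definition ratfun_fixed : fieldType := fixed_field ratfun_act.

Lemma cst_fixed (c : k) : cst c \in fixed_pred ratfun_act.
Proof.
by apply/fixed_predP => i; rewrite /= frac_map_tofrac /= comp_mpolyC.
Qed.

Definition ratfun_cst (c : k) : ratfun_fixed := FixedField (cst_fixed c).

Lemma ratfun_cst_is_zmod_morphism : zmod_morphism ratfun_cst.
Proof.
by move=> a b; apply: val_inj; rewrite rmorphB /= /cst mpolyCB tofracB.
Qed.

Lemma ratfun_cst_is_monoid_morphism : monoid_morphism ratfun_cst.
Proof.
split=> [|a b]; apply: val_inj; rewrite ?rmorph1 ?rmorphM /= /cst.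
  by rewrite mpolyC1 tofrac1.
by rewrite mpolyCM tofracM.
Qed.

HB.instance Definition _ :=
  GRing.isZmodMorphism.Build _ _ ratfun_cst ratfun_cst_is_zmod_morphism.
HB.instance Definition _ :=
  GRing.isMonoidMorphism.Build _ _ ratfun_cst ratfun_cst_is_monoid_morphism.
End RatFunField.

(* For a representation [rG] of G on the column space V = k^n (g . v = rG g *m v),
   'X_i is the i-th coordinate function on V, so that k[V] = {mpoly k[n]}, and g
   acts on V^* by (g . l)(v) = l(g^-1 . v), i.e.
   g . 'X_i = \sum_j rG g^-1 i j *: 'X_j.
   As [rG] is only meaningful on G, the index type is [subg_of G].
   [kV_fixed rG] is k(V)^G. *)
Section LinearAction.
Variables (k : fieldType) (gT : finGroupType) (G : {group gT}) (n : nat).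
Variable rG : mx_representation k G n.

Definition dual_tuple (g : subg_of G) : n.-tuple {mpoly k[n]} :=
  [tuple \sum_(j < n) rG (sgval g)^-1%g i j *: 'X_j | i < n].

Lemma dual_tuple_inj g : injective (comp_mpoly (dual_tuple g)).
Proof.
apply: (can_inj (g := comp_mpoly (dual_tuple g^-1%g))) => p.
rewrite comp_mpolyA -[RHS]comp_mpoly_id; congr (_ \mPo _).
apply: eq_from_tnth => i; rewrite !tnth_mktuple raddf_sum /=.
under eq_bigr => j _.
  rewrite comp_mpolyZ comp_mpolyXU -tnth_nth tnth_mktuple scaler_sumr.
  under eq_bigr do rewrite scalerA.
  over.
rewrite exchange_big /=.
under eq_bigr do rewrite -scaler_suml.
have gG := subgP g.
have e : rG (sgval g)^-1%g *m rG (sgval g^-1)^-1%g = 1%:M.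
  by rewrite -repr_mxM ?groupV ?subgP // morphV ?inE // invgK mulVg repr_mx1.
transitivity (\sum_j (i == j)%:R *: 'X_j : {mpoly k[n]}).
  apply: eq_bigr => j _; congr (_ *: _).
  by move/matrixP/(_ i j): e; rewrite !mxE.
rewrite (bigD1 i) //= eqxx scale1r big1 ?addr0 // => j ji.
by rewrite eq_sym (negPf ji) scale0r.
Qed.

Definition kV_fixed : fieldType := ratfun_fixed dual_tuple_inj.
Definition kV_cst : {rmorphism k -> kV_fixed} := ratfun_cst dual_tuple_inj.
End LinearAction.

(* k(G): the variable x_g is 'X_(gring_index G g), and h . x_g = x_(hg);
   [kG_fixed k G] is k(G). *)
Section Noether.
Variables (k : fieldType) (gT : finGroupType) (G : {group gT}).

Definition noether_tuple (h : subg_of G) : #|G|.-tuple {mpoly k[#|G|]} :=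
  [tuple 'X_(gring_index G (sgval h * enum_val i)%g) | i < #|G|].

Lemma noether_tuple_inj h : injective (comp_mpoly (noether_tuple h)).
Proof.
apply: (can_inj (g := comp_mpoly (noether_tuple h^-1%g))) => p.
rewrite comp_mpolyA -[RHS]comp_mpoly_id; congr (_ \mPo _).
apply: eq_from_tnth => i; rewrite !tnth_mktuple comp_mpolyXU -tnth_nth.
rewrite tnth_mktuple gring_indexK ?groupM ?subgP ?enum_valP //.
by rewrite mulgA morphV ?inE // mulVg mul1g gring_valK.
Qed.

Definition kG_fixed : fieldType := ratfun_fixed noether_tuple_inj.
Definition kG_cst : {rmorphism k -> kG_fixed} := ratfun_cst noether_tuple_inj.
End Noether.

(* Main.v *)
From HB Require Import structures.
Require Import Defs.
From mathcomp Require Import all_boot all_order all_algebra.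
From mathcomp Require Import all_fingroup all_solvable all_field all_character.
From mathcomp Require Import boolp.
From mathcomp Require Import mpoly.

(** Let F = k(V), with G acting faithfully (the kernel of the action is divided
    out), and put D = Hom(H, Z/e), e = exp H, r = the order of tau modulo H,
    m = ord tau, n1 = m/r.  Dedekind's independence of automorphisms gives
    elements w_psi (psi in D) and Y of F on which G acts by permuting the psi and
    by scalars of k, so monomials in them have every G-weight.  The kernel I of
    the degree map Z[D] -> D has vanishing H^-1 for the subgroups of <tau>, and
    for a lattice over a cyclic p-group this yields a tau-stable family that is
    a basis modulo p.  By transfer and Bezout one finds tau-permuted H-invariant
    monomials a_j such that, after adjoining al_j with al_j^e = a_j and Z with
    Z^n1 = Y, every weight is realised by some Z^l * prod_j al_j^h_j.

    A coordinate x_i of V is a combination of such monomials with coefficients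
    in F^G.  Replacing al_j, Z and the coefficients by independent variables
    lifts x_i to a polynomial, in such a way that scaling the al_j by e-th roots
    of unity and rotating by tau act on the lifts through G.  An invariant of
    k[V] thus lifts to a polynomial in the al_j^e invariant under the rotation,
    and expanding a_j in powers of Y over F^G descends it to a polynomial ring
    over k.  Specialising the variables recovers the invariant, so F^G is a
    retract, up to localisation, of a polynomial ring. *)

Set Implicit Arguments.
Unset Strict Implicit.
Unset Printing Implicit Defensive.

Import GRing.Theory Num.Theory.
Local Open Scope ring_scope.

(** * Lattices over a cyclic p-group *)

(** The obstacle is that the kernel I of Z[D] -> D need not be a permutation lattice for tau, so F^G
    is not visibly rational. The lifting needs less. Multiplication by e induces an equivariant map
    D -> I/eI, chi -> e[chi], and it suffices to factor it through (Z/e)[J] for some J permuted by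
    tau: the components D -> Z/e are the exponents h_j, and the basis vectors go to the monomials
    a_j. By duality each component is evaluation at an element of H, which is why scaling al_j acts
    on the lifts through G. The size of J is not controlled, so only a retract results. The integers
    c for which c times the map factors form an ideal; the question is therefore local at each
    prime, where a cyclic p-group acts and vanishing of H^-1 is strong enough. Two roots of unity
    play different roles: one of order exp H diagonalises H, while the order of tau enters because
    tau^r lies in H, so the scalar attached to tau must be an r-th root of the value of a character
    at tau^r. *)

Lemma sum_expr_mul (R : nzRingType) (x : R) m l :
  \sum_(a < m * l) x ^+ a = (\sum_(a < m) x ^+ a) * \sum_(b < l) x ^+ m ^+ b.
Proof.
elim: l => [|l IHl]; first by rewrite muln0 !big_ord0 mulr0.
rewrite mulnSr big_split_ord /= IHl big_ord_recr /= mulrDr; congr (_ + _).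
by rewrite mulr_suml; apply: eq_bigr => a _; rewrite -exprM -exprD addnC.
Qed.

Section CyclicLattice.
Variables (p n N : nat) (S : 'M[int]_N.+1).
Hypothesis p_pr : prime p.
Hypothesis S_exp : S ^+ (p ^ n) = 1.
(* H^-1 vanishes for each subgroup <S^(p^i)>. *)
Hypothesis coflabby : forall i (z : 'rV[int]_N.+1), (i <= n)%N ->
  z *m (\sum_(a < p ^ (n - i)) S ^+ (p ^ i) ^+ a) = 0 ->
  exists c, z = c *m (S ^+ (p ^ i) - 1).

Definition red_mod m1 m2 : 'M[int]_(m1, m2) -> 'M['F_p]_(m1, m2) :=
  map_mx (intr : int -> 'F_p).

Lemma red_mod_surj m1 m2 (x : 'M['F_p]_(m1, m2)) : exists z, red_mod z = x.
Proof.
exists (map_mx (fun a : 'F_p => (a : nat)%:Z) x).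
by apply/matrixP => i j; rewrite !mxE /= -pmulrn natr_Zp.
Qed.

Lemma red_mod_eq0 m1 m2 (z : 'M[int]_(m1, m2)) :
  red_mod z = 0 -> exists b, z = p%:Z *: b.
Proof.
move=> /matrixP z0; exists (map_mx (fun a : int => (a %/ p)%Z) z).
apply/matrixP => i j; rewrite !mxE mulrC divzK //.
by rewrite (dvdz_pcharf (pchar_Fp p_pr)); have := z0 i j; rewrite !mxE => ->.
Qed.

Lemma red_modM m1 m2 m3 (x : 'M_(m1, m2)) (y : 'M_(m2, m3)) :
  red_mod (x *m y) = red_mod x *m red_mod y.
Proof. exact: map_mxM. Qed.

Lemma red_modB m1 m2 (x y : 'M_(m1, m2)) : red_mod (x - y) = red_mod x - red_mod y.
Proof. exact: map_mxB. Qed.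

Lemma red_modD m1 m2 (x y : 'M_(m1, m2)) : red_mod (x + y) = red_mod x + red_mod y.
Proof. exact: map_mxD. Qed.

Lemma red_mod_scale m1 m2 (x : 'M_(m1, m2)) : red_mod (p%:Z *: x) = 0.
Proof.
apply/matrixP => i j; rewrite !mxE rmorphM /=.
by rewrite -pmulrn pchar_Fp_0 // mul0r.
Qed.

Lemma red_modX a : red_mod (S ^+ a) = red_mod S ^+ a.
Proof. exact: rmorphXn. Qed.

Lemma scaler_p_inj m1 m2 : injective (fun z : 'M[int]_(m1, m2) => p%:Z *: z).
Proof.
move=> x y /matrixP e; apply/matrixP => i j; move: (e i j); rewrite !mxE.
by apply: mulfI; rewrite eqz_nat -lt0n prime_gt0.
Qed.

Let nu : 'M['F_p]_N.+1 := red_mod S - 1.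

Lemma nuX i : nu ^+ (p ^ i) = red_mod S ^+ (p ^ i) - 1.
Proof.
have pcM : p \in [pchar 'M['F_p]_N.+1] by rewrite pchar_lalg pchar_Fp.
elim: i => [|i IHi]; first by rewrite expn0 !expr1.
rewrite expnSr !exprM IHi -!(pFrobenius_autE pcM) pFrobenius_autB_comm.
  by rewrite pFrobenius_aut1.
exact: commr1.
Qed.

(* (X^q - 1)/(X - 1) = (X - 1)^(q - 1) in characteristic p, for q = p^i. *)
Lemma sum_red_modX i :
  \sum_(a < p ^ i) red_mod S ^+ a = nu ^+ (p ^ i).-1.
Proof.
have pcP : p \in [pchar {poly 'F_p}] by rewrite pchar_lalg pchar_Fp.
have e : \sum_(a < p ^ i) 'X ^+ a = ('X - 1) ^+ (p ^ i).-1 :> {poly 'F_p}.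
  have X0 : 'X - 1 != 0 :> {poly 'F_p} by rewrite polyXsubC_eq0.
  apply: (mulfI X0); rewrite -subrX1 -exprS prednK ?expn_gt0 ?prime_gt0 //.
  elim: i => [|i IHi]; first by rewrite expn0 !expr1.
  rewrite expnSr [RHS]exprM -IHi exprM -!(pFrobenius_autE pcP).
  rewrite pFrobenius_autB_comm ?pFrobenius_aut1 //; exact: commr1.
have := congr1 (horner_mx (red_mod S)) e.
rewrite rmorph_sum rmorphXn rmorphB rmorph1 /= horner_mx_X => <-.
by apply: eq_bigr => a _; rewrite rmorphXn /= horner_mx_X.
Qed.

(** An integral lift z is invariant up to [p%:Z *: b]. The norm kills b because the lattice has no
    p-torsion, so [coflabby] makes b a coboundary of some c, and z - p c is invariant. *)
Lemma lift_invariant i (x : 'rV['F_p]_N.+1) : (i <= n)%N ->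
  x *m nu ^+ (p ^ i) = 0 ->
  exists y, red_mod y = x /\ y *m S ^+ (p ^ i) = y.
Proof.
move=> le_in x0; have [z zx] := red_mod_surj x.
have [b zb] : exists b, z *m (S ^+ (p ^ i) - 1) = p%:Z *: b.
  apply: red_mod_eq0; rewrite red_modM zx -x0 nuX red_modB red_modX.
  by rewrite /red_mod map_mx1.
have [|c bc] := coflabby le_in (z := b).
  apply: (@scaler_p_inj 1); rewrite scalemxAl -zb scaler0 -mulmxA.
  have -> : (S ^+ (p ^ i) - 1) *m (\sum_(a < p ^ (n - i)) S ^+ (p ^ i) ^+ a)
     = 0 by rewrite -[_ *m _]subrX1 -exprM -expnD subnKC // S_exp subrr.
  by rewrite mulmx0.
exists (z - p%:Z *: c); split.
  by rewrite red_modB red_mod_scale subr0.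
apply/eqP; rewrite -subr_eq0 -{2}[z - _]mulmx1 -mulmxBr mulmxBl zb bc.
by rewrite scalemxAl subrr.
Qed.

(* With N the norm from <S^(p^j)> to <S^(p^(j+1))>, lift v to an invariant u and
   write u = b N; coflabbiness lets one correct b to an S-invariant b', whence
   u = p b' + c (1 + S + ... + S^(p^(j+1) - 1)). *)
Lemma socle_jump j (v : 'rV['F_p]_N.+1) : (j < n)%N ->
  v *m nu = 0 -> (v <= nu ^+ (p ^ j))%MS -> (v <= nu ^+ (p ^ j.+1).-1)%MS.
Proof.
move=> lt_jn v0 /submxP[w vw].
have p_gt0 := prime_gt0 p_pr; have p_gt1 := prime_gt1 p_pr.
have [y [yw yS]] : exists y, red_mod y = w /\ y *m S ^+ (p ^ j.+1) = y.
  apply: lift_invariant => //.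
  have lt_j : (p ^ j < p ^ j.+1)%N by rewrite ltn_exp2l.
  by rewrite -(subnKC lt_j) exprD mulmxA exprSr mulmxA -vw v0 mul0mx.
have [u [uv uS]] : exists u, red_mod u = v /\ u *m S ^+ (p ^ 0) = u.
  by apply: lift_invariant => //; rewrite expn0 expr1.
rewrite expn0 expr1 in uS.
set q := (p ^ j)%N in vw *.
have [b ub] : exists b, u - y *m (S ^+ q - 1) = p%:Z *: b.
  apply: red_mod_eq0; rewrite red_modB uv red_modM yw.
  by rewrite {1}vw nuX red_modB red_modX [red_mod 1]map_mx1 subrr.
pose Np := \sum_(a < p) S ^+ q ^+ a.
have SqNp : (S ^+ q - 1) *m Np = S ^+ (p ^ j.+1) - 1.
  by rewrite -[_ *m _]subrX1 -exprM -expnSr.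
have uX a : u *m S ^+ a = u.
  by elim: a => [|a IHa]; rewrite ?expr0 ?mulmx1 // exprSr mulmxA IHa uS.
have uNp : u = b *m Np.
  apply: (@scaler_p_inj 1); rewrite scalemxAl -ub mulmxBl -mulmxA SqNp.
  rewrite mulmxBr yS mulmx1 subrr subr0 mulmx_sumr.
  under eq_bigr do rewrite -exprM uX.
  by rewrite sumr_const card_ord -scaler_nat natz.
have [c bc] : exists c, b *m (S - 1) = c *m (S ^+ q - 1).
  have := @coflabby j (b *m (S - 1)) (ltnW lt_jn); rewrite -/q; apply.
  have -> : \sum_(a < p ^ (n - j)) S ^+ q ^+ a =
      Np *m \sum_(a < p ^ (n - j.+1)) S ^+ (p ^ j.+1) ^+ a.
    by rewrite -(subnSK lt_jn) expnS sum_expr_mul -exprM -expnSr.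
  rewrite mulmxA -[_ *m Np]mulmxA.
  have -> : (S - 1) *m Np = Np *m (S - 1).
    by rewrite mulmxBl mulmxBr mul1mx mulmx1 mulmx_suml mulmx_sumr;
       congr (_ - _); apply: eq_bigr => a _;
       apply: (@commrX _ S); apply: commrX.
  by rewrite mulmxA -uNp mulmxBr uS mulmx1 subrr mul0mx.
pose Nq := \sum_(a < q) S ^+ a.
have Nq1 : Nq *m (S - 1) = S ^+ q - 1.
  rewrite subrX1 mulmx_suml mulr_sumr; apply: eq_bigr => a _.
  by rewrite mulmxBr mulmx1 mulrBl mul1r -[_ *m _]exprSr -exprS.
have NqNp : Nq *m Np = \sum_(a < p ^ j.+1) S ^+ a.
  by rewrite expnSr sum_expr_mul.
pose b' := b - c *m Nq.
have b'S a : b' *m S ^+ a = b'.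
  have b'1 : b' *m S = b'.
    apply/eqP; rewrite -subr_eq0 -{2}[b']mulmx1 -mulmxBr mulmxBl bc -mulmxA.
    by rewrite Nq1 subrr.
  by elim: a => [|a IHa]; rewrite ?expr0 ?mulmx1 // exprSr mulmxA IHa b'1.
have uE : u = p%:Z *: b' + c *m \sum_(a < p ^ j.+1) S ^+ a.
  rewrite uNp -[b](subrK (c *m Nq)) -/b' mulmxDl -mulmxA NqNp; congr (_ + _).
  rewrite mulmx_sumr; under eq_bigr do rewrite -exprM b'S.
  by rewrite sumr_const card_ord -scaler_nat natz.
apply/submxP; exists (red_mod c).
rewrite -uv uE -sum_red_modX red_modD red_mod_scale add0r red_modM.
congr (_ *m _); rewrite /red_mod rmorph_sum.
by apply: eq_bigr => a _; exact: rmorphXn.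
Qed.

(* The ranks of the V a count the Jordan blocks of nu; by [socle_jump] V only drops
   at a = p^j, so all blocks have size a power of p. *)
Let V a : 'M['F_p]_N.+1 := (nu ^+ a :&: kermx nu)%MS.
Let W j := V (p ^ j).-1.
Let U j := (W j :\: W j.+1)%MS.
Let r j := \rank (U j).

Let V_anti a b : (a <= b)%N -> (V b <= V a)%MS.
Proof.
move=> le_ab; apply: capmxS => //.
by rewrite -(subnK le_ab) exprD submxMl.
Qed.

Let nu_nil a : (p ^ n <= a)%N -> nu ^+ a = 0.
Proof.
move=> le_na; rewrite -(subnKC le_na) exprD nuX -red_modX S_exp.
by rewrite [red_mod 1]map_mx1 subrr mul0r.
Qed.

Let pX_gt0 j : (0 < p ^ j)%N.
Proof. by rewrite expn_gt0 prime_gt0. Qed.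

Let W_last : W n.+1 = 0.
Proof.
rewrite /W /V nu_nil ?cap0mx // -ltnS prednK // ltn_exp2l ?prime_gt1 //.
Qed.

Let V_W a : (a < p ^ n)%N -> exists j,
  [/\ (j <= n)%N, forall i, (a < p ^ i)%N = (j <= i)%N & (V a == W j)%MS].
Proof.
move=> lt_an; have ex_j : exists j, (a < p ^ j)%N by exists n.
have [j lt_aj j_min] := ex_minnP ex_j; exists j.
have le_jn : (j <= n)%N by apply: j_min.
split=> // [i|].
  apply/idP/idP => [/j_min //|le_ji].
  by rewrite (leq_trans lt_aj) // leq_exp2l ?prime_gt1.
apply/andP; split; last by apply: V_anti; rewrite -ltnS prednK.
case: j => [|j] in lt_aj j_min le_jn *.
  by move: lt_aj; rewrite /W expn0 ltnS leqn0 => /eqP->.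
have le_ja : (p ^ j <= a)%N.
  by rewrite leqNgt; apply/negP => /j_min; rewrite ltnn.
apply: submx_trans (V_anti le_ja) _; apply/rV_subP => v.
rewrite sub_capmx => /andP[v_im /sub_kermxP v_ker].
by rewrite sub_capmx socle_jump //=; apply/sub_kermxP.
Qed.

Let rank_W j : (j <= n.+1)%N -> \rank (W j) = (\sum_(j <= i < n.+1) r i)%N.
Proof.
move=> le_jn; rewrite -(subKn le_jn).
elim: (n.+1 - j)%N (leq_subr j n.+1) => [|d IHd] le_dn.
  by rewrite subn0 W_last mxrank0 big_geq.
rewrite big_ltn ?ltn_subrL //  subnSK // -IHd 1?ltnW // /r /U subnSK //.
rewrite addnC -[LHS](mxrank_cap_compl _ (W (n.+1 - d))); congr (_ + _)%N.
apply: eqmx_rank; apply/andP; split; first exact: capmxSr.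
rewrite sub_capmx submx_refl andbT; apply: V_anti.
by rewrite -ltnS !prednK // leq_exp2l ?prime_gt1 // leq_sub2l.
Qed.

Let rank_V a : (a < p ^ n)%N -> \rank (V a) = (\sum_(i < n.+1 | a < p ^ i) r i)%N.
Proof.
move=> lt_an; have [j [le_jn lt_a eqVW]] := V_W lt_an.
rewrite (eqmx_rank eqVW) rank_W; last exact: ltnW.
under [RHS]eq_bigl do rewrite lt_a.
by rewrite (big_nat_widenl j 0) // big_mkord.
Qed.

(** Here [r i] counts the Jordan blocks of size [p ^ i]. The rank of [nu ^+ a] drops by
    [\rank (V a)] at the next power, and a block of size p^i contributes 1 for each a < p^i. *)
Let sum_ranks : (\sum_(i < n.+1) r i * p ^ i)%N = N.+1.
Proof.
have rank_nu a : (\sum_(b < a) \rank (V b) + \rank (nu ^+ a))%N = N.+1.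
  elim: a => [|a IHa]; first by rewrite big_ord0 expr0 mxrank1.
  rewrite big_ord_recr /= -[RHS]IHa -addnA; congr (_ + _)%N.
  by rewrite -(mxrank_mul_ker (nu ^+ a) nu) -[_ *m nu]exprSr addnC.
have := rank_nu (p ^ n)%N; rewrite nu_nil // mxrank0 addn0 => <-.
under [RHS]eq_bigr => a _ do rewrite rank_V // big_mkcond.
rewrite exchange_big /=; apply: eq_bigr => i _.
rewrite -big_mkcond /=.
have le_in : (p ^ i <= p ^ n)%N by rewrite leq_exp2l ?prime_gt1 // -ltnS.
by rewrite (big_ord_narrow le_in) sum_nat_const card_ord mulnC.
Qed.

(** A block of size p^i has socle vector [w *m nu ^+ (p ^ i).-1]. As nu^(p^i) kills w, w lifts to a
    vector y fixed by S^(p^i), whose p^i translates under S are permuted cyclically and reduce to a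
    spanning set of the block generated by w. *)
Lemma cyclic_lattice_perm : exists (J : finType) (sJ : J -> J)
    (y : J -> 'rV[int]_N.+1),
  [/\ #|J| = N.+1, forall j, iter (p ^ n) sJ j = j,
      forall j, y j *m S = y (sJ j)
    & forall x : 'rV['F_p]_N.+1,
      exists c : J -> 'F_p, x = \sum_j c j *: red_mod (y j)].
Proof.
pose D := {j : 'I_n.+1 & 'I_(r j)}.
have /fin_all_exists[y yP] (d : D) : exists y : 'rV[int]_N.+1,
    red_mod y *m nu ^+ (p ^ tag d).-1 = row (tagged d) (row_base (U (tag d))) /\
    y *m S ^+ (p ^ tag d) = y.
  case: d => j c /=; set v := row _ _.
  have : (v <= W j)%MS.
    apply: submx_trans (diffmxSl _ (W j.+1)).
    by rewrite (submx_trans (row_sub _ _)) ?eq_row_base.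
  rewrite sub_capmx => /andP[/submxP[w ->] /sub_kermxP v_ker].
  have [||y [yw yS]] := @lift_invariant j w; first by rewrite -ltnS.
    by rewrite -v_ker -mulmxA -[_ *m nu]exprSr prednK.
  by exists y; rewrite yw.
pose J := {d : D & 'I_(p ^ tag d)}.
pose sJ (j : J) : J := Tagged (fun d : D => 'I_(p ^ tag d)) (ordS (tagged j)).
pose yJ (j : J) := y (tag j) *m S ^+ tagged j.
have yS (d : D) a : y d *m S ^+ a = y d *m S ^+ (a %% p ^ tag d).
  rewrite {1}(divn_eq a (p ^ tag d)) exprD mulmxA; congr (_ *m _).
  elim: (a %/ _)%N => [|b IHb]; first by rewrite mul0n expr0 mulmx1.
  by rewrite mulSn exprD mulmxA (yP d).2.
exists J, sJ, yJ; split.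
- rewrite -sum_ranks card_tagged sumnE big_map big_enum /=.
  under eq_bigr do rewrite card_ord.
  rewrite -(sig_big_dep xpredT (fun _ => xpredT) (fun (j : 'I_n.+1) (_ : 'I_(r j)) => p ^ j)%N) /=.
  by apply: eq_bigr => j _; rewrite sum_nat_const card_ord.
- case=> d i.
  have sJE a : exists lt_a, iter a sJ (Tagged (fun d : D => 'I_(p ^ tag d)) i) =
     Tagged (fun d : D => 'I_(p ^ tag d)) (@Ordinal (p ^ tag d) ((i + a) %% p ^ tag d) lt_a).
    elim: a => [|a [lt_a IHa]].
      have lt_i : ((i + 0) %% p ^ tag d < p ^ tag d)%N by rewrite ltn_mod.
      exists lt_i; congr Tagged; apply: val_inj => /=.
      by rewrite addn0 modn_small.
    have lt_Sa : ((i + a.+1) %% p ^ tag d < p ^ tag d)%N by rewrite ltn_mod.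
    exists lt_Sa; rewrite iterS IHa /sJ /=; congr Tagged; apply: val_inj => /=.
    by rewrite addnS -addn1 modnDml addn1.
  have [lt_a ->] := sJE (p ^ n)%N; congr Tagged; apply: val_inj => /=.
  have /dvdnP[b ->] : (p ^ tag d %| p ^ n)%N by rewrite dvdn_exp2l // -ltnS.
  by rewrite addnC modnMDl modn_small.
- case=> d i; rewrite /yJ /sJ /= -mulmxA -[_ *m S]exprSr yS.
  by rewrite [RHS]yS modn_mod.
(* X is the span of all the reductions; it is stable under nu, and it is shown to be everything by
   comparing socles. *)
pose X := (\sum_j <<red_mod (yJ j)>>)%MS.
have yX d b : (red_mod (y d) *m nu ^+ b <= X)%MS.
  have X_T : (X *m red_mod S <= X)%MS.
    rewrite sumsmxMr; apply/sumsmx_subP => -[d' i] _.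
    apply: submx_trans (sumsmx_sup (sJ (Tagged (fun d : D => 'I_(p ^ tag d)) i)) _ (submx_refl _)) => //.
    rewrite (eqmxMr _ (genmxE _)) genmxE -red_modM /yJ /sJ /=.
    by rewrite -mulmxA -[_ *m S]exprSr yS.
  have X_nu : (X *m nu <= X)%MS.
    by rewrite mulmxBr mulmx1 addmx_sub // eqmx_opp.
  elim: b => [|b IHb]; last first.
    rewrite exprSr mulmxA; apply: submx_trans X_nu; exact: submxMr.
  rewrite expr0 mulmx1.
  have lt_0 : (0 < p ^ tag d)%N by [].
  apply: submx_trans (sumsmx_sup (Tagged (fun d : D => 'I_(p ^ tag d)) (Ordinal lt_0)) _ (submx_refl _)) => //.
  by rewrite genmxE /yJ /= expr0 mulmx1.
have UX i a : (i <= n)%N -> (a < p ^ i)%N -> (U i <= X *m nu ^+ a)%MS.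
  rewrite -ltnS => lt_in lt_ai; rewrite -(eq_row_base (U i)).
  apply/row_subP => c.
  have := (yP (Tagged (fun j : 'I_n.+1 => 'I_(r j)) (c : 'I_(r (Ordinal lt_in))))).1.
  rewrite /= => <-.
  have le_ai : (a <= (p ^ i).-1)%N by rewrite -ltnS prednK.
  by rewrite -(subnK le_ai) exprD mulmxA submxMr.
have WX a d : (d <= n.+1)%N -> (a < p ^ (n.+1 - d))%N ->
    (W (n.+1 - d) <= X *m nu ^+ a)%MS.
  elim: d => [|d IHd] le_dn lt_a; first by rewrite subn0 W_last sub0mx.
  rewrite -(addsmx_diff_cap_eq _ (W (n.+1 - d))) addsmx_sub.
  rewrite -{1}(subnSK le_dn) UX ?leq_subr //=.
    apply: submx_trans (capmxSr _ _) (IHd (ltnW le_dn) _).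
    by rewrite (leq_trans lt_a) // leq_exp2l ?prime_gt1 // leq_sub2l.
  by rewrite -ltnS (leq_trans _ (leq_subr d _)) // subnSK.
have VX a : (V a <= X *m nu ^+ a)%MS.
  have [lt_an|le_na] := ltnP a (p ^ n); last by rewrite /V nu_nil // cap0mx sub0mx.
  have [j [le_jn lt_a /andP[leVW _]]] := V_W lt_an.
  apply: submx_trans leVW _; rewrite -(subKn (leqW le_jn)) WX ?leq_subr //.
  by rewrite subKn ?lt_a // leqW.
(* If x is killed by nu^(a+1), then x nu^a lies in [V a], hence equals w X nu^a for some w, and x -
   w X is killed by nu^a. *)
have kerX a : (kermx (nu ^+ a) <= X)%MS.
  elim: a => [|a IHa]; apply/rV_subP => x /sub_kermxP.
    by rewrite expr0 mulmx1 => ->; rewrite sub0mx.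
  rewrite exprSr mulmxA => x_ker.
  have /submxP[w xw] : (x *m nu ^+ a <= X *m nu ^+ a)%MS.
    apply: submx_trans (VX a); rewrite sub_capmx submxMl.
    exact/sub_kermxP.
  rewrite -(subrK (w *m X) x) addmx_sub ?submxMl //.
  by apply: submx_trans IHa; apply/sub_kermxP; rewrite mulmxBl xw mulmxA subrr.
move=> x; have : (x <= X)%MS.
  apply: submx_trans (kerX (p ^ n)%N).
  by apply/sub_kermxP; rewrite nu_nil // mulmx0.
move/sub_sumsmxP=> [u ->].
have /fin_all_exists[c cP] j : exists c, u j *m <<red_mod (yJ j)>>%MS = c *: red_mod (yJ j).
  have : (u j *m <<red_mod (yJ j)>> <= red_mod (yJ j))%MS.
    by rewrite (submx_trans (submxMl _ _)) ?genmxE.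
  by move/sub_rVP=> [c ->]; exists c.
by exists c; apply: eq_bigr => j _; rewrite cP.
Qed.

End CyclicLattice.

(** * Integral kernel lattices and additive Hilbert 90 *)

Lemma mulmx_det_inj (N m : nat) (B : 'M[int]_N) (x y : 'M[int]_(m, N)) :
  \det B != 0 -> x *m B = y *m B -> x = y.
Proof.
move=> dB /(congr1 (mulmx^~ (\adj B))); rewrite -!mulmxA mul_mx_adj.
rewrite !mul_mx_scalar => /matrixP e; apply/matrixP => i j.
by have := e i j; rewrite !mxE => /(mulfI dB).
Qed.

(** The kernel contains e Z^N, so it is generated by e Z^N and its finitely many elements with
    coordinates in [0, e). The Smith normal form replaces these generators by N of them, independent
    because they generate e Z^N. *)
Lemma int_kernel_basis (N : nat) (D : zmodType) (e : nat)
    (f : {additive 'rV[int]_N -> D}) :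
  (0 < e)%N -> (forall x : D, x *+ e = 0) ->
  exists2 B : 'M[int]_N, \det B != 0 &
    forall v, f v = 0 <-> exists mu, v = mu *m B.
Proof.
move=> e_gt0 De.
pose Om := {ffun 'I_N -> 'I_e}.
pose w (g : Om) : 'rV[int]_N := \row_i (g i : nat)%:Z.
(* Vectors outside the kernel become zero rows, so the rows of M generate exactly the kernel. *)
pose M : 'M[int]_(N + #|Om|, N) := col_mx (e%:Z)%:M
  (\matrix_(a < #|Om|) (if f (w (enum_val a)) == 0 then w (enum_val a) else 0)).
have [L Lu [R Ru [d _ MLR]]] := int_Smith_normal_form M.
pose Dg : 'M[int]_N := \matrix_(i, j) (d`_i *+ (i == j :> nat)).
have DE : \matrix_(i < N + #|Om|, j < N) (d`_i *+ (i == j :> nat)) = col_mx Dg 0.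
  apply/matrixP => i j; rewrite !mxE; case: splitP => a ->; rewrite !mxE //.
  by rewrite gtn_eqF // (leq_trans (ltn_ord j)) ?leq_addr.
rewrite DE in MLR.
have MB m (x : 'M_(m, _)) : x *m M = lsubmx (x *m L) *m (Dg *m R).
  rewrite {1}MLR !mulmxA -[x *m L]hsubmxK mul_row_col mulmx0 addr0.
  by rewrite hsubmxK.
have fM x : f (x *m M) = 0.
  rewrite mulmx_sum_row raddf_sum big1 // => i _.
  rewrite -[x 0 i]intz scaler_int raddfMz.
  suff -> : f (row i M) = 0 by rewrite mul0rz.
  case: (splitP i) => a ia.
    have -> : i = lshift _ a by apply: val_inj.
    rewrite rowKu -scalemx1 linearZ /= -[e%:Z]intz scaler_int raddfMz.
    by rewrite -pmulrn De.
  have -> : i = rshift _ a by apply: val_inj.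
  by rewrite rowKd rowK; case: eqP => // _; rewrite raddf0.
exists (Dg *m R).
  have /(congr1 determinant) := MB _ (row_mx 1%:M 0).
  rewrite mul_row_col mul1mx mul0mx addr0 det_scalar det_mulmx => eN.
  apply/negP => /eqP d0; move: eN; rewrite d0 mulr0 => /eqP.
  by rewrite expf_eq0 eqz_nat gtn_eqF // andbF.
move=> v; split=> [fv|[mu ->]]; last first.
  have -> : mu *m (Dg *m R) = (row_mx mu 0 *m invmx L) *m M.
    by rewrite MB mulmxKV // row_mxKl.
  exact: fM.
have lt_e i : (`|(v ord0 i %% e)%Z| < e)%N.
  by rewrite -ltz_nat gez0_abs ?modz_ge0 ?ltz_pmod // eqz_nat -lt0n.
pose g : Om := [ffun i => Ordinal (lt_e i)].
have vE : v = e%:Z *: (\row_i (v ord0 i %/ e)%Z) + w g.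
  apply/rowP => i; rewrite !mxE ffunE /= gez0_abs ?modz_ge0 ?eqz_nat -?lt0n //.
  by rewrite mulrC -divz_eq.
have fw : f (w g) = 0.
  move: fv; rewrite {1}vE raddfD /= -[e%:Z]intz scaler_int raddfMz.
  by rewrite -pmulrn De add0r.
exists (lsubmx (row_mx (\row_i (v ord0 i %/ e)%Z) (delta_mx 0 (enum_rank g)) *m L)).
rewrite -MB mul_row_col mul_mx_scalar -rowE rowK enum_rankK fw eqxx.
exact: vE.
Qed.

Lemma iter_id_inj (T : Type) (g : T -> T) o :
  (0 < o)%N -> (forall x, iter o g x = x) -> injective g.
Proof.
case: o => // o _ go x y; move/(congr1 (iter o g)).
by rewrite -!iterSr !go.
Qed.

(** In o steps a cycle is run through a whole number of times, so v sums to zero on every cycle;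
    then minus the partial sums from the root of the cycle are a consistent choice of c. *)
Lemma perm_hilbert90 (D : finType) (g : D -> D) (o : nat) (v : D -> int) :
  (0 < o)%N -> (forall x, iter o g x = x) ->
  (forall x, \sum_(a < o) v (iter a g x) = 0) ->
  exists c : D -> int, forall x, v (g x) = c x - c (g x).
Proof.
move=> o_gt0 go v0; have g_inj := iter_id_inj o_gt0 go.
pose rt := froot g.
have rtC x : fconnect g (rt x) x.
  by rewrite (fconnect_sym g_inj) connect_root.
have rtg x : rt (g x) = rt x.
  apply/esym/eqP; rewrite root_connect ?fconnect1 //; exact: fconnect_sym.
have orbit0 x : \sum_(a < fingraph.order g x) v (iter a g x) = 0.
  have iter_mul b : iter (fingraph.order g x * b) g x = x.
    by elim: b => [|b IHb]; rewrite ?muln0 // mulnS iterD IHb fingraph.iter_order.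
  have /dvdnP[l ol] : (fingraph.order g x %| o)%N.
    rewrite /dvdn; set r := (o %% _)%N.
    have lt_r : (r < fingraph.order g x)%N by rewrite ltn_mod fingraph.order_gt0.
    have : iter r g x = x.
      have := go x; rewrite (divn_eq o (fingraph.order g x)) addnC iterD mulnC.
      by rewrite iter_mul.
    by move/(congr1 (findex g x)); rewrite findex_iter // findex0 => ->.
  have l_gt0 : (0 < l)%N by case: l ol o_gt0 => // ->.
  have sum_mul b : \sum_(a < fingraph.order g x * b) v (iter a g x) =
      (\sum_(a < fingraph.order g x) v (iter a g x)) *+ b.
    elim: b => [|b IHb]; first by rewrite muln0 big_ord0.
    rewrite mulnSr big_split_ord /= IHb mulrSr; congr (_ + _).
    by apply: eq_bigr => a _; rewrite addnC iterD iter_mul.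
  have := v0 x; rewrite ol mulnC sum_mul => /eqP.
  by rewrite mulrn_eq0 gtn_eqF //= => /eqP.
exists (fun x => - \sum_(b < (findex g (rt x) x).+1) v (iter b g (rt x))).
move=> x; rewrite rtg opprK.
have lt_k := findex_max (rtC x); have gk := iter_findex (rtC x).
set k := findex g (rt x) x in lt_k gk *.
have gSk : iter k.+1 g (rt x) = g x by rewrite iterS gk.
(* The sums telescope except where g x is the root again; there the full cycle sum vanishes. *)
case: (ltngtP k.+1 (fingraph.order g (rt x))) lt_k => // [lt_k _|eq_k _].
  rewrite -[in findex _ _ (g x)]gSk findex_iter // [X in _ + X]big_ord_recr /=.
  by rewrite gk addKr.
rewrite eq_k fingraph.iter_order // in gSk.
by rewrite -gSk findex0 eq_k orbit0 oppr0 add0r big_ord1.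
Qed.

(** * Pairings of D through permuted index sets *)

Section PermPairing.
Variables (D : finZmodType) (t : D -> D) (o e : nat).

Definition divisor_degree (v : D -> int) : D := \sum_psi psi *~ v psi.

(* [perm_pairing c]: c times the tautological element of Hom(D, D) is induced, via a
   permuted index set J, by functions h_j that are additive modulo e and elements
   iota_j of the kernel of the degree map Z[D] -> D.  Such c form an ideal of Z. *)
Definition perm_pairing (c : int) := exists (J : finType) (sJ : J -> J)
    (h iota : J -> D -> int),
  [/\ forall j, iter o sJ j = j,
      forall j chi, h (sJ j) (t chi) = h j chi,
      forall j psi, iota (sJ j) (t psi) = iota j psi,
      forall j, divisor_degree (iota j) = 0
    & (forall j chi chi', exists q,
         h j (chi + chi') = h j chi + h j chi' + e%:Z * q) /\
      (forall chi, exists2 u, divisor_degree u = chi *~ c &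
         forall psi, \sum_j h j chi * iota j psi = e%:Z * u psi)].

Lemma divisor_degreeZ d v :
  divisor_degree (fun x => v x * d) = divisor_degree v *~ d.
Proof. by rewrite mulrz_suml; apply: eq_bigr => x _; rewrite mulrzA. Qed.

Lemma perm_pairing_mul c d : perm_pairing c -> perm_pairing (c * d).
Proof.
case=> J [sJ [h [iota [sJo hs is0 iD [hD hu]]]]].
exists J, sJ, h, (fun j x => iota j x * d); split=> //.
- by move=> j psi; rewrite is0.
- by move=> j; rewrite divisor_degreeZ iD mul0rz.
split=> // x; have [u uD ue] := hu x; exists (fun psi => u psi * d).
  by rewrite divisor_degreeZ uD -mulrzA.
move=> psi; rewrite mulrA -ue mulr_suml.
by apply: eq_bigr => j _; rewrite mulrA.
Qed.

(** The two index sets are put side by side. *)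
Lemma perm_pairing_add c d : perm_pairing c -> perm_pairing d -> perm_pairing (c + d).
Proof.
case=> J [sJ [h [iota [sJo hs is0 iD [hD hu]]]]].
case=> J' [sJ' [h' [iota' [sJo' hs' is0' iD' [hD' hu']]]]].
pose sJJ (j : J + J') : J + J' :=
  match j with inl j => inl (sJ j) | inr j => inr (sJ' j) end.
pose glue (f : J -> D -> int) (f' : J' -> D -> int) (j : J + J') :=
  match j with inl j => f j | inr j => f' j end.
exists (J + J')%type, sJJ, (glue h h'), (glue iota iota'); split.
- case=> j.
    have -> : iter o sJJ (inl j) = inl (iter o sJ j).
      by elim: (o) => //= a ->.
    by rewrite sJo.
  have -> : iter o sJJ (inr j) = inr (iter o sJ' j).
    by elim: (o) => //= a ->.
  by rewrite sJo'.
- by case=> j x /=.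
- by case=> j x /=.
- by case=> j /=.
split; first by case=> j x x' /=.
move=> x; have [u uD ue] := hu x; have [u' uD' ue'] := hu' x.
exists (fun psi => u psi + u' psi).
  rewrite mulrzDr -uD -uD' -big_split /=.
  by apply: eq_bigr => psi _; rewrite mulrzDr.
by move=> psi; rewrite big_sumType /= ue ue' mulrDr.
Qed.

(** The index set is empty and u = 0, which has the required degree because e kills D. *)
Lemma perm_pairing_exp : (forall x : D, x *+ e = 0) -> perm_pairing e.
Proof.
move=> De; exists void, id, (fun=> fun=> 0), (fun=> fun=> 0).
split; try by case.
split; first by case.
move=> x; exists (fun psi => 0).
  by rewrite -pmulrn De; apply: big1 => psi _; rewrite mulr0z.
by move=> psi; rewrite [RHS]mulr0; apply: big1; case.
Qed.

End PermPairing.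

(* A p-basis of the kernel lattice has determinant prime to p; its dual basis,
   up to this determinant, provides the h_j. *)
Lemma perm_pairing_prime (D : finZmodType) (t : {additive D -> D}) (p n e : nat) :
  prime p -> (0 < e)%N -> (forall x : D, x *+ e = 0) ->
  (forall x, iter (p ^ n) t x = x) ->
  exists2 c : nat, ~~ (p %| c)%N & perm_pairing t (p ^ n) e c.
Proof.
move=> p_pr e_gt0 De to.
have p_gt0 := prime_gt0 p_pr.
have t_inj : injective t by apply: (iter_id_inj _ to); rewrite expn_gt0 p_gt0.
have D_gt0 : (0 < #|D|)%N by apply/card_gt0P; exists 0.
pose N := #|D|.-1; have DN : #|D| = N.+1 by rewrite prednK.
pose idx (x : D) : 'I_N.+1 := cast_ord DN (enum_rank x).
pose vl (i : 'I_N.+1) : D := enum_val (cast_ord (esym DN) i).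
have idxK : cancel idx vl.
  by move=> x; rewrite /vl /idx cast_ordK enum_rankK.
have vlK : cancel vl idx.
  by move=> x; rewrite /vl /idx enum_valK cast_ordKV.
have idx_bij : bijective idx by exists vl.
pose fdeg (v : 'rV[int]_N.+1) : D := \sum_i vl i *~ v ord0 i.
have fdegE v : fdeg v = divisor_degree (fun psi => v 0 (idx psi)).
  rewrite /fdeg (reindex idx); last exact: onW_bij.
  by apply: eq_bigr => i _; rewrite idxK.
have fdeg_add : zmod_morphism fdeg.
  move=> u v; rewrite /fdeg -sumrB; apply: eq_bigr => i _.
  by rewrite !mxE mulrzBr.
pose fD : {additive 'rV[int]_N.+1 -> D} :=
  HB.pack fdeg (GRing.isZmodMorphism.Build _ _ fdeg fdeg_add).
have [B dB kerB] := @int_kernel_basis _ _ e fD e_gt0 De.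
pose delta x : 'rV[int]_N.+1 := delta_mx 0 (idx x).
have fDZ c v : fD (c *: v) = fD v *~ c.
  by rewrite -[c]intz scaler_int raddfMz intz.
have fdelta x : fD (delta x) = x.
  rewrite /= /fdeg (bigD1 (idx x)) //= big1 => [|i ne_i]; last first.
    by rewrite mxE eqxx (negPf ne_i) mulr0z.
  by rewrite mxE !eqxx mulr1z addr0 idxK.
pose P : 'M[int]_N.+1 := \matrix_(i, j) (t (vl i) == vl j)%:R.
have vP (v : 'rV_N.+1) a x :
    (v *m P ^+ a) 0 (idx (iter a t x)) = v 0 (idx x).
  elim: a => [|a IHa]; first by rewrite expr0 mulmx1.
  rewrite exprSr mulmxA mxE (bigD1 (idx (iter a t x))) //= IHa.
  rewrite [P _ _]mxE !idxK eqxx mulr1 big1 ?addr0 // => i ne_i.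
  rewrite [P _ _]mxE idxK (inj_eq t_inj) [_ == _](_ : _ = false) ?mulr0 //.
  by apply: contraNF ne_i => /eqP <-; rewrite vlK.
have vecP (u v : 'rV[int]_N.+1) a :
    (forall x, u 0 (idx (iter a t x)) = v 0 (idx (iter a t x))) -> u = v.
  move=> uv; apply/rowP => j; rewrite -[j]vlK.
  have [g gK Kg] : bijective (iter a t).
    by apply: injF_bij; elim: a {uv} => // a IHa x y /t_inj/IHa.
  by rewrite -[vl j]Kg.
have deltaP x a : delta x *m P ^+ a = delta (iter a t x).
  apply: (vecP _ _ a) => y; rewrite vP !mxE eqxx /= !(can_eq idxK).
  by congr (_ %:R); elim: a => //= a ->; rewrite (inj_eq t_inj).
have Pto : P ^+ (p ^ n) = 1.
  apply/row_matrixP => i; rewrite rowE [RHS]rowE mulmx1.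
  by rewrite -[i]vlK -/(delta _) deltaP to.
have fP v : fD (v *m P) = t (fD v).
  rewrite /= !fdegE /divisor_degree (reindex t); last exact/onW_bij/injF_bij.
  rewrite raddf_sum; apply: eq_bigr => x _; rewrite raddfMz; congr (_ *~ _).
  by rewrite -[P]expr1 (vP v 1).
have fPX v a : fD (v *m P ^+ a) = iter a t (fD v).
  by elim: a => [|a IHa]; rewrite ?expr0 ?mulmx1 // exprSr mulmxA fP IHa.
have fB mu : fD (mu *m B) = 0 by apply/kerB; exists mu.
(* t preserves the kernel lattice; S will be its matrix in the basis of the rows of B. *)
have /fin_all_exists[SS SP] i : exists mu, row i B *m P = mu *m B.
  by apply/kerB; rewrite fP rowE fB raddf0.
pose S : 'M[int]_N.+1 := \matrix_i SS i.
have SB : S *m B = B *m P.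
  by apply/row_matrixP => i; rewrite !row_mul rowK SP.
have SXB a : S ^+ a *m B = B *m P ^+ a.
  elim: a => [|a IHa]; first by rewrite !expr0 mul1mx mulmx1.
  by rewrite !exprSr -[LHS]mulmxA SB mulmxA IHa -mulmxA.
have S_exp : S ^+ (p ^ n) = 1.
  by apply: (mulmx_det_inj dB); rewrite SXB Pto mul1mx mulmx1.
have coflabby i (z : 'rV[int]_N.+1) : (i <= n)%N ->
    z *m (\sum_(a < p ^ (n - i)) S ^+ (p ^ i) ^+ a) = 0 ->
    exists c, z = c *m (S ^+ (p ^ i) - 1).
  move=> le_in z0; set q := (p ^ i)%N in z0 *.
  pose v x := (z *m B) 0 (idx x); pose g := iter q t.
  have iter_g a x : iter a g x = iter (q * a) t x.
    by elim: a => [|a IHa]; rewrite ?muln0 // mulnS iterD -IHa.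
  have og x : iter (p ^ (n - i)) g x = x.
    by rewrite iter_g -expnD subnKC.
  have o_gt0 : (0 < p ^ (n - i))%N by rewrite expn_gt0 p_gt0.
  have [x|c cP] := @perm_hilbert90 D g _ v o_gt0 og.
    have := congr1 (fun u => (u *m B) 0 (idx (iter (p ^ (n - i)).-1 g x))) z0.
    rewrite mul0mx [RHS]mxE -mulmxA mulmx_suml mulmx_sumr summxE => e0.
    apply: etrans e0.
    rewrite [LHS](reindex_inj rev_ord_inj) /=; apply: eq_bigr => a _.
    rewrite -exprM SXB mulmxA.
    have -> : iter (p ^ (n - i)).-1 g x =
        iter (q * a) t (iter (p ^ (n - i) - a.+1) g x).
      by rewrite -iter_g -iterD subnS -subn1 -!subn1 addnBA ?subn_gt0 // subnKC // ltnW.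
    by rewrite vP.
  (* Hilbert 90 on Z[D] gives cv, which need not lie in the kernel lattice. Its degree is fixed by
     t^q, so [delta (fD cv)] is a fixed vector of the same degree, and subtracting it corrects cv
     without changing the coboundary. *)
  pose cv : 'rV[int]_N.+1 := \row_j c (vl j).
  have cvP : z *m B = cv *m P ^+ q - cv.
    apply: (vecP _ _ q) => x; rewrite [RHS]mxE vP; move: (cP x).
    by rewrite /v => ->; rewrite !mxE !idxK.
  have dP : iter q t (fD cv) = fD cv.
    apply/eqP; rewrite -subr_eq0 -fPX -raddfB -cvP; exact/eqP/fB.
  have [mu muP] : exists mu, cv - delta (fD cv) = mu *m B.
    by apply/kerB; rewrite raddfB fdelta subrr.
  exists mu; apply: (mulmx_det_inj dB).
  rewrite -mulmxA mulmxBl SXB mul1mx -[X in _ - X]mulmx1 -mulmxBr mulmxA -muP.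
  rewrite mulmxBr mulmx1 mulmxBl deltaP dP cvP.
  by rewrite opprD addrACA subrr addr0.
have [J [sJ [y [cardJ sJo yS ySpan]]]] := cyclic_lattice_perm p_pr S_exp coflabby.
have sJ_inj : injective sJ by apply: (iter_id_inj _ sJo); rewrite expn_gt0 p_gt0.
pose ix (j : J) : 'I_N.+1 := cast_ord cardJ (enum_rank j).
pose jv (i : 'I_N.+1) : J := enum_val (cast_ord (esym cardJ) i).
have ixK : cancel ix jv by move=> x; rewrite /jv /ix cast_ordK enum_rankK.
have jvK : cancel jv ix by move=> x; rewrite /jv /ix enum_valK cast_ordKV.
have ix_bij : bijective ix by exists jv.
pose Y : 'M[int]_N.+1 := \matrix_i y (jv i).
have dY : ~~ (p %| `|\det Y|)%N.
  have Yu : red_mod p Y \in unitmx.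
    rewrite -row_full_unit -sub1mx; apply/row_subP => i.
    have [c ->] := ySpan (row i 1%:M); apply: summx_sub => j _.
    have -> : red_mod p (y j) = row (ix j) (red_mod p Y).
      by rewrite -map_row rowK ixK.
    by rewrite scalemx_sub ?row_sub.
  move: Yu; rewrite unitmxE det_map_mx unitfE.
  by rewrite -(dvdz_pcharf (pchar_Fp p_pr)).
have dY0 : \det Y != 0 by apply: contraNneq dY => ->; rewrite dvdn0.
have /fin_all_exists[mu muP] x : exists mu, e%:Z *: delta x = mu *m B.
  by apply/kerB; rewrite fDZ -pmulrn De.
(* The rows of Y B are the iota_j, and [la x] holds the coordinates of [\det Y] e [x] on them; the
   adjugate keeps these integral. *)
pose la x := mu x *m \adj Y.
have laY x : la x *m Y = \det Y *: mu x.
  by rewrite -mulmxA mul_adj_mx mul_mx_scalar.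
pose PJ : 'M[int]_N.+1 := \matrix_(i, j) (sJ (jv i) == jv j)%:R.
have YS : Y *m S = PJ *m Y.
  apply/row_matrixP => i; rewrite !row_mul rowK yS.
  rewrite mulmx_sum_row (bigD1 (ix (sJ (jv i)))) //= big1 => [|j ne_j].
    by rewrite !mxE ixK eqxx scale1r rowK ixK addr0.
  rewrite !mxE [_ == _](_ : _ = false) ?scale0r //.
  by apply: contraNF ne_j => /eqP ->; rewrite jvK.
have star_det : perm_pairing t (p ^ n) e (\det Y).
  exists J, sJ, (fun j x => la x 0 (ix j)), (fun j x => (y j *m B) 0 (idx x)).
  split=> //.
  - move=> j x.
    have -> : la (t x) = la x *m PJ.
      apply: (mulmx_det_inj dY0); rewrite laY -mulmxA -YS mulmxA laY.
      rewrite -scalemxAl; congr (_ *: _); apply: (mulmx_det_inj dB).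
      rewrite -muP -mulmxA SB mulmxA -muP -scalemxAl; congr (_ *: _).
      by rewrite -[P]expr1 deltaP.
    rewrite mxE (bigD1 (ix j)) //= [PJ _ _]mxE !ixK eqxx mulr1 big1 ?addr0 // => i ne_i.
    rewrite [PJ _ _]mxE ixK (inj_eq sJ_inj) [_ == _](_ : _ = false) ?mulr0 //.
    by apply: contraNF ne_i => /eqP <-; rewrite jvK.
  - move=> j x; rewrite -yS -mulmxA SB mulmxA -[P]expr1; exact: (vP _ 1).
  - by move=> j; rewrite -fdegE; exact: fB.
  split=> [j x x'|x].
    (* [x + x'] - [x] - [x'] has degree zero, so it has integral coordinates, and e times it has
       coordinates divisible by e. *)
    have [ka kaP] : exists ka, delta (x + x') - delta x - delta x' = ka *m B.
      by apply/kerB; rewrite !raddfB !fdelta -addrA -opprD subrr.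
    exists ((ka *m \adj Y) 0 (ix j)).
    suff -> : la (x + x') = la x + la x' + e%:Z *: (ka *m \adj Y).
      by rewrite !mxE.
    rewrite /la -!mulmxDl scalemxAl -mulmxDl; congr (_ *m _).
    apply: (mulmx_det_inj dB); rewrite !mulmxDl -!muP -scalemxAl -kaP.
    rewrite -!scalerDr; congr (_ *: _).
    by rewrite -[delta _ - _ - _]addrA -opprD [RHS]addrC subrK.
  exists (fun psi => \det Y * delta x 0 (idx psi)).
    transitivity (fD (\det Y *: delta x)); last by rewrite fDZ fdelta.
    by rewrite /= fdegE; apply: eq_bigr => psi _; rewrite [in RHS]mxE.
  move=> psi.
  transitivity ((la x *m Y *m B) 0 (idx psi)).
    rewrite -mulmxA mxE (reindex ix) /=; last exact: onW_bij.
    apply: eq_bigr => j _; congr (_ * _).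
    have <- : row (ix j) Y = y j by rewrite rowK ixK.
    by rewrite -row_mul mxE.
  rewrite laY -scalemxAl -muP scalerA mulrC -scalerA.
  by rewrite [LHS]mxE [X in _ * X]mxE.
exists `|\det Y|%N => //; rewrite abszE normrEsg mulrC.
exact: perm_pairing_mul.
Qed.

Section IterAdditive.
Variables (D : zmodType) (s : {additive D -> D}) (a : nat).
Definition iter_additive := iter a s.
Fact iter_additive_is_zmod_morphism : zmod_morphism iter_additive.
Proof.
by rewrite /iter_additive => x y; elim: a => //= b ->; rewrite raddfB.
Qed.
HB.instance Definition _ :=
  GRing.isZmodMorphism.Build _ _ iter_additive iter_additive_is_zmod_morphism.
End IterAdditive.

Lemma divisor_degree_iter (D : finZmodType) (s : {additive D -> D})
    (a b : nat) (v : D -> int) : (forall x, iter (a + b) s x = x) ->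
  divisor_degree (fun x => v (iter b s x)) = iter a s (divisor_degree v).
Proof.
move=> sab; rewrite -/(iter_additive s a _) raddf_sum /=.
have sba x : iter b s (iter a s x) = x by rewrite -iterD addnC.
have s_bij : bijective (iter a s).
  by exists (iter b s) => // x; rewrite -iterD.
rewrite /divisor_degree (reindex (iter a s)) /=; last exact: onW_bij.
apply: eq_bigr => x _; rewrite sba.
by rewrite -[RHS]/(iter_additive s a _) raddfMz.
Qed.

(* Induction from <s^m> to <s>. *)
Lemma perm_pairing_transfer (D : finZmodType) (s : {additive D -> D})
    (m o e : nat) (c : int) : (0 < m)%N -> (0 < o)%N ->
  (forall x, iter (m * o) s x = x) ->
  perm_pairing (iter m s) o e c -> perm_pairing s (m * o) e (c * m%:Z).
Proof.
move=> m_gt0 o_gt0 so [J [sJ [h [iota [sJo hs is0 iD [hD hu]]]]]].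
have [u uD uE] := fin_all_exists2 hu.
(* The index set consists of m translates of J. One step of s goes to the next translate and, after
   the last, applies [sJ], which corresponds to [iter m s]. *)
pose sJ' (j : 'I_m * J) : 'I_m * J :=
  if insub j.1.+1 is Some g then (g, j.2) else (Ordinal m_gt0, sJ j.2).
pose back (g : 'I_m) := iter (m * o - g) s.
have le_mo (g : 'I_m) : (g <= m * o)%N.
  by rewrite (leq_trans (ltnW (ltn_ord g))) // leq_pmulr.
have s_step (f : J -> D -> int) j x :
    (forall i y, f (sJ i) (iter m s y) = f i y) ->
    f (sJ' j).2 (back (sJ' j).1 (s x)) = f j.2 (back j.1 x).
  move=> fs; rewrite /sJ' /back; case: insubP => [g lt_g /= -> | /=].
    by rewrite -iterSr subnSK // (leq_trans (ltnW lt_g)) // leq_pmulr.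
  rewrite -leqNgt => le_m; have {}le_m : j.1.+1 = m.
    by apply/eqP; rewrite eqn_leq le_m ltn_ord.
  rewrite subn0 so -[RHS]fs -iterD; congr (f _ _).
  have -> : (m + (m * o - j.1))%N = (m * o).+1.
    by move: (le_mo j.1) le_m; move: (nat_of_ord j.1) => g le_g gm;
       rewrite -{1}gm addSn subnKC.
  by rewrite iterS so.
exists ('I_m * J)%type, sJ', (fun j x => h j.2 (back j.1 x)),
  (fun j x => iota j.2 (back j.1 x)).
have it0 g (lt_g : (g < m)%N) j : iter g sJ' (Ordinal m_gt0, j) = (Ordinal lt_g, j).
  elim: g lt_g => [|g IHg] lt_g; first by congr (_, _); apply: val_inj.
  rewrite iterS (IHg (ltnW lt_g)) /sJ' /= insubT.
  by congr (_, _); apply: val_inj.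
have itm j : iter m sJ' j = (j.1, sJ j.2).
  case: j => -[g lt_g] j /=; rewrite -it0 -iterD addnC iterD.
  rewrite -(it0 _ lt_g); congr (iter _ _ _).
  have lt_m : (m.-1 < m)%N by rewrite prednK.
  suff : iter m.-1.+1 sJ' (Ordinal m_gt0, j) = (Ordinal m_gt0, sJ j).
    by rewrite prednK.
  by rewrite iterS (it0 _ lt_m) /sJ' /= insubN // prednK // ltnn.
split.
- move=> j; suff -> b : iter (m * b) sJ' j = (j.1, iter b sJ j.2).
    by rewrite sJo; case: j.
  elim: b => [|b IHb]; first by rewrite muln0; case: j.
  by rewrite mulnS iterD IHb itm.
- by move=> j x; apply: (s_step h).
- by move=> j x; apply: (s_step iota).
- move=> j; rewrite (@divisor_degree_iter _ _ j.1) ?subnKC // iD.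
  by rewrite -/(iter_additive s _ _) raddf0.
split=> [j x x'|x].
  have -> : back j.1 (x + x') = back j.1 x + back j.1 x'.
    exact: (raddfD (iter_additive s (m * o - j.1))).
  exact: hD.
exists (fun psi => \sum_(g < m) u (back g x) (back g psi)).
  transitivity (\sum_(g < m) divisor_degree (fun psi => u (back g x) (back g psi))).
    rewrite exchange_big /=; apply: eq_bigr => psi _.
    by rewrite mulrz_sumr.
  (* Each of the m translates contributes c times x, whence the factor m. *)
  have itgc (g : 'I_m) : iter g s (back g x *~ c) = x *~ c.
    transitivity (iter_additive s g (back g x) *~ c).
      exact: (raddfMz (iter_additive s g)).
    by rewrite /iter_additive /back -iterD subnKC // so.
  under eq_bigr => g _.
    rewrite (@divisor_degree_iter _ _ g) ?subnKC // uD.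
    rewrite itgc.
    over.
  by rewrite sumr_const card_ord mulrzA pmulrn.
move=> psi; rewrite mulr_sumr.
rewrite -(pair_bigA _ (fun g j => h j (back g x) * iota j (back g psi))) /=.
by apply: eq_bigr => g _; rewrite uE.
Qed.

(** For a prime p, [perm_pairing_prime] applies to the p-part of the cyclic group generated by s,
    and induction costs only the p'-part of r; so some integer prime to p is attained. An ideal of Z
    contained in no pZ is Z. *)
Lemma perm_pairing_one (D : finZmodType) (s : {additive D -> D}) (r e : nat) :
  (0 < r)%N -> (0 < e)%N -> (forall x : D, x *+ e = 0) ->
  (forall x, iter r s x = x) -> perm_pairing s r e 1.
Proof.
move=> r_gt0 e_gt0 De so.
have star_pr p : prime p -> exists2 c : nat, ~~ (p %| c)%N & perm_pairing s r e c.
  move=> p_pr; pose m := (r`_p^')%N; pose n := logn p r.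
  have rE : r = (m * p ^ n)%N by rewrite -p_part mulnC partnC.
  have m_gt0 : (0 < m)%N by rewrite part_gt0.
  have so' x : iter (p ^ n) (iter_additive s m) x = x.
    rewrite -[RHS]so rE; elim: (p ^ n)%N => [|a IHa]; first by rewrite muln0.
    by rewrite mulnS iterD -IHa.
  have [c pc star_c] := perm_pairing_prime p_pr e_gt0 De so'.
  exists (c * m)%N.
    rewrite Euclid_dvdM // negb_or pc /=.
    by rewrite -prime_coprime // coprime_sym (@pnat_coprime p^') ?part_pnat // pnatNK pnat_id.
  rewrite PoszM rE; apply: perm_pairing_transfer => //; last by rewrite -rE.
  by rewrite expn_gt0 prime_gt0.
have star_gcd a b : perm_pairing s r e a%:Z -> perm_pairing s r e b%:Z ->
    perm_pairing s r e (gcdn a b)%:Z.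
  move=> sa sb; have [x [y xy]] := Bezoutz a b.
  rewrite -[(gcdn a b)%:Z]xy mulrC [y * _]mulrC.
  by apply: perm_pairing_add; apply: perm_pairing_mul.
have : perm_pairing s r e e by apply: perm_pairing_exp.
(* Descent from g = e: the gcd with an attained integer prime to a prime divisor of g is strictly
   smaller than g. *)
elim/ltn_ind: {1 3}e e_gt0 => g IHg g_gt0 star_g.
have [g_le1|g_gt1] := leqP g 1.
  by have -> : 1 = g%:Z by congr Posz; apply/eqP; rewrite eqn_leq g_gt0.
have [c pc star_c] := star_pr _ (pdiv_prime g_gt1).
apply: (IHg (gcdn g c)); last exact: star_gcd.
  rewrite ltn_neqAle dvdn_leq ?dvdn_gcdl // andbT.
  apply: contra pc => /eqP <-.
  by rewrite (dvdn_trans (pdiv_dvd _)) // dvdn_gcdr.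
by rewrite gcdn_gt0 g_gt0.
Qed.

(** The h_j will serve as exponents, so they are reduced modulo e to natural numbers; the quotients
    are absorbed into u through the iota_j, which have degree zero. Equivariance of u comes from
    that of e u, which the pairing expresses. *)
Lemma perm_pairing_data (D : finZmodType) (s : {additive D -> D}) (r e : nat) :
  (0 < r)%N -> (0 < e)%N -> (forall x : D, x *+ e = 0) ->
  (forall x, iter r s x = x) ->
  exists (J : finType) (sJ : J -> J) (h : J -> D -> nat)
    (iota : J -> D -> int) (u : D -> D -> int),
  [/\ forall j, iter r sJ j = j,
      forall j chi, h (sJ j) (s chi) = h j chi,
      forall j psi, iota (sJ j) (s psi) = iota j psi,
      forall j, divisor_degree (iota j) = 0
    & [/\ forall j chi chi',
            h j (chi + chi')%R = (h j chi + h j chi')%N %[mod e],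
          forall chi, divisor_degree (u chi) = chi,
          forall chi psi, u (s chi) (s psi) = u chi psi
        & forall chi psi,
            \sum_j (h j chi)%:Z * iota j psi = e%:Z * u chi psi]].
Proof.
move=> r_gt0 e_gt0 De so.
have [J [sJ [h [iota [sJo hs is0 iD [hD hu]]]]]] := perm_pairing_one r_gt0 e_gt0 De so.
have [u uD uE] := fin_all_exists2 hu.
have e_neq0 : e%:Z != 0 by rewrite eqz_nat -lt0n.
pose hn j x := `|(h j x %% e)%Z|%N.
have hnE j x : (hn j x)%:Z = (h j x %% e)%Z by rewrite gez0_abs ?modz_ge0.
pose v x psi := u x psi - \sum_j (h j x %/ e)%Z * iota j psi.
have vE x psi : \sum_j (hn j x)%:Z * iota j psi = e%:Z * v x psi.
  rewrite mulrBr -uE mulr_sumr -sumrB; apply: eq_bigr => j _.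
  by rewrite hnE /modz mulrBl; congr (_ - _); rewrite [RHS]mulrA [e%:Z * _]mulrC.
have hns j x : hn (sJ j) (s x) = hn j x by rewrite /hn hs.
exists J, sJ, hn, iota, v; split=> //; split=> //.
- move=> j x x'; have [q qE] := hD j x x'.
  apply/eqP; rewrite -eqz_nat -!modz_nat PoszD !hnE modz_mod modzDml modzDmr qE.
  by rewrite addrC mulrC modzMDl.
- move=> x; rewrite /divisor_degree /v.
  under eq_bigr do rewrite mulrzBr mulrz_sumr.
  rewrite sumrB -/(divisor_degree _) uD mulr1z exchange_big /= big1 ?subr0 //.
  move=> j _; under eq_bigr do rewrite mulrC mulrzA.
  by rewrite -mulrz_suml -/(divisor_degree _) iD mul0rz.
move=> x psi; apply: (mulfI e_neq0); rewrite -!vE.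
rewrite (reindex_inj (iter_id_inj r_gt0 sJo)) /=.
by apply: eq_bigr => j _; rewrite hns is0.
Qed.

(** * The character group of H *)

Section CharGroup.
Variables (gT : finGroupType) (H : {group gT}) (e0 : nat).
Local Notation e := e0.+1.

(* Homomorphisms H -> Z/e, extended by 0 outside H so that equality is extensional. *)
Definition chr_pred : {pred {ffun gT -> 'I_e}} := fun f =>
  [forall x in H, forall y in H, f (x * y)%g == f x + f y] &&
  [forall x, (x \notin H) ==> (f x == 0)].

Lemma chr_predP (f : {ffun gT -> 'I_e}) :
  reflect ({in H &, forall x y, f (x * y)%g = f x + f y} /\
           (forall x, x \notin H -> f x = 0)) (f \in chr_pred).
Proof.
apply: (iffP andP) => -[hM h0]; split.
- by move=> x y Hx Hy; apply/eqP; move/forall_inP/(_ x Hx)/forall_inP/(_ y Hy): hM.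
- by move=> x nHx; apply/eqP; move/forallP/(_ x)/implyP/(_ nHx): h0.
- apply/forall_inP => x Hx; apply/forall_inP => y Hy; apply/eqP; exact: hM.
- by apply/forallP => x; apply/implyP => nHx; rewrite h0.
Qed.

Fact chr_pred_zmod : zmod_closed chr_pred.
Proof.
split=> [|f g /chr_predP[fM f0] /chr_predP[gM g0]]; apply/chr_predP; split.
- by move=> x y _ _; rewrite !ffunE addr0.
- by move=> x _; rewrite ffunE.
- by move=> x y Hx Hy; rewrite !ffunE fM // gM // opprD addrACA.
- by move=> x nHx; rewrite !ffunE f0 // g0 // subr0.
Qed.
HB.instance Definition _ := GRing.isZmodClosed.Build _ chr_pred chr_pred_zmod.

Record chr := Chr { chr_val :> {ffun gT -> 'I_e}; chr_valP : chr_val \in chr_pred }.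
HB.instance Definition _ := [isSub for chr_val].
HB.instance Definition _ := [Finite of chr by <:].
HB.instance Definition _ := [SubChoice_isSubZmodule of chr by <:].

Lemma chrM (f : chr) : {in H &, forall x y, f (x * y)%g = f x + f y}.
Proof. by have /chr_predP[] := chr_valP f. Qed.

Lemma chr_out (f : chr) x : x \notin H -> f x = 0.
Proof. by have /chr_predP[_] := chr_valP f; apply. Qed.

Lemma chr1 (f : chr) : f 1%g = 0.
Proof.
by have := chrM f (group1 H) (group1 H); rewrite mulg1 => /eqP; rewrite -subr_eq0 opprD addrA subrr sub0r oppr_eq0 => /eqP.
Qed.

Lemma chrD (f g : chr) x : (f + g)%R x = f x + g x.
Proof. by rewrite ffunE. Qed.

Lemma chr_mulrn (f : chr) : f *+ e = 0.
Proof.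
apply: val_inj; apply/ffunP => x; rewrite raddfMn raddf0 /= ffunMnE ffunE.
by apply: val_inj; rewrite Zp_mulrn /= modnMl.
Qed.

Lemma chrX (f : chr) x n : x \in H -> f (x ^+ n)%g = f x *+ n.
Proof.
move=> Hx; elim: n => [|n IHn]; first by rewrite expg0 chr1.
by rewrite expgS mulrS chrM ?groupX // IHn.
Qed.

Lemma chrV (f : chr) x : x \in H -> f x^-1%g = - f x.
Proof.
by move=> Hx; apply/eqP; rewrite -addr_eq0 -chrM ?groupV // mulVg chr1.
Qed.

Section RootValues.
Variables (K : fieldType) (w : K).
Hypothesis w_prim : e.-primitive_root w.

Lemma prim_exprD (a b : 'I_e) : w ^+ (a + b)%R = w ^+ a * w ^+ b.
Proof. by rewrite -exprD (prim_expr_mod w_prim). Qed.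

Lemma prim_expr_neq0 n : w ^+ n != 0.
Proof.
apply: expf_neq0; apply/eqP => w0; have := prim_expr_order w_prim.
by rewrite w0 expr0n /= => /esym/eqP; rewrite oner_eq0.
Qed.

Lemma prim_exprN (a : 'I_e) : w ^+ (- a)%R = (w ^+ a)^-1.
Proof.
apply: (mulfI (prim_expr_neq0 a)); rewrite mulfV ?prim_expr_neq0 //.
by rewrite -prim_exprD subrr.
Qed.

Lemma prim_expr_inj (a b : 'I_e) : w ^+ a = w ^+ b -> a = b.
Proof.
move/eqP; rewrite (eq_prim_root_expr w_prim) !modn_small //.
by move/eqP/val_inj.
Qed.

Lemma chr_sum (f : chr) : f != 0 -> \sum_(x in H) w ^+ f x = 0.
Proof.
move=> f0; have [x Hx fx] : exists2 x, x \in H & f x != 0.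
  apply/exists_inP; apply: contraNT f0 => /exists_inPn fH.
  apply/eqP/val_inj/ffunP => x; rewrite ffunE.
  case: (boolP (x \in H)) => [/fH|/chr_out->//].
  by rewrite negbK => /eqP.
set S := \sum_(x in H) _; have : (w ^+ f x - 1) * S = 0.
  rewrite mulrBl mul1r mulr_sumr; apply/eqP; rewrite subr_eq0; apply/eqP.
  rewrite [RHS](reindex_inj (mulgI x)) /=; apply: eq_big => [y|y Hy].
    by rewrite groupMl.
  by rewrite chrM // prim_exprD.
move/eqP; rewrite mulf_eq0 subr_eq0 => /orP[/eqP|/eqP //].
by rewrite -[1]/(w ^+ (0%R : 'I_e)) => /prim_expr_inj; move/eqP: fx.
Qed.
End RootValues.

(* The values of the characters form a matrix with independent rows. *)
Lemma card_chr_le : (#|{: chr}| <= #|H|)%N.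
Proof.
have [w w_prim] := C_prim_root_exists (ltn0Sn e0).
pose M := \matrix_(i < #|{: chr}|, j < #|H|) w ^+ (enum_val i : chr) (enum_val j).
pose M' := \matrix_(j < #|H|, i < #|{: chr}|) w ^+ (- (enum_val i : chr))%R (enum_val j).
have MM' : M *m M' = (#|H|%:R)%:M.
  apply/matrixP => i i'; rewrite !mxE.
  transitivity (\sum_(x in H) w ^+ (enum_val i - enum_val i')%R x).
    rewrite [RHS]big_enum_val; apply: eq_bigr => j _; rewrite !mxE.
    by rewrite chrD (prim_exprD w_prim).
  have [<-|ne_i] := eqVneq i i'.
    rewrite subrr mulr1n -sumr_const; apply: eq_bigr => x _.
    by rewrite ffunE.
  rewrite mulr0n; apply: (chr_sum w_prim).
  by rewrite subr_eq0; apply: contraNneq ne_i => /enum_val_inj ->.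
have : row_free (M *m M').
  rewrite MM' row_free_unit unitmxE det_scalar unitfE expf_eq0 negb_and.
  by rewrite pnatr_eq0 -lt0n cardG_gt0 orbT.
rewrite /row_free => /eqP rk; rewrite -[X in (X <= _)%N]rk.
by apply: leq_trans (mxrankM_maxl _ _) _; apply: rank_leq_col.
Qed.

(** The complex irreducible characters of H are linear, have e-th roots of unity as values and are
    jointly faithful; the exponents of these values give an element of [chr]. *)
Lemma chr_separates : abelian H -> (exponent H %| e)%N ->
  forall x, x \in H -> x != 1%g -> exists f : chr, f x != 0.
Proof.
move=> abH eH x Hx x1.
have [w w_prim] := C_prim_root_exists (ltn0Sn e0).
have [i ki] : exists i : Iirr H, x \notin cfker 'chi_i.
  apply/existsP; apply: contraNT x1; rewrite negb_exists => /forallP kx.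
  rewrite -in_set1 -[[set _]](TI_cfker_irr H).
  by apply/bigcapP => i _; have := kx i; rewrite negbK.
have lin_i : 'chi_i \is a linear_char by apply/char_abelianP.
have root y : y \in H -> exists a : 'I_e, 'chi_i y = w ^+ a.
  move=> Hy; have ye : 'chi_i y ^+ e = 1.
    by rewrite -lin_charX // (exponentP eH) // lin_char1.
  by have [a ->] := prim_rootP w_prim ye; exists a.
pose f := [ffun y => if y \in H then odflt 0 [pick a : 'I_e | 'chi_i y == w ^+ a] else 0].
have fE y : y \in H -> w ^+ f y = 'chi_i y.
  move=> Hy; rewrite ffunE Hy; case: pickP => [a /eqP -> //|no].
  by have [a ia] := root y Hy; have := no a; rewrite ia eqxx.
have fP : f \in chr_pred.
  apply/chr_predP; split=> [y z Hy Hz|y nHy]; last by rewrite ffunE (negPf nHy).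
  apply: (prim_expr_inj w_prim); rewrite (prim_exprD w_prim) !fE ?groupM //.
  by rewrite lin_charM.
exists (Chr fP) => /=; apply: contra ki => /eqP fx0.
by rewrite cfkerEirr inE -fE // fx0 expr0 lin_char1.
Qed.

Lemma chr_dual_sum (K : fieldType) (w : K) (w_prim : e.-primitive_root w) x :
  abelian H -> (exponent H %| e)%N -> x \in H -> x != 1%g ->
  \sum_(f : chr) w ^+ f x = 0.
Proof.
move=> abH eH Hx x1; have [f fx] := chr_separates abH eH Hx x1.
set S := \sum_f _; have : (w ^+ f x - 1) * S = 0.
  rewrite mulrBl mul1r mulr_sumr; apply/eqP; rewrite subr_eq0; apply/eqP.
  rewrite [RHS](reindex_inj (addrI f)) /=; apply: eq_bigr => g _.
  by rewrite chrD (prim_exprD w_prim).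
move/eqP; rewrite mulf_eq0 subr_eq0 => /orP[/eqP|/eqP //].
by rewrite -[1]/(w ^+ (0%R : 'I_e)) => /(prim_expr_inj w_prim); move/eqP: fx.
Qed.
End CharGroup.

(** Duality by counting: evaluation at elements of H is injective by [chr_separates], and the bidual
    has at most as many elements as D, hence at most #|H|. *)
Lemma chr_dual_eval (gT : finGroupType) (H : {group gT}) (e0 : nat) :
  abelian H -> (exponent H %| e0.+1)%N ->
  forall F : chr H e0 -> 'I_e0.+1, {morph F : f g / f + g} ->
  exists2 x, x \in H & forall f, F f = f x.
Proof.
move=> abH eH F FM.
pose D : finZmodType := chr H e0.
have ev_chr (G : D -> 'I_e0.+1) : {morph G : f g / f + g} ->
    [ffun f => G f] \in @chr_pred _ [group of [set: D]] e0.
  move=> GM; apply/chr_predP; split=> [f g _ _|f]; last by rewrite inE.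
  by rewrite !ffunE GM.
have evM x : {morph (fun f : D => f x) : f g / f + g} by move=> f g; rewrite chrD.
pose ev x := Chr (ev_chr _ (evM x)).
have ev_inj : {in H &, injective ev}.
  move=> x y Hx Hy /(congr1 val)/ffunP e; apply/eqP; rewrite eq_mulgV1.
  apply/negPn/negP => /(chr_separates abH eH (groupM Hx (groupVr Hy)))[f].
  rewrite chrM ?groupV //; have := e f; rewrite !ffunE => ->.
  by rewrite -chrM ?groupV // mulgV chr1 eqxx.
have : Chr (ev_chr F FM) \in ev @: H.
  suff -> : ev @: H = [set: chr [group of [set: D]] e0] by rewrite inE.
  apply/eqP; rewrite eqEcard subsetT cardsT (card_in_imset ev_inj).
  apply: leq_trans (card_chr_le _ _) _; rewrite cardsT.
  exact: card_chr_le.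
case/imsetP => x Hx /(congr1 val)/ffunP e; exists x => // f.
by have := e f; rewrite !ffunE.
Qed.

Section ChrAction.
Variables (gT : finGroupType) (H : {group gT}) (e0 : nat).
Implicit Type f : chr H e0.

(** The left action sending f to x -> f(g^-1 x g). The default f of [insubd] is met only if the
    conjugated function is not a character, which cannot happen when g normalises H. *)
Definition chrJ (g : gT) f : chr H e0 := insubd f [ffun x => f (x ^ g)%g].

Lemma chrJE g f x : g \in 'N(H)%g -> chrJ g f x = f (x ^ g)%g.
Proof.
move=> nHg; rewrite /chrJ /= val_insubd ifT ?ffunE //.
apply/chr_predP; split=> [y z Hy Hz|y nHy]; rewrite !ffunE.
  by rewrite conjMg chrM ?memJ_norm.
by rewrite chr_out // memJ_norm.
Qed.

Lemma chrP (f f' : chr H e0) : (forall x, f x = f' x) -> f = f'.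
Proof. by move=> ff'; apply/val_inj/ffunP. Qed.

Lemma chrJM g g' f : g \in 'N(H)%g -> g' \in 'N(H)%g ->
  chrJ (g * g')%g f = chrJ g (chrJ g' f).
Proof.
by move=> nHg nHg'; apply: chrP => x; rewrite !chrJE ?groupM // conjgM.
Qed.

Lemma chrJ1 f : chrJ 1%g f = f.
Proof. by apply: chrP => x; rewrite chrJE ?group1 // conjg1. Qed.

Lemma chrJK g : g \in 'N(H)%g -> cancel (chrJ g) (chrJ g^-1).
Proof. by move=> nHg f; rewrite -chrJM ?groupV // mulVg chrJ1. Qed.

Lemma chrJKV g : g \in 'N(H)%g -> cancel (chrJ g^-1) (chrJ g).
Proof. by move=> nHg f; rewrite -chrJM ?groupV // mulgV chrJ1. Qed.

Lemma chrJ_is_zmod_morphism g : g \in 'N(H)%g -> zmod_morphism (chrJ g).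
Proof. by move=> nHg f f'; apply: chrP => x; rewrite chrJE // !ffunE !chrJE. Qed.

Lemma chrJ_abelian x f : abelian H -> x \in H -> chrJ x f = f.
Proof.
move=> abH Hx; apply: chrP => y; rewrite chrJE ?(subsetP (normG H)) //.
have [Hy|nHy] := boolP (y \in H); last by rewrite !chr_out ?memJ_norm ?(subsetP (normG H)).
by rewrite conjgE (centsP abH y Hy x Hx) mulKg.
Qed.
End ChrAction.

(** * Independence of automorphisms and radical extensions *)

(** A relation is shortened: taking it at y x and subtracting [f i0 y] times the relation at x
    removes i0, and keeps i1 when [f i1 y != f i0 y]. *)
Lemma artin_independence (F : fieldType) (I : finType) (A : {set I})
    (f : I -> {rmorphism F -> F}) (c : I -> F) i0 :
  {in A &, forall i j, (forall x, f i x = f j x) -> i = j} ->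
  (forall i, c i != 0 -> i \in A) -> c i0 != 0 ->
  exists x, \sum_i c i * f i x != 0.
Proof.
move=> f_inj cA ci0; move: {2}#|_| (leqnn #|[pred i | c i != 0]|) => N.
elim: N c i0 cA ci0 => [|N IHN] c i0 cA ci0 leN.
  by move: leN; rewrite leqn0 => /eqP/card0_eq/(_ i0); rewrite inE ci0.
apply: contrapT => /forallNP sum0.
have {}sum0 x : \sum_i c i * f i x = 0.
  by apply/eqP/negPn/negP; apply: sum0.
have [i1 i10 ci1] : exists2 i1, i1 != i0 & c i1 != 0.
  apply: contrapT => noi; have := sum0 1; rewrite (bigD1 i0) //= big1.
    by rewrite rmorph1 mulr1 addr0 => /eqP; apply/negP.
  move=> i ne_i; have [->|ci] := eqVneq (c i) 0; first by rewrite mul0r.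
  by case: noi; exists i.
have [y fy] : exists y, f i1 y != f i0 y.
  apply: contrapT => noy; case/eqP: i10; apply: f_inj; rewrite ?cA // => y.
  by apply/eqP/negPn/negP => ne; apply: noy; exists y.
pose d i := c i * (f i y - f i0 y).
have di1 : d i1 != 0 by rewrite mulf_neq0 // subr_eq0.
have [i di||x] := IHN d i1 _ di1.
- by apply: cA; apply: contraNneq di; rewrite /d => ->; rewrite mul0r.
- rewrite -ltnS; apply: leq_trans leN; apply/proper_card/properP; split.
    apply/subsetP => i; rewrite !inE; apply: contraNneq.
    by rewrite /d => ->; rewrite mul0r.
  by exists i0; rewrite !inE ?ci0 // /d subrr mulr0 eqxx.
apply/negP; rewrite negbK; apply/eqP.
transitivity (\sum_i c i * f i (y * x) - f i0 y * \sum_i c i * f i x).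
  rewrite mulr_sumr -sumrB; apply: eq_bigr => i _.
  by rewrite /d rmorphM mulrBr mulrBl -mulrA mulrCA [f i0 y * _]mulrCA !mulrA.
by rewrite !sum0 mulr0 subr0.
Qed.

Lemma exists_irreducible_factor (F : fieldType) (p : {poly F}) :
  (1 < size p)%N -> exists2 q, irreducible_poly q & q %| p.
Proof.
elim: {p}_.+1 {-2}p (ltnSn (size p)) => // N IHN p leN p_gt1.
have [irr|nirr] := pselect (irreducible_poly p); first by exists p.
have [q [q_n1 q_dvd q_neq]] : exists q : {poly F}, [/\ size q != 1%N, q %| p & ~~ (q %= p)].
  apply: contrapT => noq; apply: nirr; split=> // q q1 qp.
  by apply/negPn/negP => ne; apply: noq; exists q.
have p0 : p != 0 by rewrite -size_poly_gt0 ltnW.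
have q0 : q != 0 by apply: contraTneq q_dvd => ->; rewrite dvd0p.
have lt_qp : (size q < size p)%N.
  by rewrite ltn_neqAle dvdp_leq // andbT dvdp_size_eqp.
have [||r irr rq] := IHN q; first exact: leq_trans lt_qp leN.
  by rewrite ltn_neqAle eq_sym q_n1 size_poly_gt0.
by exists r; rewrite ?(dvdp_trans rq).
Qed.

(** A root of any irreducible factor of X^n - a will do: the extension only has to contain the
    values at which the lifts are evaluated. *)
Lemma exists_root_extension (F : fieldType) (n : nat) (a : F) : (0 < n)%N ->
  exists (L : fieldType) (f : {rmorphism F -> L}) (y : L), y ^+ n = f a.
Proof.
move=> n_gt0; have [|q irr /dvdpP[d pE]] := @exists_irreducible_factor F ('X^n - a%:P).
  by rewrite size_XnsubC.
have [L _ [z qz _]] := irredp_FAdjoin irr.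
exists (L : fieldType), (in_alg L), z; apply/eqP; rewrite -subr_eq0.
have := congr1 (fun p => (map_poly (in_alg L) p).[z]) pE.
rewrite rmorphB rmorphM /= map_polyXn map_polyC !hornerE.
by rewrite (eqP qz) mulr0 => ->.
Qed.

Lemma exists_roots_extension (F : fieldType) (n : nat) (I : finType) (a : I -> F) :
  (0 < n)%N ->
  exists (L : fieldType) (f : {rmorphism F -> L}) (y : I -> L),
    forall i, y i ^+ n = f (a i).
Proof.
move=> n_gt0.
suff [L [f yP]] : exists (L : fieldType) (f : {rmorphism F -> L}),
    forall i, i \in enum I -> exists y, y ^+ n = f (a i).
  have /fin_all_exists[y yE] i : exists y, y ^+ n = f (a i).
    by apply: yP; rewrite mem_enum.
  by exists L, f, y.
elim: (enum I) => [|i s [L [f IH]]]; first by exists F, idfun.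
have [L' [f' [y yE]]] := exists_root_extension (f (a i)) n_gt0.
exists L', (f' \o f) => j; rewrite inE => /predU1P[->|/IH[z zE]].
  by exists y.
by exists (f' z); rewrite /= -zE rmorphXn.
Qed.

(** * Twisted weights *)

Section Twist.
Variables (k : fieldType) (gT : finGroupType) (G H : {group gT}) (tau : gT).
Variables (e0 : nat) (om ze : k).
Local Notation e := e0.+1.
Local Notation m := #[tau]%g.
Hypotheses (nHG : (H <| G)%g) (abH : abelian H) (tauG : tau \in G).
Hypothesis genG : forall g, g \in G -> exists a, exists2 h, h \in H & g = (tau ^+ a * h)%g.
Hypothesis om_prim : e.-primitive_root om.
Hypothesis ze_prim : m.-primitive_root ze.

Local Notation D := (chr H e0).
Definition tau_index := #[coset H tau]%g.
Local Notation r := tau_index.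
Definition tau_coindex := (m %/ r)%N.
Local Notation n1 := tau_coindex.

Let nG : {in G, forall g, g \in 'N(H)%g}.
Proof. by move=> g Gg; apply: (subsetP (normal_norm nHG)). Qed.
Let HG : {in H, forall h, h \in G}.
Proof. by move=> h; apply: (subsetP (normal_sub nHG)). Qed.

Lemma tau_index_gt0 : (0 < r)%N. Proof. exact: order_gt0. Qed.

Lemma tau_expH a : ((tau ^+ a)%g \in H) = (r %| a)%N.
Proof.
rewrite order_dvdn -morphX ?nG //= -[in RHS]val_eqE /=; apply/idP/eqP => [|e].
  by move/coset_id->.
by apply: coset_idr; [exact/groupX/nG | apply: val_inj].
Qed.

Lemma tau_index_dvd : (r %| m)%N.
Proof. by rewrite -tau_expH expg_order group1. Qed.

Lemma tau_coindexK : (n1 * r)%N = m.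
Proof. exact: divnK tau_index_dvd. Qed.

Lemma tau_coindex_gt0 : (0 < n1)%N.
Proof. by have := order_gt0 tau; rewrite -tau_coindexK; case: n1. Qed.

Let ze0 : ze != 0.
Proof.
apply/eqP => z0; have := prim_expr_order ze_prim.
by rewrite z0 expr0n gtn_eqF ?order_gt0 //= => /eqP; rewrite eq_sym oner_eq0.
Qed.

(* A weight is a pair (l, chi): tau should scale by ze^l and h in H by om^(chi h).
   [compat] says that both prescriptions agree on tau^r, and [kap l chi] is then the
   resulting 1-cocycle, kap (tau^a h) = ze^(l a) om^(chi h). *)
Definition compat (l : int) (chi : D) : bool := ze ^ (l * r%:Z) == om ^+ chi (tau ^+ r)%g.

(** The a < r with g in tau^a H; the default 0 is met when g lies in no such coset. *)
Definition tau_log (g : gT) : nat :=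
  oapp (@nat_of_ord r) 0%N [pick a : 'I_r | (tau ^- a * g)%g \in H].

Definition kap (l : int) (chi : D) (g : gT) : k :=
  ze ^ (l * (tau_log g)%:Z) * om ^+ chi (tau ^- tau_log g * g)%g.

Lemma tau_log_exp a h : h \in H -> tau_log (tau ^+ a * h)%g = (a %% r)%N.
Proof.
move=> Hh; rewrite /tau_log.
have tauH b : (b < r)%N -> ((tau ^- b * (tau ^+ a * h))%g \in H) = (b == a %% r)%N.
  move=> lt_b; rewrite mulgA groupMr //.
  have [le_ab|lt_ba] := leqP a b.
    have -> : (tau ^- b * tau ^+ a)%g = ((tau ^+ (b - a))^-1)%g.
      by rewrite -{1}(subnKC le_ab) expgD invMg mulgKV.
    rewrite groupV tau_expH modn_small ?(leq_ltn_trans le_ab) //.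
    apply/idP/eqP => [|->]; last by rewrite subnn.
    rewrite /dvdn modn_small ?(leq_ltn_trans (leq_subr _ _)) // subn_eq0.
    by move=> le_ba; apply/eqP; rewrite eqn_leq le_ba.
  have -> : (tau ^- b * tau ^+ a)%g = (tau ^+ (a - b))%g.
    by rewrite -{1}(subnKC (ltnW lt_ba)) expgD mulKg.
  rewrite tau_expH -eqn_mod_dvd ?(ltnW lt_ba) // (modn_small lt_b).
  by rewrite eq_sym.
case: pickP => [b|no] /=; first by rewrite tauH // => /eqP.
have lt_r : (a %% r < r)%N by rewrite ltn_mod tau_index_gt0.
by have := no (Ordinal lt_r); rewrite tauH // eqxx.
Qed.

(** Reducing a modulo r moves a power of tau^r into the factor in H, and by [compat] both
    prescriptions give that power the same scalar. *)
Lemma kapE l chi a h : compat l chi -> h \in H ->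
  kap l chi (tau ^+ a * h)%g = ze ^ (l * a%:Z) * om ^+ chi h.
Proof.
move=> /eqP cl Hh; rewrite /kap tau_log_exp //.
have -> : (tau ^- (a %% r) * (tau ^+ a * h))%g = (tau ^+ (a %/ r * r) * h)%g.
  by rewrite {2}(divn_eq a r) addnC expgD -mulgA mulKg.
have Hr : (tau ^+ (a %/ r * r))%g \in H by rewrite tau_expH dvdn_mull.
rewrite chrM // (prim_exprD om_prim) mulrA; congr (_ * _).
rewrite mulnC expgM chrX ?tau_expH //.
have -> : om ^+ (chi (tau ^+ r)%g *+ (a %/ r)) = (om ^+ chi (tau ^+ r)%g) ^+ (a %/ r).
  by rewrite -exprM Zp_mulrn /= (prim_expr_mod om_prim).
rewrite -cl exprnP exprz_exp -expfzDr //; congr (_ ^ _).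
by rewrite -mulrA -PoszM -mulrDr -PoszD; congr (_ * Posz _); rewrite mulnC addnC -divn_eq.
Qed.

Lemma kap_neq0 l chi g : kap l chi g != 0.
Proof. by rewrite mulf_neq0 ?expfz_neq0 ?(prim_expr_neq0 om_prim). Qed.

Lemma kapD l l' chi chi' g : kap (l + l') (chi + chi') g = kap l chi g * kap l' chi' g.
Proof.
rewrite /kap mulrDl expfzDr // chrD (prim_exprD om_prim) !mulrA.
by congr (_ * _); rewrite -!mulrA; congr (_ * _); rewrite mulrC.
Qed.

Lemma kap_H l chi h : compat l chi -> h \in H -> kap l chi h = om ^+ chi h.
Proof.
move=> cl Hh; have := kapE 0 cl Hh; rewrite expg0 mul1g => ->.
by rewrite mulr0 expr0z mul1r.
Qed.

Lemma kap_tau l chi : compat l chi -> kap l chi tau = ze ^ l.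
Proof.
move=> cl; have := kapE 1 cl (group1 H); rewrite expg1 mulg1 => ->.
by rewrite chr1 expr0 !mulr1.
Qed.

(** Every g is tau^b h, and a power of tau lying in H commutes with both factors. *)
Lemma chrJ_tau_exp g (chi : D) a : g \in G -> chrJ g chi (tau ^+ a)%g = chi (tau ^+ a)%g.
Proof.
move=> Gg; have [b [h Hh ->]] := genG Gg.
have [Ha|nHa] := boolP ((tau ^+ a)%g \in H); last first.
  by rewrite !chr_out.
have Gtb : (tau ^+ b)%g \in G by rewrite groupX.
rewrite chrJE ?nG ?groupM ?(HG Hh) // conjgM; congr (chi _).
have -> : (tau ^+ a ^ tau ^+ b = tau ^+ a)%g.
  by rewrite conjgE -expgD addnC expgD mulKg.
by rewrite conjgE (centsP abH _ Ha _ Hh) mulKg.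
Qed.

Lemma compat_chrJ l chi g : g \in G -> compat l (chrJ g chi) = compat l chi.
Proof. by move=> Gg; rewrite /compat chrJ_tau_exp. Qed.

(** The product of tau^a h and tau^b h' has normal form tau^(a+b) (h^(tau^b) h'); the conjugate
    h^(tau^b) is where chi is twisted by g'. *)
Lemma kapM l chi g g' : compat l chi -> g \in G -> g' \in G ->
  kap l chi (g * g')%g = kap l (chrJ g' chi) g * kap l chi g'.
Proof.
move=> cl Gg Gg'; have cl' := cl; rewrite -(compat_chrJ _ _ Gg') in cl'.
have [a [h Hh gE]] := genG Gg; have [b [h' Hh' gE']] := genG Gg'.
have Hhb : (h ^ (tau ^+ b))%g \in H by rewrite memJ_norm ?nG ?groupX.
have -> : (g * g')%g = (tau ^+ (a + b) * (h ^ (tau ^+ b) * h'))%g.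
  by rewrite gE gE' expgD conjgE !mulgA mulgK.
rewrite [in kap l _ g]gE [in kap l chi g']gE' !kapE ?(groupM Hhb Hh') //.
have -> : chrJ g' chi h = chi (h ^ (tau ^+ b))%g.
  rewrite chrJE ?nG // gE' conjgM; congr (chi _).
  by rewrite [in LHS]conjgE (centsP abH _ Hhb _ Hh') mulKg.
rewrite chrM // (prim_exprD om_prim) PoszD mulrDr expfzDr // -!mulrA.
by congr (_ * _); rewrite mulrCA.
Qed.

(** As tau^r has n1-th power 1, chi gives it an n1-th root of unity, which is a power of ze^r
    because ze has the full order of tau. *)
Lemma compat_exists chi : exists2 a : 'I_m, compat (a : nat)%:Z chi & True.
Proof.
have zr : n1.-primitive_root (ze ^+ r).
  have n1m : (n1 %| m)%N by rewrite -tau_coindexK dvdn_mulr.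
  have := dvdn_prim_root ze_prim n1m.
  by rewrite -tau_coindexK mulKn ?tau_coindex_gt0.
have cz : (om ^+ chi (tau ^+ r)%g) ^+ n1 = 1.
  have := chrX chi n1 (_ : (tau ^+ r)%g \in H).
  rewrite tau_expH dvdnn => /(_ isT); rewrite -expgM mulnC tau_coindexK.
  rewrite expg_order chr1 => /(congr1 val) /= c0.
  rewrite -exprM -(prim_expr_mod om_prim) -[RHS](expr0 om); congr (_ ^+ _).
  by rewrite c0 Zp_mulrn.
have [a aE] := prim_rootP zr cz.
have le_n1 : (n1 <= m)%N.
  by rewrite -tau_coindexK leq_pmulr ?tau_index_gt0.
exists (widen_ord le_n1 a) => //; apply/eqP.
by rewrite aE -exprM /= -PoszM -exprnP mulnC.
Qed.

(** Chosen through the value chi(tau^r) alone, so that conjugate characters share it;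
    [compat_exists] excludes the default 0. *)
Definition jexp (chi : D) : nat :=
  oapp (@nat_of_ord m) 0%N
    [pick a : 'I_m | ze ^ ((a : nat)%:Z * r%:Z) == om ^+ chi (tau ^+ r)%g].

Lemma compat_jexp chi : compat (jexp chi)%:Z chi.
Proof.
rewrite /jexp; case: pickP => [a //|no].
by have [a ca _] := compat_exists chi; have := no a; rewrite [_ == _]ca.
Qed.

Lemma jexp_chrJ g chi : g \in G -> jexp (chrJ g chi) = jexp chi.
Proof. by move=> Gg; rewrite /jexp chrJ_tau_exp. Qed.

Lemma compatD l l' chi chi' :
  compat l chi -> compat l' chi' -> compat (l + l') (chi + chi').
Proof.
move=> /eqP cl /eqP cl'; rewrite /compat mulrDl expfzDr // cl cl'.
by rewrite chrD (prim_exprD om_prim).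
Qed.

Lemma ze_exprz_eq1 l : (ze ^ l == 1) = (m%:Z %| l)%Z.
Proof.
case: l => l; first by rewrite -exprnP -(prim_order_dvd ze_prim).
by rewrite NegzE -exprnN invr_eq1 -(prim_order_dvd ze_prim) dvdzE abszN.
Qed.

Lemma compat0 l : compat l 0 = (n1%:Z %| l)%Z.
Proof.
rewrite /compat ffunE expr0 ze_exprz_eq1 -tau_coindexK !dvdzE abszM.
by rewrite dvdn_pmul2r ?tau_index_gt0.
Qed.

Lemma compatMz l chi z : compat l chi -> compat (l * z) (chi *~ z).
Proof.
move=> cl; have cn n : compat (l * n%:Z) (chi *~ n%:Z).
  elim: n => [|n IHn]; first by rewrite mulr0 mulr0z compat0 dvdz0.
  by rewrite -addn1 PoszD mulrDr mulr1 mulrzDr mulr1z compatD.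
case: z => z //; rewrite NegzE mulrN mulrNz /compat mulNr -invr_expz.
have /eqP -> := cn z.+1.
by rewrite ffunE (prim_exprN om_prim).
Qed.

Lemma compat_sum (I : finType) (l : I -> int) (chi : I -> D) :
  (forall i, compat (l i) (chi i)) -> compat (\sum_i l i) (\sum_i chi i).
Proof.
move=> cl; apply: (big_ind2 compat) => //; first by rewrite compat0 dvdz0.
by move=> *; apply: compatD.
Qed.

Lemma kap0 g : kap 0 0 g = 1.
Proof. by rewrite /kap mul0r expr0z ffunE expr0 mulr1. Qed.

Lemma kapMz l chi z g : kap (l * z) (chi *~ z) g = kap l chi g ^ z.
Proof.
have kn n : kap (l * n%:Z) (chi *~ n%:Z) g = kap l chi g ^+ n.
  elim: n => [|n IHn]; first by rewrite mulr0 mulr0z kap0.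
  by rewrite -addn1 PoszD mulrDr mulr1 mulrzDr mulr1z kapD IHn exprD expr1.
case: z => z; first exact: kn.
rewrite NegzE mulrN mulrNz -exprnN -kn; apply: (mulfI (kap_neq0 (l * z.+1%:Z) (chi *~ z.+1%:Z) g)).
by rewrite -kapD !subrr kap0 mulfV ?kap_neq0.
Qed.

Lemma kap_sum (I : finType) (l : I -> int) (chi : I -> D) g :
  kap (\sum_i l i) (\sum_i chi i) g = \prod_i kap (l i) (chi i) g.
Proof.
by elim/big_rec3: _ => [|i x y z _ <-]; [rewrite kap0 | rewrite kapD].
Qed.

(** * Semi-invariants in a field with faithful action *)

Section Field.
Variables (F : fieldType) (cF : {rmorphism k -> F}) (act : gT -> {rmorphism F -> F}).
Hypothesis actM : {in G &, forall g g' x, act (g * g')%g x = act g (act g' x)}.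
Hypothesis act_cF : forall g c, g \in G -> act g (cF c) = cF c.
Hypothesis act_inj : {in G, forall g, (forall x, act g x = x) -> g = 1%g}.

Lemma act1 x : act 1%g x = x.
Proof.
apply: (fmorph_inj (act 1%g)).
by rewrite -actM ?mulg1.
Qed.

Lemma actK g : g \in G -> cancel (act g) (act g^-1%g).
Proof. by move=> Gg x; rewrite -actM ?groupV // mulVg act1. Qed.

Lemma act_eq : {in G &, forall g g', (forall x, act g x = act g' x) -> g = g'}.
Proof.
move=> g g' Gg Gg' gg'; apply/eqP; rewrite eq_mulVg1; apply/eqP.
apply: act_inj => [|x]; first by rewrite groupM ?groupV.
by rewrite actM ?groupV // -gg' actK.
Qed.

(** A representative of the G-orbit: [pick] returns the same element for all chi with the same
    orbit. *)
Definition chr_rep (chi : D) : D :=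
  odflt chi [pick psi : D | [exists g in G, chrJ g chi == psi]].

Lemma chr_rep_chrJ g chi : g \in G -> chr_rep (chrJ g chi) = chr_rep chi.
Proof.
move=> Gg; rewrite /chr_rep.
have eqp psi : [exists g' in G, chrJ g' (chrJ g chi) == psi] =
               [exists g' in G, chrJ g' chi == psi].
  apply/exists_inP/exists_inP => -[g' Gg' /eqP <-].
    by exists (g' * g)%g; rewrite ?groupM // chrJM ?nG.
  by exists (g' * g^-1)%g; rewrite ?groupM ?groupV // chrJM ?nG ?groupV // chrJK ?nG.
rewrite (eq_pick eqp); case: pickP => //= no.
have /negP[] := negbT (no chi); apply/exists_inP.
by exists 1%g; rewrite ?chrJ1.
Qed.

Lemma chr_rep_in chi : exists2 g, g \in G & chrJ g chi = chr_rep chi.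
Proof.
rewrite /chr_rep; case: pickP => [psi /exists_inP[g Gg /eqP <-]|]; first by exists g.
by move=> _; exists 1%g; rewrite ?chrJ1.
Qed.

(* Hilbert 90 for the cocycle [kap]: an average of the kap^-1 * g y is nonzero for some y. *)
Lemma twisted_family (l : D -> int) : (forall chi, compat (l chi) chi) ->
  (forall g chi, g \in G -> l (chrJ g chi) = l chi) ->
  exists w : D -> F, (forall chi, w chi != 0) /\
    forall g chi, g \in G -> act g (w chi) = cF (kap (l chi) chi g) * w (chrJ g chi).
Proof.
move=> cl lJ.
pose co chi g := if g \in G then cF (kap (l chi) (chrJ g^-1%g chi) g)^-1 else 0.
have /fin_all_exists[y yP] (chi : D) : exists y, \sum_g co chi g * act g y != 0.
  apply: (artin_independence (A := G) (i0 := 1%g)) => [g g' Gg Gg' /act_eq->//|g|].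
    by rewrite /co; case: ifP => //; rewrite eqxx.
  by rewrite /co group1 fmorph_eq0 invr_eq0 kap_neq0.
(* One y, that of the representative, serves a whole orbit; nonvanishing is known at the
   representative and transported by [wJ]. *)
pose w chi := \sum_g co chi g * act g (y (chr_rep chi)).
have wJ g0 chi : g0 \in G -> act g0 (w chi) = cF (kap (l chi) chi g0) * w (chrJ g0 chi).
  move=> Gg0; rewrite /w chr_rep_chrJ // rmorph_sum mulr_sumr /=.
  rewrite [RHS](reindex_inj (mulgI g0)); apply: eq_bigr => g _ /=.
  rewrite rmorphM mulrA /co groupMl //; case: ifP => Gg; last by rewrite rmorph0 mulr0 !mul0r.
  rewrite act_cF // -actM // lJ //; congr (_ * _); rewrite -rmorphM; congr (cF _).
  have -> : chrJ (g0 * g)^-1 (chrJ g0 chi) = chrJ g^-1 chi.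
    rewrite -chrJM; first by rewrite invMg mulgKV.
      by apply/nG; rewrite groupV groupM.
    exact: nG.
  have GgV : g^-1%g \in G by rewrite groupV.
  rewrite kapM //; last by rewrite compat_chrJ.
  rewrite (chrJKV (nG Gg)) -[X in X / _]mulr1 -mulf_div divff ?kap_neq0 //.
  by rewrite mul1r div1r.
exists w; split=> // chi.
have [g Gg chig] := chr_rep_in chi.
have : w (chr_rep chi) != 0.
  have rr : chr_rep (chr_rep chi) = chr_rep chi by rewrite -{1}chig chr_rep_chrJ.
  by rewrite /w rr.
apply: contraNneq => w0; have := wJ g chi Gg; rewrite w0 rmorph0 chig.
by move/esym/eqP; rewrite mulf_eq0 fmorph_eq0 (negPf (kap_neq0 _ _ _)).
Qed.

(** The trivial character with tau-exponent n1 is a compatible weight; [jexp] merely extends this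
    choice to the other characters. *)
Lemma exists_kummer_generator : exists2 Y : F, Y != 0 &
  forall g, g \in G -> act g Y = cF (kap n1%:Z 0 g) * Y.
Proof.
have J0 g : g \in G -> chrJ g (0 : D) = 0.
  by move=> Gg; apply: chrP => x; rewrite chrJE ?nG // !ffunE.
pose l (chi : D) := if chi == 0 then n1%:Z else (jexp chi)%:Z.
have [chi|g chi Gg|w [w0 wJ]] := @twisted_family l.
- rewrite /l; case: eqP => [->|_]; last exact: compat_jexp.
  by rewrite compat0 dvdzz.
- have -> : l (chrJ g chi) = l chi; last by [].
  rewrite /l jexp_chrJ // -{1}(J0 g Gg) (inj_eq (can_inj (chrJK (nG Gg)))).
  by [].
exists (w 0) => // g Gg.
by rewrite wJ // J0 // /l eqxx.
Qed.

(** * Monomials of prescribed weight *)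

Section Monomials.
Variables (w0 : D -> F) (Y : F).
Hypothesis w0_neq0 : forall chi, w0 chi != 0.
Hypothesis w0J : forall g chi, g \in G ->
  act g (w0 chi) = cF (kap (jexp chi)%:Z chi g) * w0 (chrJ g chi).
Hypothesis Y_neq0 : Y != 0.
Hypothesis YJ : forall g, g \in G -> act g Y = cF (kap n1%:Z 0 g) * Y.

Definition jweight (v : D -> int) : int := \sum_psi (jexp psi)%:Z * v psi.

(* The power of Y, of weight (n1, 0), adjusts the tau-part of the weight to l. *)
Definition twisted_monomial (l : int) (v : D -> int) : F :=
  (\prod_psi w0 psi ^ v psi) * Y ^ ((l - jweight v) %/ n1%:Z)%Z.

Lemma twisted_monomial_neq0 l v : twisted_monomial l v != 0.
Proof.
rewrite mulf_neq0 ?expfz_neq0 //; apply/prodf_neq0 => psi _.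
exact: expfz_neq0.
Qed.

Lemma jweight_compat v : compat (jweight v) (divisor_degree v).
Proof. by apply: compat_sum => psi; apply/compatMz/compat_jexp. Qed.

Lemma jweight_dvd l v : compat l (divisor_degree v) -> (n1%:Z %| l - jweight v)%Z.
Proof.
move=> cl; rewrite -compat0 -(subrr (divisor_degree v)).
apply: compatD => //; rewrite -[- jweight v]mulrN1 -[- divisor_degree v]mulrN1z.
exact/compatMz/jweight_compat.
Qed.

(** [jexp] is constant on orbits, so permuting the exponents leaves the power of Y unchanged, and
    the scalars multiply up to the cocycle of the total weight. *)
Lemma act_twisted_monomial g l v v' : g \in G -> compat l (divisor_degree v) ->
  (forall psi, v' (chrJ g psi) = v psi) ->
  act g (twisted_monomial l v) =
  cF (kap l (divisor_degree v) g) * twisted_monomial l v'.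
Proof.
move=> Gg cl v'J; have chrJ_bij : bijective (@chrJ gT H e0 g).
  by exists (chrJ g^-1); [apply: chrJK | apply: chrJKV]; apply: nG.
have jv' : jweight v' = jweight v.
  rewrite /jweight (reindex (chrJ g)) /=; last exact: onW_bij.
  by apply: eq_bigr => psi _; rewrite v'J jexp_chrJ.
rewrite /twisted_monomial jv'.
have /divzK lE := jweight_dvd cl; set t := (_ %/ _)%Z in lE *.
have kE : kap l (divisor_degree v) g =
    (\prod_psi kap (jexp psi)%:Z psi g ^ v psi) * kap n1%:Z 0 g ^ t.
  rewrite -kapMz mul0rz mulrC -[X in _ * X](_ : kap (jweight v) (divisor_degree v) g = _).
    by rewrite -kapD add0r mulrC lE subrK.
  by rewrite /jweight /divisor_degree kap_sum; apply: eq_bigr => psi _; rewrite kapMz.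
rewrite kE rmorphM /= !fmorphXz YJ // expfzMl ?fmorph_eq0 ?kap_neq0 //.
rewrite rmorph_prod [in RHS]rmorphM rmorph_prod /=.
rewrite [X in _ = _ * (X * _)](reindex (chrJ g)) /=; last exact: onW_bij.
under eq_bigr => psi _ do rewrite fmorphXz w0J // expfzMl.
rewrite big_split /= -!mulrA; congr (_ * _).
  by apply: eq_bigr => psi _; rewrite fmorphXz.
rewrite [in RHS]mulrCA; congr (_ * _).
  by apply: eq_bigr => psi _; rewrite v'J.
by rewrite fmorphXz.
Qed.

(** With a root Z of Y the exponent quotient disappears: each psi receives its own factor Z^(-jexp
    psi), and the expression becomes multiplicative in l and v. *)
Lemma twisted_monomial_extension (L : fieldType) (f : {rmorphism F -> L}) (Z : L) l v :
  Z ^+ n1 = f Y -> compat l (divisor_degree v) ->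
  f (twisted_monomial l v) =
  Z ^ l * \prod_psi (f (w0 psi) * Z ^ (- (jexp psi)%:Z)) ^ v psi.
Proof.
move=> ZY cl; have Z0 : Z != 0.
  by apply: contraNneq Y_neq0 => Z0; rewrite -(fmorph_eq0 f) -ZY Z0 expr0n gtn_eqF // tau_coindex_gt0.
have /divzK lE := jweight_dvd cl.
rewrite /twisted_monomial rmorphM /= fmorphXz -ZY exprnP exprz_exp mulrC.
rewrite [_ * (_ %/ _)%Z]mulrC lE rmorph_prod /=.
rewrite expfzDr // -mulrA; congr (_ * _).
rewrite mulrC; under [RHS]eq_bigr => psi _ do rewrite expfzMl.
rewrite big_split /=; congr (_ * _); first by apply: eq_bigr => psi _; rewrite fmorphXz.
rewrite /jweight -sumrN (big_morph (fun a : int => Z ^ a)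
  (fun a b => expfzDr a b Z0) (expr0z Z)).
by apply: eq_bigr => psi _; rewrite exprz_exp mulNr.
Qed.

Definition fixedG (x : F) := forall g, g \in G -> act g x = x.

Lemma fixedG_gen x :
  {in H, forall h, act h x = x} -> act tau x = x -> fixedG x.
Proof.
move=> hx tx g Gg; have [a [h Hh ->]] := genG Gg.
rewrite actM ?groupX ?(HG Hh) // hx //.
elim: a => [|a IHa]; first by rewrite expg0 act1.
by rewrite expgS actM ?groupX // IHa.
Qed.

Lemma act_tau_Y : act tau Y = cF (ze ^+ n1) * Y.
Proof. by rewrite YJ // kap_tau // compat0 dvdzz. Qed.

Lemma act_H_Y : {in H, forall h, act h Y = Y}.
Proof.
move=> h Hh; rewrite YJ ?HG // kap_H ?compat0 ?dvdzz // ffunE expr0.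
by rewrite rmorph1 mul1r.
Qed.

Lemma zen1_prim : r.-primitive_root (ze ^+ n1).
Proof.
rewrite /tau_coindex; apply: (dvdn_prim_root ze_prim); exact: tau_index_dvd.
Qed.

Lemma tau_index_unit : cF r%:R != 0.
Proof. by rewrite fmorph_eq0 (prim_root_natf_neq0 zen1_prim). Qed.

(* Projection onto the ze^(n1 i)-eigenspace of tau, which is spanned by Y^i over F^G. *)
Definition eigencomp (i : nat) (y : F) : F :=
  (cF r%:R)^-1 * \sum_(a < r) cF (ze ^+ (n1 * i * a))^-1 * act (tau ^+ a)%g y.

Lemma eigencomp_tau i y : {in H, forall h, act h y = y} ->
  act tau (eigencomp i y) = cF (ze ^+ (n1 * i)) * eigencomp i y.
Proof.
move=> Hy; rewrite /eigencomp rmorphM fmorphV act_cF // mulrCA; congr (_ * _).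
rewrite rmorph_sum mulr_sumr /=.
have r_gt0 := tau_index_gt0.
pose f a := cF (ze ^+ (n1 * i * a))^-1 * act (tau ^+ a)%g y.
have fS a : act tau (f a) = cF (ze ^+ (n1 * i)) * f a.+1.
  rewrite /f rmorphM act_cF // -actM ?groupX // -expgS mulrA -rmorphM.
  rewrite mulnS exprD invfM mulrA divff ?mul1r //.
  by rewrite expf_neq0.
have fr : f r = f 0%N.
  rewrite /f muln0 expr0 expg0 act1 Hy ?tau_expH //.
  congr (cF _^-1 * _); rewrite mulnAC tau_coindexK.
  by rewrite exprM (prim_expr_order ze_prim) expr1n.
transitivity (\sum_(a < r) cF (ze ^+ (n1 * i)) * f a.+1).
  by apply: eq_bigr => a _; rewrite -fS.
rewrite -!mulr_sumr; congr (_ * _).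
rewrite -(prednK r_gt0) big_ord_recr [RHS]big_ord_recl /= prednK // fr addrC.
by congr (_ + _); apply: eq_bigr.
Qed.

Lemma eigencomp_act i y : {in H, forall h, act h y = y} ->
  eigencomp i (act tau y) = act tau (eigencomp i y).
Proof.
move=> Hy; rewrite /eigencomp rmorphM fmorphV act_cF // rmorph_sum /=.
congr (_ * _); apply: eq_bigr => a _.
by rewrite rmorphM act_cF // -!actM ?groupX // -expgS -expgSr.
Qed.

Lemma eigencomp_H i y : {in H, forall h, act h y = y} ->
  {in H, forall h, act h (eigencomp i y) = eigencomp i y}.
Proof.
move=> Hy h Hh; have Gh := HG Hh.
rewrite /eigencomp rmorphM fmorphV act_cF // rmorph_sum /=.
congr (_ * _); apply: eq_bigr => a _.
rewrite rmorphM act_cF // -actM ?groupX //; congr (_ * _).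
have -> : (h * tau ^+ a = tau ^+ a * (h ^ (tau ^+ a)))%g by rewrite conjgC.
have Hha : (h ^ (tau ^+ a))%g \in H by rewrite memJ_norm ?nG ?groupX.
by rewrite actM ?groupX ?(HG Hha) // Hy.
Qed.

Lemma eigencomp_sum y : \sum_(i < r) eigencomp i y = y.
Proof.
rewrite -mulr_sumr exchange_big /=.
have r_gt0 := tau_index_gt0.
rewrite (bigD1 (Ordinal r_gt0)) //= [X in _ + X]big1 ?addr0 => [|a a0].
  under eq_bigr do rewrite muln0 expr0 invr1 rmorph1 mul1r.
  rewrite expg0 act1 sumr_const card_ord -[y *+ _]mulr_natl rmorph_nat.
  by rewrite mulKf // -(rmorph_nat cF) tau_index_unit.
rewrite -mulr_suml [X in X * _](_ : _ = 0) ?mul0r //.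
rewrite -rmorph_sum /=; apply/eqP; rewrite fmorph_eq0; apply/eqP.
set z := ((ze ^+ n1) ^+ a)^-1.
have z1 : z - 1 != 0.
  rewrite subr_eq0 invr_eq1 -(prim_order_dvd zen1_prim).
  by rewrite gtnNdvd // lt0n.
apply: (mulfI z1); rewrite mulr0.
transitivity ((z - 1) * \sum_(i < r) z ^+ i).
  congr (_ * _); apply: eq_bigr => i _.
  by rewrite /z [RHS]exprVn -!exprM mulnAC.
rewrite -subrX1 /z -exprVn -exprM mulnC exprM exprVn.
by rewrite (prim_expr_order zen1_prim) invr1 expr1n subrr.
Qed.

Definition kcomp (i : nat) (y : F) := eigencomp i y / Y ^+ i.

Lemma kcomp_fixed i y : {in H, forall h, act h y = y} -> fixedG (kcomp i y).
Proof.
move=> Hy; apply: fixedG_gen => [h Hh|].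
  by rewrite fmorph_div rmorphXn eigencomp_H // act_H_Y.
rewrite fmorph_div rmorphXn /= eigencomp_tau // act_tau_Y exprMn -rmorphXn.
rewrite exprM -mulf_div divff ?mul1r //=.
by rewrite fmorph_eq0 !expf_neq0.
Qed.

Lemma kcomp_sum y : \sum_(i < r) kcomp i y * Y ^+ i = y.
Proof.
rewrite -[RHS]eigencomp_sum; apply: eq_bigr => i _.
by rewrite /kcomp divfK // expf_neq0.
Qed.

Lemma kcomp_tau i y : {in H, forall h, act h y = y} ->
  kcomp i (act tau y) = cF (ze ^+ (n1 * i)) * kcomp i y.
Proof. by move=> Hy; rewrite /kcomp eigencomp_act // eigencomp_tau // mulrA. Qed.

(** A prime dividing #|D| divides its exponent, hence e, and e is invertible in k because k has a
    primitive e-th root of unity. *)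
Lemma card_chr_unit : cF #|{: D}|%:R != 0.
Proof.
rewrite fmorph_eq0 -cardsT; apply: (prim_root_pi_eq0 om_prim).
have De : (exponent [group of [set: (D : finZmodType)]] %| e)%N.
  apply/exponentP => x _; rewrite FinRing.zmodXgE; exact: chr_mulrn.
apply: sub_in_pnat (pnat_pi (cardG_gt0 [group of [set: (D : finZmodType)]])).
move=> p _; rewrite -[in X in X -> _]pi_of_exponent => /pi_of_dvd; exact.
Qed.

(** Fourier analysis on H splits x into chi-eigenvectors; divided by a monomial of weight chi, each
    becomes H-invariant, hence a combination of powers of Y over F^G. *)
Lemma twisted_decomposition (u : D -> D -> int) :
  (exponent H %| e)%N -> (forall chi, divisor_degree (u chi) = chi) -> forall x,
  exists2 c : D -> 'I_r -> F, forall chi i, fixedG (c chi i) &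
  x = \sum_chi \sum_i c chi i *
        twisted_monomial ((jexp chi)%:Z + n1%:Z * (i : nat)%:Z) (u chi).
Proof.
move=> eH uD x; pose X0 chi := twisted_monomial (jexp chi)%:Z (u chi).
have XY chi (i : 'I_r) : twisted_monomial ((jexp chi)%:Z + n1%:Z * (i : nat)%:Z) (u chi) =
    X0 chi * Y ^+ i.
  rewrite /X0 /twisted_monomial -mulrA exprnP -expfzDr //; congr (_ * _ ^ _).
  rewrite addrAC addrC [n1%:Z * _]mulrC divzMDl; first exact: addrC.
  by rewrite eqz_nat -lt0n tau_coindex_gt0.
pose xc (chi : D) := (cF #|{: D}|%:R)^-1 * \sum_(h in H) cF (om ^+ chi h)^-1 * act h x.
have xcE chi h : h \in H -> act h (xc chi) = cF (om ^+ chi h) * xc chi.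
  move=> Hh; rewrite /xc rmorphM fmorphV act_cF ?HG // mulrCA; congr (_ * _).
  rewrite rmorph_sum mulr_sumr /= [RHS](reindex_inj (mulgI h)) /=.
  apply: eq_big => [h'|h' Hh']; first by rewrite groupMl.
  rewrite rmorphM act_cF ?HG // -actM ?HG // mulrA -rmorphM; congr (cF _ * _).
  rewrite chrM // (prim_exprD om_prim) invfM mulrA divff ?mul1r //.
  exact: prim_expr_neq0 om_prim _.
have X0E chi h : h \in H -> act h (X0 chi) = cF (om ^+ chi h) * X0 chi.
  move=> Hh; have cj : compat (jexp chi)%:Z (divisor_degree (u chi)).
    by rewrite uD compat_jexp.
  rewrite (@act_twisted_monomial h _ _ (u chi)) ?HG //.
    by rewrite uD kap_H ?compat_jexp.
  by move=> psi; rewrite chrJ_abelian.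
pose yc chi := xc chi / X0 chi.
have ycH chi : {in H, forall h, act h (yc chi) = yc chi}.
  move=> h Hh; rewrite fmorph_div xcE // X0E // -mulf_div divff ?mul1r //.
  by rewrite fmorph_eq0 (prim_expr_neq0 om_prim).
exists (fun chi i => kcomp i (yc chi)) => [chi i|].
  exact: kcomp_fixed.
transitivity (\sum_chi xc chi).
  rewrite -mulr_sumr exchange_big /= (bigD1 1%g) //= [X in _ + X]big1 ?addr0 => [|h /andP[Hh h1]].
    under eq_bigr do rewrite chr1 expr0 invr1 rmorph1 mul1r act1.
    rewrite sumr_const -[x *+ _]mulr_natl rmorph_nat mulKf //.
    by rewrite -(rmorph_nat cF) card_chr_unit.
  rewrite -mulr_suml -rmorph_sum /= [X in cF X](_ : _ = 0) ?rmorph0 ?mul0r //.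
  rewrite -[RHS](chr_dual_sum om_prim abH eH (groupVr Hh) _) ?invg_eq1 //.
  by apply: eq_bigr => chi _; rewrite chrV // (prim_exprN om_prim).
apply: eq_bigr => chi _.
rewrite -[LHS](divfK (twisted_monomial_neq0 (jexp chi)%:Z (u chi))).
rewrite -[_ / _]/(yc chi) -[in LHS](kcomp_sum (yc chi)) mulr_suml.
by apply: eq_bigr => i _; rewrite XY mulrAC -mulrA.
Qed.
End Monomials.
End Field.

End Twist.

Lemma mpoly_morphism_eq (k : nzRingType) (N : nat) (R : nzRingType)
    (f g : {rmorphism {mpoly k[N]} -> R}) :
  (forall c, f c%:MP = g c%:MP) -> (forall i, f 'X_i = g 'X_i) -> f =1 g.
Proof.
move=> fgC fgX; elim/mpolyind => [|c m p _ _ IHp]; first by rewrite !rmorph0.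
rewrite !rmorphD IHp -mul_mpolyC !rmorphM fgC; congr (_ * _ + _).
rewrite -mmap1_id /mmap1 !rmorph_prod; apply: eq_bigr => i _.
by rewrite !rmorphXn fgX.
Qed.

(** * Substitutions in polynomial rings *)

Section Substitution.
Variables (k : comNzRingType) (N : nat).

Lemma mmap_id (p : {mpoly k[N]}) : mmap (@mpolyC N k) (fun i => 'X_i) p = p.
Proof.
apply: (@mpoly_morphism_eq _ _ _ (mmap (@mpolyC N k) (fun i => 'X_i)) idfun).
  by move=> c; apply: mmapC.
by move=> i; rewrite /= mmapX mmap1U.
Qed.

Lemma mmap_comp (N' : nat) (R : comNzRingType) (c : {rmorphism k -> R})
    (h : 'I_N' -> R) (t : 'I_N -> {mpoly k[N']}) (p : {mpoly k[N]}) :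
  mmap c h (mmap (@mpolyC N' k) t p) = mmap c (fun i => mmap c h (t i)) p.
Proof.
apply: (@mpoly_morphism_eq _ _ _ (mmap c h \o mmap (@mpolyC N' k) t)
  (mmap c (fun i => mmap c h (t i)))) => [a|i] /=; rewrite ?mmapC //.
by rewrite !mmapX !mmap1U.
Qed.

Lemma mmap_morph (R R' : comNzRingType) (c : {rmorphism k -> R})
    (f : {rmorphism R -> R'}) (c' : {rmorphism k -> R'}) (h : 'I_N -> R)
    (p : {mpoly k[N]}) :
  (forall a, c' a = f (c a)) -> f (mmap c h p) = mmap c' (fun i => f (h i)) p.
Proof.
move=> cc'; apply: (@mpoly_morphism_eq _ _ _ (f \o mmap c h)
  (mmap c' (fun i => f (h i)))) => [a|i] /=.
  by rewrite !mmapC; apply/esym/cc'.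
by rewrite !mmapX !mmap1U.
Qed.

Lemma mmap_ext (R : comNzRingType) (c c' : {rmorphism k -> R}) (h h' : 'I_N -> R)
    (p : {mpoly k[N]}) : c =1 c' -> h =1 h' -> mmap c h p = mmap c' h' p.
Proof.
move=> cc' hh'; apply: (@mpoly_morphism_eq _ _ _ (mmap c h) (mmap c' h')).
  by move=> a; rewrite /= !mmapC; apply: cc'.
by move=> i; rewrite /= !mmapX !mmap1U; apply: hh'.
Qed.

Definition mscale (z : 'I_N -> k) : {mpoly k[N]} -> {mpoly k[N]} :=
  mmap (@mpolyC N k) (fun i => z i *: 'X_i).

Lemma mmap_monomials (h : 'I_N -> k) (t : 'X_{1..N} -> 'X_{1..N}) (p : {mpoly k[N]})
    (f : 'I_N -> {mpoly k[N]}) :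
  (forall m, mmap1 f m = (\prod_i h i ^+ m i) *: 'X_[t m]) ->
  mmap (@mpolyC N k) f p =
  \sum_(m <- msupp p) (p@_m * \prod_i h i ^+ m i) *: 'X_[t m].
Proof.
move=> fm; rewrite /mmap; apply: eq_bigr => m _.
by rewrite fm mul_mpolyC scalerA.
Qed.

Lemma mcoeff_mscale z (p : {mpoly k[N]}) m :
  (mscale z p)@_m = p@_m * \prod_i z i ^+ m i.
Proof.
rewrite /mscale (@mmap_monomials z id); last first.
  move=> m'; rewrite -[in RHS]mmap1_id /mmap1 -scaler_prod.
  by apply: eq_bigr => i _; rewrite exprZn.
rewrite raddf_sum /=; under eq_bigr do rewrite mcoeffZ mcoeffX.
have [m_in|m_out] := boolP (m \in msupp p).
  rewrite (bigD1_seq m) //= eqxx mulr1 [X in _ + X]big1_seq ?addr0 // => m' /andP[ne _].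
  by rewrite (negPf ne) mulr0.
rewrite (memN_msupp_eq0 m_out) mul0r big1_seq // => m' /andP[_ m'_in].
by rewrite [m' == m]negbTE ?mulr0 //; apply: contraNneq m_out => <-.
Qed.

Variable w : 'I_N -> nat.
Hypothesis w_gt0 : forall i, (0 < w i)%N.

Definition mpower : {mpoly k[N]} -> {mpoly k[N]} :=
  mmap (@mpolyC N k) (fun i => 'X_i ^+ w i).
HB.instance Definition _ := GRing.RMorphism.on mpower.

Definition wmul (m : 'X_{1..N}) : 'X_{1..N} := [multinom (w i * m i)%N | i < N].

Lemma mpowerE (p : {mpoly k[N]}) :
  mpower p = \sum_(m <- msupp p) p@_m *: 'X_[wmul m].
Proof.
rewrite /mpower (@mmap_monomials (fun=> 1) wmul).
  by apply: eq_bigr => m _; rewrite big1 ?mulr1 // => i _; rewrite expr1n.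
move=> m; rewrite big1 ?scale1r => [|i _]; last by rewrite expr1n.
rewrite -mmap1_id /mmap1; apply: eq_bigr => i _.
by rewrite mnmE exprM.
Qed.

Lemma wmul_inj : injective wmul.
Proof.
move=> m m' /mnmP e; apply/mnmP => i; have := e i; rewrite !mnmE.
by move/eqP; rewrite eqn_pmul2l // => /eqP.
Qed.

Lemma mpower_inj : injective mpower.
Proof.
move=> p q; suff coef r m : (mpower r)@_(wmul m) = r@_m.
  by move=> e; apply/mpolyP => m; rewrite -(coef p) -(coef q) e.
rewrite mpowerE raddf_sum /=.
have eqw m' : (r@_m' *: 'X_[k, wmul m'])@_(wmul m) = r@_m' * (m' == m)%:R.
  by rewrite mcoeffZ mcoeffX; rewrite (inj_eq wmul_inj).
rewrite (eq_bigr _ (fun m' _ => eqw m')).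
have [m_in|m_out] := boolP (m \in msupp r).
  rewrite (bigD1_seq m) //= eqxx mulr1 [X in _ + X]big1_seq ?addr0 // => m' /andP[ne _].
  by rewrite (negPf ne) mulr0.
rewrite (memN_msupp_eq0 m_out) big1_seq // => m' /andP[_ m'_in].
by rewrite [m' == m]negbTE ?mulr0 //; apply: contraNneq m_out => <-.
Qed.
End Substitution.

(** Scaling X_i by a primitive w_i-th root z multiplies a monomial m by z^(m i), so invariance
    forces w_i to divide the exponents of X_i that occur. *)
Lemma mpower_image (k : fieldType) (N : nat) (w : 'I_N -> nat) (p : {mpoly k[N]}) :
  (forall i, w i = 1%N \/ exists2 z, (w i).-primitive_root z &
     mscale (fun j => if j == i then z else 1) p = p) ->
  exists q, mpower w q = p.
Proof.
move=> wp; have w_dvd m i : m \in msupp p -> (w i %| m i)%N.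
  move=> m_in; case: (wp i) => [->//|[z z_prim /(congr1 (mcoeff m))]].
  rewrite mcoeff_mscale (bigD1 i) //= eqxx big1 ?mulr1 => [|j ne_j]; last first.
    by rewrite (negPf ne_j) expr1n.
  rewrite -[RHS]mulr1 => /mulfI pm1; rewrite (prim_order_dvd z_prim) pm1 //.
  by rewrite -mcoeff_msupp.
exists (\sum_(m <- msupp p) p@_m *: 'X_[[multinom (m i %/ w i)%N | i < N]]).
rewrite raddf_sum [RHS]mpolyE; apply: eq_big_seq => m m_in /=.
rewrite -mul_mpolyC rmorphM /= /mpower mmapC mul_mpolyC mmapX; congr (_ *: _).
rewrite -[RHS]mmap1_id /mmap1; apply: eq_bigr => i _.
by rewrite mnmE -exprM mulnC divnK ?w_dvd.
Qed.

Lemma cyclic_sum_shift (V : zmodType) (f : nat -> V) r :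
  (0 < r)%N -> f r = f 0%N -> \sum_(g < r) f g = \sum_(g < r) f g.+1.
Proof.
case: r => // r _ fr; rewrite big_ord_recl [RHS]big_ord_recr /= fr addrC.
by congr (_ + _); apply: eq_bigr.
Qed.

(** * Polynomial rings with variables indexed by a finite type *)

Definition fvar (k : nzRingType) (I : finType) (i : I) : {mpoly k[#|I|]} :=
  'X_(enum_rank i).

Definition feval (k : nzRingType) (I : finType) (R : nzRingType) (c : k -> R)
  (f : I -> R) (p : {mpoly k[#|I|]}) : R := mmap c (fun i => f (enum_val i)) p.

HB.instance Definition _ (k : nzRingType) (I : finType) (R : comNzRingType)
  (c : {rmorphism k -> R}) (f : I -> R) :=
  GRing.RMorphism.copy (feval c f) (mmap c (fun i => f (enum_val i))).

Section Feval.
Variables (k : comNzRingType) (I : finType).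

Lemma feval_var (R : nzRingType) (c : {rmorphism k -> R}) (f : I -> R) i :
  feval c f (fvar k i) = f i.
Proof. by rewrite /feval mmapX mmap1U enum_rankK. Qed.

Lemma fevalC (R : nzRingType) (c : {rmorphism k -> R}) (f : I -> R) a :
  feval c f a%:MP = c a.
Proof. exact: mmapC. Qed.

Lemma fevalZ (R : comNzRingType) (c : {rmorphism k -> R}) (f : I -> R) a p :
  feval c f (a *: p) = c a * feval c f p.
Proof. exact: mmapZ. Qed.

Lemma feval_comp (I' : finType) (R : comNzRingType) (c : {rmorphism k -> R})
    (h : I' -> R) (t : I -> {mpoly k[#|I'|]}) (p : {mpoly k[#|I|]}) :
  feval c h (feval (@mpolyC _ k) t p) = feval c (fun i => feval c h (t i)) p.
Proof. exact: mmap_comp. Qed.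

Lemma feval_ext (R : comNzRingType) (c : {rmorphism k -> R}) (h h' : I -> R)
    (p : {mpoly k[#|I|]}) : h =1 h' -> feval c h p = feval c h' p.
Proof. by move=> hh'; apply: mmap_ext => // i. Qed.
End Feval.

(** * Descent of invariant lifts to the base polynomial ring *)

Section Descent.
Variables (k : fieldType) (J Cx : finType) (sJ : J -> J) (e r n1 : nat) (om ze : k).
Hypotheses (r_gt0 : (0 < r)%N) (n1_gt0 : (0 < n1)%N) (e_gt0 : (0 < e)%N).
Hypothesis sJr : forall j, iter r sJ j = j.
Hypothesis om_prim : e.-primitive_root om.
Hypothesis ze_prim : (n1 * r).-primitive_root ze.

(* [root_vars]: the e-th roots al_j, the n1-th root Z of Y (inr None) and the
   coefficients.  [base_vars]: the coordinates of the a_j on the powers of Y, then Z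
   and the coefficients.  [generic_orbit j] is the generic a_j, averaged over the
   rotation so that it is permuted like the index j. *)
Definition root_vars := (J + option Cx)%type.
Definition base_vars := (J * 'I_r + option Cx)%type.
Local Notation R1 := {mpoly k[#|{: root_vars}|]}.
Local Notation R2 := {mpoly k[#|{: base_vars}|]}.
Local Notation v1 := (@fvar k root_vars).
Local Notation v2 := (@fvar k base_vars).

Definition kummer_powers (i : root_vars) : R1 :=
  match i with inl j => v1 i ^+ e | inr _ => v1 i end.
Definition root_rotate (i : root_vars) : R1 :=
  match i with
  | inl j => v1 (inl (sJ j)) | inr None => ze *: v1 i | inr (Some _) => v1 i
  end.
Definition root_scale (j0 : J) (i : root_vars) : R1 :=
  if i == inl j0 then om *: v1 i else v1 i.

Definition generic_orbit (j : J) : R2 := \sum_(g < r) \sum_(i < r)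
  (ze^-1 ^+ (n1 * i * g)) *: (v2 (inl (iter g sJ j, i)) * v2 (inr None) ^+ (n1 * i)).
Definition base_subst (i : root_vars) : R2 :=
  match i with inl j => generic_orbit j | inr c => v2 (inr c) end.
(** The base variable [inr None] stands for Z^(n1 r) = Y^r, a power of Y fixed by G. *)
Definition base_powers (i : base_vars) : R2 :=
  match i with inr None => v2 i ^+ (n1 * r) | _ => v2 i end.
Definition base_rotate (i : base_vars) : R2 :=
  match i with inr None => ze *: v2 i | _ => v2 i end.


Lemma kummer_powersE : feval (@mpolyC _ k) kummer_powers =1
  mpower (fun i : 'I_#|{: root_vars}| => if enum_val i is inl _ then e else 1%N).
Proof.
move=> p; apply: mmap_ext => // i; rewrite /kummer_powers /fvar.
by case E: (enum_val i) => [j|c] /=; rewrite -E enum_valK.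
Qed.

Lemma base_powersE : feval (@mpolyC _ k) base_powers =1
  mpower (fun i : 'I_#|{: base_vars}| =>
    if enum_val i is inr None then (n1 * r)%N else 1%N).
Proof.
move=> p; apply: mmap_ext => // i; rewrite /base_powers /fvar.
by case E: (enum_val i) => [j|[c|]] /=; rewrite -E enum_valK.
Qed.

Lemma kummer_powers_inj : injective (feval (@mpolyC _ k) kummer_powers).
Proof.
move=> p q; rewrite !kummer_powersE; apply: mpower_inj => i.
by case: (enum_val i).
Qed.

Lemma base_powers_inj : injective (feval (@mpolyC _ k) base_powers).
Proof.
move=> p q; rewrite !base_powersE; apply: mpower_inj => i.
by case: (enum_val i) => // -[c //|]; rewrite muln_gt0 n1_gt0.
Qed.

(** Z^(n1 i) is multiplied by ze^(n1 i), which shifts g by one; the sum over g is cyclic since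
    ze^(n1 r) = 1 and [iter r sJ] is the identity. *)
Lemma generic_orbit_rotate j :
  feval (@mpolyC _ k) base_rotate (generic_orbit j) = generic_orbit (sJ j).
Proof.
have ze0 : ze != 0.
  by rewrite (prim_root_eq0 ze_prim) -lt0n muln_gt0 n1_gt0.
pose f g : R2 := \sum_(i < r) (ze^-1 ^+ (n1 * i * g)) *:
  (v2 (inl (iter g sJ j, i)) * (ze ^+ (n1 * i) *: v2 (inr None) ^+ (n1 * i))).
transitivity (\sum_(g < r) f g).
  rewrite rmorph_sum; apply: eq_bigr => g _ /=.
  rewrite rmorph_sum; apply: eq_bigr => i _ /=.
  by rewrite fevalZ mul_mpolyC rmorphM rmorphXn /= !feval_var /= exprZn.
have fS g : f g.+1 = \sum_(i < r) (ze^-1 ^+ (n1 * i * g)) *: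
    (v2 (inl (iter g sJ (sJ j), i)) * v2 (inr None) ^+ (n1 * i)).
  apply: eq_bigr => i _; rewrite iterSr -scalerAr scalerA; congr (_ *: _).
  by rewrite mulnSr exprD -mulrA -exprMn mulVf // expr1n mulr1.
have fr : f r = f 0%N.
  apply: eq_bigr => i _; rewrite sJr muln0; congr (_ *: _).
  rewrite mulnAC exprVn exprM (prim_expr_order ze_prim) expr1n invr1.
  by rewrite expr0.
rewrite /generic_orbit; under [RHS]eq_bigr => g _ do rewrite -fS.
exact: cyclic_sum_shift.
Qed.

Lemma base_subst_rotate p :
  feval (@mpolyC _ k) base_subst (feval (@mpolyC _ k) root_rotate p) =
  feval (@mpolyC _ k) base_rotate (feval (@mpolyC _ k) base_subst p).
Proof.
rewrite !feval_comp; apply: feval_ext => -[j|[c|]] /=.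
- by rewrite feval_var generic_orbit_rotate.
- by rewrite !feval_var.
- by rewrite fevalZ !feval_var mul_mpolyC.
Qed.

Lemma kummer_powers_rotate p :
  feval (@mpolyC _ k) root_rotate (feval (@mpolyC _ k) kummer_powers p) =
  feval (@mpolyC _ k) kummer_powers (feval (@mpolyC _ k) root_rotate p).
Proof.
rewrite !feval_comp; apply: feval_ext => -[j|[c|]] /=.
- by rewrite rmorphXn /= !feval_var.
- by rewrite !feval_var.
- by rewrite fevalZ !feval_var mul_mpolyC.
Qed.

(** Scaling invariance makes p a polynomial q in the e-th powers. Once generic orbits are
    substituted for these, rotation amounts to Z -> ze Z alone, so the result is a polynomial in
    Z^(n1 r). *)
Lemma invariant_descent (p : R1) :
  (forall j, feval (@mpolyC _ k) (root_scale j) p = p) ->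
  feval (@mpolyC _ k) root_rotate p = p ->
  exists (q : R1) (b : R2), feval (@mpolyC _ k) kummer_powers q = p /\
    feval (@mpolyC _ k) base_powers b = feval (@mpolyC _ k) base_subst q.
Proof.
move=> p_scale p_rot.
have [|q qp] := @mpower_image k _
    (fun i : 'I_#|{: root_vars}| => if enum_val i is inl _ then e else 1%N) p.
  move=> i; case E: (enum_val i) => [j|c]; [right | by left].
  exists om => //; rewrite -[RHS](p_scale j); apply: mmap_ext => // i'.
  rewrite /root_scale /fvar enum_valK -E (inj_eq enum_val_inj).
  by case: eqP => // _; rewrite scale1r.
rewrite -kummer_powersE in qp.
(* The rotation commutes with the e-th power substitution, which is injective. *)
have q_rot : feval (@mpolyC _ k) root_rotate q = q.
  by apply: kummer_powers_inj; rewrite -kummer_powers_rotate qp.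
have [|b bq] := @mpower_image k _ (fun i : 'I_#|{: base_vars}| =>
    if enum_val i is inr None then (n1 * r)%N else 1%N)
    (feval (@mpolyC _ k) base_subst q).
  move=> i; case E: (enum_val i) => [j|[c|]]; [by left | by left | right].
  exists ze => //.
  rewrite -[in RHS]q_rot base_subst_rotate; apply: mmap_ext => // i'.
  rewrite /base_rotate /fvar; case: eqP => [->|ne]; first by rewrite E -E enum_valK.
  case E': (enum_val i') => [j|[c|]]; rewrite -?E' ?enum_valK ?scale1r //.
  by case: ne; apply: enum_val_inj; rewrite E E'.
by exists q, b; rewrite base_powersE.
Qed.
End Descent.

(** * Finite generation of invariants *)

Section Invariants.
Variables (k : fieldType) (n : nat) (gT : finGroupType) (G : {group gT}).
Local Notation P := {mpoly k[n]}.
Variable s : gT -> {rmorphism P -> P}.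
Hypothesis sM : {in G &, forall g h p, s (g * h)%g p = s g (s h p)}.
Hypothesis s1 : forall p, s 1%g p = p.
Hypothesis sC : forall g c, g \in G -> s g c%:MP = c%:MP.
Hypothesis G_unit : #|G|%:R != 0 :> k.
Local Notation N := #|G|.

Definition reynolds (p : P) : P := (#|G|%:R^-1 : k) *: \sum_(g in G) s g p.

Definition orbit_poly (i : 'I_n) : {poly P} := \prod_(g in G) ('X - (s g 'X_i)%:P).

Definition orbit_gens_idx := ('I_n * 'I_N + {ffun 'I_n -> 'I_N})%type.
Definition small_monomial (v : {ffun 'I_n -> 'I_N}) : P := \prod_i 'X_i ^+ v i.
(* 'X_i is integral of degree #|G| over the coefficients of [orbit_poly i], so the
   monomials with exponents < #|G| span the polynomial ring over them. *)
Definition orbit_gens (i : orbit_gens_idx) : P :=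
  match i with
  | inl (i, l) => (orbit_poly i)`_l
  | inr v => reynolds (small_monomial v)
  end.

Let sZ g c p : g \in G -> s g (c *: p) = c *: s g p.
Proof. by move=> Gg; rewrite -!mul_mpolyC rmorphM sC. Qed.

Lemma reynolds_fixed p g : g \in G -> s g (reynolds p) = reynolds p.
Proof.
move=> Gg; rewrite /reynolds sZ // rmorph_sum; congr (_ *: _) => /=.
rewrite [RHS](reindex_inj (mulgI g)) /=; apply: eq_big => h; first by rewrite groupMl.
by move=> Gh; rewrite sM.
Qed.

Lemma reynolds_id p : (forall g, g \in G -> s g p = p) -> reynolds p = p.
Proof.
move=> sp; rewrite /reynolds (eq_bigr _ (fun g Gg => sp g Gg)) sumr_const.
by rewrite -scaler_nat scalerA mulVf // scale1r.
Qed.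

Lemma orbit_poly_fixed i l g : g \in G -> s g (orbit_poly i)`_l = (orbit_poly i)`_l.
Proof.
move=> Gg; rewrite -coef_map.
suff -> : map_poly (s g) (orbit_poly i) = orbit_poly i by [].
rewrite /orbit_poly rmorph_prod [RHS](reindex_inj (mulgI g)) /=.
apply: eq_big => h; first by rewrite groupMl.
by move=> Gh; rewrite rmorphB /= map_polyX map_polyC /= sM.
Qed.

Lemma orbit_gens_fixed i g : g \in G -> s g (orbit_gens i) = orbit_gens i.
Proof.
by case: i => [[i l]|v] Gg; [apply: orbit_poly_fixed | apply: reynolds_fixed].
Qed.

Let inA (p : P) := exists Q, p = feval (@mpolyC n k) orbit_gens Q.

Let inA0 : inA 0. Proof. by exists 0; rewrite rmorph0. Qed.
Let inAD p q : inA p -> inA q -> inA (p + q).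
Proof. by move=> [P1 ->] [Q1 ->]; exists (P1 + Q1); rewrite rmorphD. Qed.
Let inAM p q : inA p -> inA q -> inA (p * q).
Proof. by move=> [P1 ->] [Q1 ->]; exists (P1 * Q1); rewrite rmorphM. Qed.
Let inAN p : inA p -> inA (- p).
Proof. by move=> [P1 ->]; exists (- P1); rewrite rmorphN. Qed.
Let inAC c : inA c%:MP. Proof. by exists c%:MP; rewrite fevalC. Qed.
Let inAgen i : inA (orbit_gens i).
Proof. by exists (fvar k i); rewrite feval_var. Qed.

Let inA_fixed p g : g \in G -> inA p -> s g p = p.
Proof.
move=> Gg [Q ->]; rewrite /feval (@mmap_morph _ _ _ _ _ (s g) (@mpolyC n k)) //.
  by apply: mmap_ext => // i; apply: orbit_gens_fixed.
by move=> c; rewrite sC.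
Qed.

Let inM (p : P) := exists c : {ffun 'I_n -> 'I_N} -> P,
  (forall v, inA (c v)) /\ p = \sum_v c v * small_monomial v.

Let inM0 : inM 0.
Proof. by exists (fun=> 0); split=> //; rewrite big1 // => v _; rewrite mul0r. Qed.
Let inMD p q : inM p -> inM q -> inM (p + q).
Proof.
move=> [c [cA ->]] [d [dA ->]]; exists (fun v => c v + d v); split=> [v|].
  exact: inAD.
by rewrite -big_split; apply: eq_bigr => v _; rewrite mulrDl.
Qed.
Let inMZ a p : inA a -> inM p -> inM (a * p).
Proof.
move=> aA [c [cA ->]]; exists (fun v => a * c v); split=> [v|]; first exact: inAM.
by rewrite mulr_sumr; apply: eq_bigr => v _; rewrite mulrA.
Qed.
Let inM_small v : inM (small_monomial v).
Proof.
exists (fun v' => (v' == v)%:R); split=> [v'|].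
  by case: eqP => _ //; rewrite -[true%:R](@mpolyC1 n k).
rewrite (bigD1 v) //= eqxx mul1r big1 ?addr0 // => v' ne.
by rewrite (negPf ne) mul0r.
Qed.
Let inM_sum (I : finType) (f : I -> P) : (forall i, inM (f i)) -> inM (\sum_i f i).
Proof. by move=> fM; elim/big_ind: _ => // *; apply: inMD. Qed.

Let orbit_polyX i : 'X_i ^+ N = - \sum_(l < N) (orbit_poly i)`_l * 'X_i ^+ l :> P.
Proof.
have sz : size (orbit_poly i) = N.+1 by rewrite /orbit_poly -big_enum size_prod_XsubC -cardE.
have mon : orbit_poly i \is monic.
  by rewrite /orbit_poly -big_enum monic_prod_XsubC.
have : (orbit_poly i).['X_i] = 0.
  rewrite /orbit_poly (bigD1 1%g) ?group1 //= hornerM hornerXsubC s1.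
  by rewrite subrr mul0r.
have lc : (orbit_poly i)`_N = 1 by have := monicP mon; rewrite lead_coefE sz.
rewrite horner_coef sz big_ord_recr /= lc.
by rewrite mul1r addrC => /eqP; rewrite addr_eq0 => /eqP.
Qed.

(** An exponent reaching #|G| is lowered by the integral equation [orbit_polyX]. *)
Let inMX i p : inM p -> inM ('X_i * p).
Proof.
move=> [c [cA ->]]; rewrite mulr_sumr; apply: inM_sum => v.
rewrite mulrCA; apply: inMZ => //.
pose upd (l : 'I_N) := [ffun j => if j == i then l else v j].
pose rest := \prod_(j | j != i) 'X_j ^+ v j : P.
have updE l : small_monomial (upd l) = 'X_i ^+ l * rest.
  rewrite /small_monomial (bigD1 i) //= ffunE eqxx; congr (_ * _).
  by apply: eq_bigr => j /negPf ne; rewrite ffunE ne.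
have -> : 'X_i * small_monomial v = 'X_i ^+ (v i).+1 * rest.
  by rewrite /small_monomial (bigD1 i) //= mulrA -exprS.
have [lt_v|le_v] := ltnP (v i).+1 N.
  by rewrite -[(v i).+1]/(val (Ordinal lt_v)) -updE.
have -> : (v i).+1 = N by apply/eqP; rewrite eqn_leq le_v ltn_ord.
rewrite orbit_polyX mulNr mulr_suml -sumrN; apply: inM_sum => l.
rewrite -mulrA -updE -mulNr; apply: inMZ => //; apply: inAN.
exact: (inAgen (inl (i, l))).
Qed.

Let inM_all p : inM p.
Proof.
have N_gt0 : (0 < N)%N by apply: cardG_gt0.
have inM1 : inM 1.
  have <- : small_monomial [ffun=> Ordinal N_gt0] = 1.
    by rewrite /small_monomial big1 // => i _; rewrite ffunE expr0.
  exact: inM_small.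
elim/mpolyind: p => // c m p _ _ IHp; apply: inMD => //.
rewrite -mul_mpolyC; apply: inMZ => //.
rewrite -mmap1_id /mmap1 -[X in inM X]mulr1.
have : forall q, inM q -> inM (\prod_(i < n) 'X_i ^+ m i * q).
  elim/big_ind: _ => [q|x y hx hy q qM|i _ q qM]; first by rewrite mul1r.
    by rewrite -mulrA; apply/hx/hy.
  elim: (m i) => [|a IHa]; first by rewrite mul1r.
  by rewrite exprS -mulrA; apply: inMX.
exact.
Qed.

(** The Reynolds operator is linear over the algebra of the generators, whose elements are
    invariant, so it turns an expansion of p in small monomials into one in their Reynolds
    images. *)
Lemma invariants_generated p : (forall g, g \in G -> s g p = p) ->
  exists Q, p = feval (@mpolyC n k) orbit_gens Q.
Proof.
move=> sp; rewrite -(reynolds_id sp).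
have [c [cA {1}->]] := inM_all p.
have -> : reynolds (\sum_v c v * small_monomial v) =
    \sum_v c v * orbit_gens (inr v).
  rewrite /orbit_gens /reynolds; under eq_bigr do rewrite rmorph_sum.
  rewrite exchange_big scaler_sumr; apply: eq_bigr => v _ /=.
  rewrite -scalerAr mulr_sumr; congr (_ *: _); apply: eq_bigr => g Gg.
  by rewrite rmorphM inA_fixed.
elim/big_ind: _ => [|x y|v _]; [exact: inA0 | exact: inAD | exact: inAM].
Qed.
End Invariants.

(** * A criterion for retract rationality *)

Section LocalizedAlgebra.
Variables (k L : fieldType) (iL : {rmorphism k -> L}) (S : nat) (a : 'I_S -> L).
Variable g : {mpoly k[S]}.
Local Notation ev := (mmap iL a).

(** The algebra k[a_1, ..., a_S][1/g(a)] inside L; g(a) != 0 is an argument so that the ring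
    structures attached to the predicate can depend on it. *)
Definition localg_pred of ev g != 0 : {pred L} := fun x =>
  `[< exists (P : {mpoly k[S]}) (l : nat), x = ev P / ev g ^+ l >].

Hypothesis g0 : ev g != 0.

Let gX l : ev g ^+ l != 0. Proof. exact: expf_neq0. Qed.

Lemma localg_subring : subring_closed (localg_pred g0).
Proof.
split; first by apply/asboolP; exists 1, 0%N; rewrite rmorph1 expr0 divr1.
  move=> _ _ /asboolP[P [l ->]] /asboolP[Q [l' ->]]; apply/asboolP.
  exists (P * g ^+ l' - Q * g ^+ l), (l + l')%N.
  by rewrite -mulNr addf_div // exprD rmorphB !rmorphM !rmorphXn mulNr.
move=> _ _ /asboolP[P [l ->]] /asboolP[Q [l' ->]]; apply/asboolP.
by exists (P * Q), (l + l')%N; rewrite mulf_div exprD rmorphM.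
Qed.
HB.instance Definition _ :=
  GRing.isSubringClosed.Build _ (localg_pred g0) localg_subring.

Record localg := LocAlg { localg_val :> L; localg_valP : localg_val \in localg_pred g0 }.
HB.instance Definition _ := [isSub for localg_val].
HB.instance Definition _ := [Choice of localg by <:].
HB.instance Definition _ := [SubChoice_isSubComNzRing of localg by <:].

Definition localg_unit : {pred localg} := fun x =>
  (val x != 0) && ((val x)^-1 \in localg_pred g0).
Definition localg_inv (x : localg) : localg :=
  if x \in localg_unit then insubd x (val x)^-1 else x.

Lemma localg_mulVx : {in localg_unit, left_inverse 1 localg_inv *%R}.
Proof.
move=> x xu; apply: val_inj; rewrite /localg_inv xu rmorphM rmorph1 /=.
by move: xu => /andP[x0 xV]; rewrite insubdK ?mulVf.
Qed.

Lemma localg_unitPl (x y : localg) : y * x = 1 -> x \in localg_unit.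
Proof.
move/(congr1 val); rewrite rmorphM rmorph1 /= => yx.
have x0 : val x != 0.
  by apply: contra_eq_neq yx => ->; rewrite mulr0 eq_sym oner_neq0.
apply/andP; split=> //.
by rewrite -[_^-1](mul1r) -yx mulfK // localg_valP.
Qed.

Lemma localg_inv_out : {in [predC localg_unit], localg_inv =1 id}.
Proof. by move=> x; rewrite inE /localg_inv => /negPf->. Qed.
HB.instance Definition _ :=
  GRing.ComNzRing_hasMulInverse.Build localg localg_mulVx localg_unitPl localg_inv_out.

Lemma localg_integral (x y : localg) : x * y = 0 -> (x == 0) || (y == 0).
Proof.
move/(congr1 val); rewrite rmorphM /= => /eqP.
by rewrite mulf_eq0 => /orP[]/eqP xy; apply/orP; [left|right]; apply/eqP/val_inj.
Qed.
HB.instance Definition _ := GRing.ComUnitRing_isIntegral.Build localg localg_integral.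

Lemma localg_constP c : iL c \in localg_pred g0.
Proof. by apply/asboolP; exists c%:MP, 0%N; rewrite mmapC expr0 divr1. Qed.
Definition localg_const c : localg := LocAlg (localg_constP c).

Lemma localg_const_is_zmod_morphism : zmod_morphism localg_const.
Proof. by move=> x y; apply: val_inj; rewrite rmorphB /= rmorphB. Qed.
Lemma localg_const_is_monoid_morphism : monoid_morphism localg_const.
Proof. by split=> [|x y]; apply: val_inj; rewrite ?rmorph1 ?rmorphM /= ?rmorph1 ?rmorphM. Qed.
HB.instance Definition _ :=
  GRing.isZmodMorphism.Build _ _ localg_const localg_const_is_zmod_morphism.
HB.instance Definition _ :=
  GRing.isMonoidMorphism.Build _ _ localg_const localg_const_is_monoid_morphism.
End LocalizedAlgebra.

Section RetractMaps.
Variables (k L : fieldType) (iL : {rmorphism k -> L}) (S N : nat).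
Variables (a : 'I_S -> L) (u : 'I_N -> L) (b : 'I_S -> {mpoly k[N]}).
Variable g : {mpoly k[S]}.
Local Notation eva := (mmap iL a).
Local Notation evu := (mmap iL u).
Local Notation evb := (mmap (@mpolyC N k) b).
Hypothesis g0 : eva g != 0.
Hypothesis ub : forall i, evu (b i) = a i.
Hypothesis ab : forall P, eva P = 0 -> evb P = 0.
Hypothesis uA : forall i, u i \in localg_pred g0.
Local Notation A := (localg g0).
Local Notation f := (evb g).

Let evub P : evu (evb P) = eva P.
Proof. by rewrite mmap_comp; apply: mmap_ext. Qed.

Let f0 : f != 0.
Proof. by apply: contraNneq g0 => f0; rewrite -evub f0 rmorph0. Qed.

Let ff0 l : tofrac f ^+ l != 0.
Proof. by rewrite expf_neq0 ?tofrac_eq0. Qed.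

Let gX0 l : eva g ^+ l != 0. Proof. exact: expf_neq0. Qed.

Let phi_spec (x : A) (y : localization f) := forall P l,
  localg_val x = eva P / eva g ^+ l ->
  loc_val y = tofrac (evb P) / tofrac f ^+ l.

(** Two fractions for x give a relation among the [a i], which [ab] transports to the [b i]. *)
Lemma retract_phi_ex x : exists y, phi_spec x y.
Proof.
have /asboolP[P [l xP]] := localg_valP x.
have yP : tofrac (evb P) / tofrac f ^+ l \in loc_pred f.
  by apply/asboolP; exists (evb P), l.
exists (Localization yP) => P' l'; rewrite xP => /eqP.
rewrite eqr_div // -!rmorphXn -!rmorphM -subr_eq0 -rmorphB => /eqP/ab/eqP.
rewrite rmorphB !rmorphM !rmorphXn subr_eq0 => /eqP e /=.
by apply/eqP; rewrite eqr_div // -!tofracXn -!tofracM e.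
Qed.

Definition retract_phi x := projT1 (cid (retract_phi_ex x)).
Let retract_phiP x : phi_spec x (retract_phi x) := projT2 (cid (retract_phi_ex x)).

Lemma retract_phi_is_zmod_morphism : zmod_morphism retract_phi.
Proof.
move=> x y; apply: val_inj.
have /asboolP[P [l xP]] := localg_valP x; have /asboolP[Q [l' yQ]] := localg_valP y.
rewrite rmorphB /= (retract_phiP xP) (retract_phiP yQ) -mulNr addf_div // -exprD.
rewrite (@retract_phiP (x - y) (P * g ^+ l' - Q * g ^+ l) (l + l')%N).
  by rewrite mulNr rmorphB !rmorphM !rmorphXn tofracB !tofracM !tofracXn.
rewrite rmorphB /= xP yQ -mulNr addf_div // exprD.
by rewrite !rmorphM !rmorphXn mulNr.
Qed.

Lemma retract_phi_is_monoid_morphism : monoid_morphism retract_phi.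
Proof.
split=> [|x y]; apply: val_inj.
  by rewrite /= (@retract_phiP 1 1 0%N) ?rmorph1 ?expr0 ?divr1 ?tofrac1.
have /asboolP[P [l xP]] := localg_valP x; have /asboolP[Q [l' yQ]] := localg_valP y.
rewrite rmorphM /= (retract_phiP xP) (retract_phiP yQ) mulf_div -exprD.
rewrite (@retract_phiP (x * y) (P * Q) (l + l')%N).
  by rewrite !rmorphM.
by rewrite rmorphM /= xP yQ mulf_div exprD ?rmorphM.
Qed.
HB.instance Definition _ :=
  GRing.isZmodMorphism.Build _ _ retract_phi retract_phi_is_zmod_morphism.
HB.instance Definition _ :=
  GRing.isMonoidMorphism.Build _ _ retract_phi retract_phi_is_monoid_morphism.

Let evuA p l : evu p / eva g ^+ l \in localg_pred g0.
Proof.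
rewrite rpredM //; last first.
  by apply/asboolP; exists 1, l; rewrite rmorph1 div1r.
rewrite /mmap rpred_sum // => m _; rewrite rpredM ?localg_constP //.
by rewrite /mmap1 rpred_prod // => i _; rewrite rpredX.
Qed.

Let psi_spec (y : localization f) (x : A) := forall p l,
  loc_val y = tofrac p / tofrac f ^+ l -> localg_val x = evu p / eva g ^+ l.

(** Specialisation at u sends f to g(a), which is invertible in A. *)
Lemma retract_psi_ex y : exists x, psi_spec y x.
Proof.
have /asboolP[p [l yp]] := loc_valP y.
exists (LocAlg (evuA p l)) => p' l'; rewrite yp => /eqP.
rewrite eqr_div // -!tofracXn -!tofracM tofrac_eq => /eqP/(congr1 evu).
rewrite !rmorphM !rmorphXn /= evub => e /=.
by apply/eqP; rewrite eqr_div // e.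
Qed.

Definition retract_psi y := projT1 (cid (retract_psi_ex y)).
Let retract_psiP y : psi_spec y (retract_psi y) := projT2 (cid (retract_psi_ex y)).

Lemma retract_psi_is_zmod_morphism : zmod_morphism retract_psi.
Proof.
move=> x y; apply: val_inj.
have /asboolP[P [l xP]] := loc_valP x; have /asboolP[Q [l' yQ]] := loc_valP y.
rewrite rmorphB /= (retract_psiP xP) (retract_psiP yQ) -mulNr addf_div // -exprD.
rewrite (@retract_psiP (x - y) (P * f ^+ l' - Q * f ^+ l) (l + l')%N).
  by rewrite mulNr rmorphB !rmorphM !rmorphXn /= evub.
rewrite rmorphB /= xP yQ -mulNr addf_div // exprD.
by rewrite ?tofracB !tofracM !tofracXn mulNr.
Qed.

Lemma retract_psi_is_monoid_morphism : monoid_morphism retract_psi.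
Proof.
split=> [|x y]; apply: val_inj.
  by rewrite /= (@retract_psiP 1 1 0%N) ?rmorph1 ?expr0 ?divr1 ?tofrac1.
have /asboolP[P [l xP]] := loc_valP x; have /asboolP[Q [l' yQ]] := loc_valP y.
rewrite rmorphM /= (retract_psiP xP) (retract_psiP yQ) mulf_div -exprD.
rewrite (@retract_psiP (x * y) (P * Q) (l + l')%N).
  by rewrite !rmorphM.
by rewrite rmorphM /= xP yQ mulf_div exprD ?tofracM.
Qed.
HB.instance Definition _ :=
  GRing.isZmodMorphism.Build _ _ retract_psi retract_psi_is_zmod_morphism.
HB.instance Definition _ :=
  GRing.isMonoidMorphism.Build _ _ retract_psi retract_psi_is_monoid_morphism.

Let a_in i : a i \in localg_pred g0.
Proof. by apply/asboolP; exists 'X_i, 0%N; rewrite mmapX mmap1U expr0 divr1. Qed.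

Let ginv_in : (eva g)^-1 \in localg_pred g0.
Proof. by apply/asboolP; exists 1, 1%N; rewrite rmorph1 expr1 div1r. Qed.

Lemma retract_maps : (forall x, exists P Q, eva Q != 0 /\ x = eva P / eva Q) ->
  retract_rational iL.
Proof.
move=> gen.
exists A, (localg_const g0), (\val : {rmorphism A -> L}), N, f, retract_phi, retract_psi.
split=> //.
(* The algebra is generated by 1/g(a), placed at [ord0], and the [a i]. *)
- pose h : 'I_S.+1 -> A := fun i =>
    if unlift ord0 i is Some j then LocAlg (a_in j) else LocAlg ginv_in.
  exists S.+1, h => x; have /asboolP[P [l xP]] := localg_valP x.
  exists (mmap (@mpolyC S.+1 k) (fun j => 'X_(lift ord0 j)) P * 'X_ord0 ^+ l).
  apply: val_inj.
  rewrite (@mmap_morph _ _ _ _ _ (\val : {rmorphism A -> L}) iL) //.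
  rewrite rmorphM rmorphXn /= mmap_comp xP mmapX mmap1U {2}/h unlift_none /=.
  rewrite exprVn; congr (_ / _); apply: mmap_ext => // j.
  by rewrite mmapX mmap1U /h liftK.
- split=> //; split; first exact: val_inj.
  move=> x; have [P [Q [Q0 ->]]] := gen x.
  have inA P' : eva P' \in localg_pred g0.
    by apply/asboolP; exists P', 0%N; rewrite expr0 divr1.
  exists (LocAlg (inA P)), (LocAlg (inA Q)); split=> //.
- split=> c.
    by apply: val_inj; rewrite /= (@retract_phiP _ c%:MP 0%N) /= ?mmapC ?expr0 ?divr1.
  by apply: val_inj; rewrite /= (@retract_psiP _ c%:MP 0%N) /= ?mmapC ?expr0 ?divr1.
move=> x; apply: val_inj; have /asboolP[P [l xP]] := localg_valP x.
by rewrite /= (retract_psiP (retract_phiP xP)) evub.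
Qed.
End RetractMaps.

(** A common denominator g(a) of the [u i] is inverted, so that specialisation at u lands in the
    algebra generated by the [a i]. *)
Lemma retract_criterion (k L : fieldType) (iL : {rmorphism k -> L}) (S N : nat)
    (a : 'I_S -> L) (u : 'I_N -> L) (b : 'I_S -> {mpoly k[N]}) :
  (forall x, exists P Q, mmap iL a Q != 0 /\ x = mmap iL a P / mmap iL a Q) ->
  (forall i, mmap iL u (b i) = a i) ->
  (forall P, mmap iL a P = 0 -> mmap (@mpolyC N k) b P = 0) ->
  retract_rational iL.
Proof.
move=> gen ub ab.
have /fin_all_exists[P PP] i : exists P, exists Q,
    mmap iL a Q != 0 /\ u i = mmap iL a P / mmap iL a Q by apply: gen.
have /fin_all_exists[Q PQ] := PP.
pose g := \prod_i Q i.
have gE : mmap iL a g = \prod_i mmap iL a (Q i) by rewrite rmorph_prod.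
have g0 : mmap iL a g != 0.
  by rewrite gE; apply/prodf_neq0 => i _; have [] := PQ i.
apply: (retract_maps (g0 := g0) (u := u)) => // i.
apply/asboolP; exists (P i * \prod_(j | j != i) Q j), 1%N.
have [Qi ->] := PQ i.
rewrite rmorphM rmorph_prod expr1 gE [X in _ = _ / X](bigD1 i) //= -mulf_div divff ?mulr1 //.
by apply/prodf_neq0 => j _; have [] := PQ j.
Qed.

(** * The generic lift of an invariant *)

Section GenericLift.
Variables (k : fieldType) (n : nat) (gT : finGroupType) (G : {group gT}).
Variable M : gT -> 'M[k]_n.
Variables (F : fieldType) (cF : {rmorphism k -> F}) (act : gT -> {rmorphism F -> F}).
Variable x : 'I_n -> F.
Hypothesis MM : {in G &, forall g g', M (g * g')%g = M g' *m M g}.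
Hypothesis M1 : M 1%g = 1%:M.
Hypothesis act_cF : forall g c, g \in G -> act g (cF c) = cF c.
Hypothesis act_x : forall g i, g \in G -> act g (x i) = \sum_j cF (M g i j) * x j.
Hypothesis G_unit : #|G|%:R != 0 :> k.

Variables (J D : finType) (sJ : J -> J) (e r n1 : nat) (om ze : k) (tau : gT).
Hypotheses (r_gt0 : (0 < r)%N) (n1_gt0 : (0 < n1)%N) (e_gt0 : (0 < e)%N).
Hypothesis sJr : forall j, iter r sJ j = j.
Hypothesis om_prim : e.-primitive_root om.
Hypothesis ze_prim : (n1 * r).-primitive_root ze.
Hypothesis tauG : tau \in G.

Variables (h : J -> D -> nat) (dJ : gT -> D -> D) (l : D -> 'I_r -> nat).
Variables (kp : gT -> D -> 'I_r -> k) (X : D -> 'I_r -> F) (a : J -> F) (Y : F).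
(* Scaling one root al_j by om is the action of some y in H on every weight. *)
Hypothesis dJ_scale : forall j, exists2 y, y \in G & forall g chi i, g \in G ->
  dJ (y * g)%g chi = dJ g chi /\ kp (y * g)%g chi i = om ^+ h j (dJ g chi) * kp g chi i.
Hypothesis dJ_tau : forall g chi, g \in G -> dJ (tau * g)%g chi = dJ tau (dJ g chi).
Hypothesis kp_tau : forall g chi i, g \in G ->
  kp (tau * g)%g chi i = ze ^+ l chi i * kp g chi i.
Hypothesis h_tau : forall j psi, h (sJ j) (dJ tau psi) = h j psi.
Hypothesis l_dJ : forall g chi i, g \in G -> l (dJ g chi) i = l chi i.
Hypothesis act_X : forall g chi i, g \in G ->
  act g (X chi i) = cF (kp g chi i) * X (dJ g chi) i.

Variable c : 'I_n -> D -> 'I_r -> F.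
Hypothesis c_fixed : forall i' chi i g, g \in G -> act g (c i' chi i) = c i' chi i.
Hypothesis x_decomp : forall i', x i' = \sum_chi \sum_i c i' chi i * X chi i.

Variable kc : J -> 'I_r -> F.
Hypothesis kc_sum : forall j, a j = \sum_i kc j i * Y ^+ i.
Hypothesis kc_tau : forall j i, kc (sJ j) i = cF (ze ^+ (n1 * i)) * kc j i.

Variables (F2 : fieldType) (f : {rmorphism F -> F2}) (Z : F2) (al : J -> F2).
Hypothesis ZY : Z ^+ n1 = f Y.
Hypothesis al_a : forall j, al j ^+ e = f (a j).
Hypothesis al_X : forall chi i, Z ^+ l chi i * \prod_j al j ^+ h j chi = f (X chi i).

Definition coef_vars := ('I_n * D * 'I_r)%type.
Local Notation RV := (root_vars J coef_vars).
Local Notation BV := (base_vars J coef_vars r).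
Local Notation R1 := {mpoly k[#|{: RV}|]}.
Local Notation v1 := (@fvar k RV).

(** The image under g of a term c X of the decomposition of a coordinate, with c, Z and the al_j
    replaced by variables. *)
Definition generic_term (g : gT) (t : coef_vars) : R1 :=
  let: (i', chi, i) := t in
  kp g chi i *: (v1 (inr (Some t)) * v1 (inr None) ^+ l chi i *
                 \prod_j v1 (inl j) ^+ h j (dJ g chi)).

(** The generic form of averaging M(g^-1) g(x) over g, each summand being x itself: a substitution
    that translates the index g then acts linearly, as an element of G. *)
Definition generic_coord (i : 'I_n) : R1 :=
  \sum_(g in G) \sum_(t : coef_vars) M g^-1%g i t.1.1 *: generic_term g t.

(** The factors 1/r and 1/#|G| normalise the sums in [generic_orbit] and [generic_coord]. *)
Definition base_point (v : BV) : F :=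
  match v with
  | inl (j, i) => cF (r%:R^-1) * kc j i
  | inr None => Y ^+ r
  | inr (Some t) => cF (#|G|%:R^-1) * c t.1.1 t.1.2 t.2
  end.

Definition coord_action (g : gT) : {mpoly k[n]} -> {mpoly k[n]} :=
  mmap (@mpolyC n k) (fun i => \sum_j M g i j *: 'X_j).

(** The sum is reindexed by y g; M reverses products, so M(g^-1) = M(y) M((y g)^-1). *)
Lemma generic_coord_act (sub : RV -> R1) y : y \in G ->
  (forall g t, g \in G ->
     feval (@mpolyC _ k) sub (generic_term g t) = generic_term (y * g)%g t) ->
  forall i, feval (@mpolyC _ k) sub (generic_coord i) =
    \sum_j M y i j *: generic_coord j.
Proof.
move=> Gy sub_term i; rewrite /generic_coord rmorph_sum /=.
under [RHS]eq_bigr do rewrite scaler_sumr.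
rewrite [RHS]exchange_big /= [RHS](reindex_inj (mulgI y)) /=.
apply: eq_big => g; first by rewrite groupMl.
move=> Gg; rewrite rmorph_sum /=; under [RHS]eq_bigr do rewrite scaler_sumr.
rewrite exchange_big /=; apply: eq_bigr => t _.
rewrite fevalZ mul_mpolyC sub_term //.
under eq_bigr do rewrite scalerA.
rewrite -scaler_suml; congr (_ *: _).
have -> : M g^-1%g = M y *m M (y * g)^-1%g.
  by rewrite -MM ?groupV ?groupM // invMg mulgKV.
by rewrite mxE.
Qed.

Lemma generic_coord_scale j : exists2 y, y \in G & forall i,
  feval (@mpolyC _ k) (root_scale om j) (generic_coord i) =
  \sum_j' M y i j' *: generic_coord j'.
Proof.
have [y Gy yP] := dJ_scale j; exists y => //; apply: generic_coord_act => //.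
move=> g [[i' chi] i] Gg; have [dE kE] := yP g chi i Gg.
rewrite /generic_term dE kE fevalZ mul_mpolyC [om ^+ _ * _]mulrC -scalerA; congr (_ *: _).
rewrite !rmorphM rmorphXn /= !feval_var /root_scale /= scalerAr; congr (_ * _).
rewrite rmorph_prod (bigD1 j) //= [in RHS](bigD1 j) //= scalerAl; congr (_ * _).
  by rewrite rmorphXn /= feval_var eqxx exprZn.
by apply: eq_bigr => j' ne; rewrite rmorphXn /= feval_var (inj_eq inl_inj) (negPf ne).
Qed.

Lemma generic_coord_rotate i :
  feval (@mpolyC _ k) (root_rotate sJ ze) (generic_coord i) =
  \sum_j M tau i j *: generic_coord j.
Proof.
apply: generic_coord_act => // g [[i' chi] ii] Gg.
rewrite /generic_term dJ_tau // kp_tau // fevalZ mul_mpolyC [ze ^+ _ * _]mulrC -scalerA.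
congr (_ *: _); rewrite !rmorphM !rmorphXn /= !feval_var /= exprZn.
rewrite -scalerAr -scalerAl; congr (_ *: (_ * _)).
have sJ_inj : injective sJ by apply: (iter_id_inj r_gt0 sJr).
rewrite rmorph_prod [RHS](reindex_inj sJ_inj) /=.
by apply: eq_bigr => j _; rewrite rmorphXn /= feval_var h_tau.
Qed.

Lemma invariant_generic p : (forall g, g \in G -> coord_action g p = p) ->
  forall (sub : RV -> R1) y, y \in G ->
  (forall i, feval (@mpolyC _ k) sub (generic_coord i) =
     \sum_j M y i j *: generic_coord j) ->
  feval (@mpolyC _ k) sub (mmap (@mpolyC _ k) generic_coord p) =
  mmap (@mpolyC _ k) generic_coord p.
Proof.
move=> p_inv sub y Gy subE; rewrite -{2}(p_inv y Gy) /coord_action mmap_comp.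
rewrite (@mmap_morph _ _ _ _ _ (feval (@mpolyC _ k) sub) (@mpolyC _ k)).
  apply: mmap_ext => // i; rewrite /= subE raddf_sum /=.
  by apply: eq_bigr => j _; rewrite mmapZ mmapX mmap1U mul_mpolyC.
by move=> b; apply/esym/fevalC.
Qed.

Definition root_point (v : RV) : F2 :=
  match v with
  | inl j => al j | inr None => Z | inr (Some t) => f (base_point (inr (Some t)))
  end.

(** The variable [inr None] goes to Z instead of Y^r: this point evaluates the images of
    [base_subst] and [base_powers]. *)
Definition kummer_point (v : BV) : F2 :=
  match v with inr None => Z | v => f (base_point v) end.

(** The terms for g evaluate to g(c X)/#|G|, and M(g^-1) undoes the action of g, so each g
    contributes x_i/#|G|. *)
Lemma eval_generic_coord i :
  feval (f \o cF) root_point (generic_coord i) = f (x i).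
Proof.
have term_eval g t : g \in G -> feval (f \o cF) root_point (generic_term g t) =
    f (cF #|G|%:R^-1 * act g (c t.1.1 t.1.2 t.2 * X t.1.2 t.2)).
  case: t => -[i' chi] ii Gg /=; rewrite [act g _]rmorphM c_fixed // act_X //.
  rewrite fevalZ !rmorphM rmorphXn /= !feval_var /= -(l_dJ _ _ Gg).
  rewrite rmorph_prod /=; under eq_bigr do rewrite rmorphXn /= feval_var /=.
  rewrite -mulrA al_X !rmorphM /= -!mulrA mulrCA.
  by congr (_ * _); rewrite mulrCA.
rewrite /generic_coord rmorph_sum /=.
under eq_bigr => g Gg do (rewrite rmorph_sum /=;
  under eq_bigr => t _ do rewrite fevalZ term_eval //).
have sum_t g : g \in G -> \sum_(t : coef_vars)
    cF (M g^-1%g i t.1.1) * act g (c t.1.1 t.1.2 t.2 * X t.1.2 t.2) = x i.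
  move=> Gg.
  transitivity (\sum_i' cF (M g^-1%g i i') * act g (x i')).
    under [RHS]eq_bigr => i' _ do rewrite x_decomp rmorph_sum mulr_sumr.
    rewrite pair_big /=.
    under [RHS]eq_bigr => p _ do rewrite rmorph_sum mulr_sumr.
    by rewrite pair_big.
  under eq_bigr => i' _ do rewrite act_x // mulr_sumr.
  rewrite exchange_big /=.
  under eq_bigr => j _ do (under eq_bigr => i' _ do rewrite mulrA -rmorphM).
  under eq_bigr => j _ do rewrite -mulr_suml -rmorph_sum.
  have MgV : M g^-1%g *m M g = 1%:M by rewrite -MM ?groupV // mulgV M1.
  rewrite (bigD1 i) //= [X in _ + X]big1 ?addr0 => [|j ne_j].
    by move/matrixP/(_ i i): MgV; rewrite !mxE eqxx => ->; rewrite rmorph1 mul1r.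
  move/matrixP/(_ i j): MgV; rewrite !mxE eq_sym (negPf ne_j) => ->.
  by rewrite rmorph0 mul0r.
transitivity (\sum_(g in G) f (cF #|G|%:R^-1 * x i)).
  apply: eq_bigr => g Gg; rewrite -[in RHS](sum_t g Gg) mulr_sumr rmorph_sum /=.
  by apply: eq_bigr => t _; rewrite !rmorphM /= mulrCA.
rewrite sumr_const -[LHS]mulr_natl rmorphM mulrA -(rmorph_nat f) -(rmorph_nat cF).
by rewrite -!rmorphM mulfV // !rmorph1 mul1r.
Qed.

(** Moving j by g rotations multiplies the i-th component by ze^(n1 i g), which cancels the
    coefficient; each g contributes a_j/r. *)
Lemma eval_generic_orbit j :
  feval (f \o cF) kummer_point (@generic_orbit k J coef_vars sJ r n1 ze j) = f (a j).
Proof.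
have ze0 : ze != 0.
  by rewrite (prim_root_eq0 ze_prim) -lt0n muln_gt0 n1_gt0.
have kcX g i : kc (iter g sJ j) i = cF (ze ^+ (n1 * i * g)) * kc j i.
  elim: g => [|g IHg]; first by rewrite muln0 expr0 rmorph1 mul1r.
  by rewrite iterS kc_tau IHg mulrA -rmorphM -exprD mulnS.
rewrite /generic_orbit rmorph_sum /=.
transitivity (\sum_(g < r) f (cF r%:R^-1 * a j)).
  apply: eq_bigr => g _; rewrite rmorph_sum kc_sum mulr_sumr rmorph_sum /=.
  apply: eq_bigr => i _.
  rewrite fevalZ [feval _ _ _]rmorphM /= [feval _ _ (_ ^+ _)]rmorphXn /=.
  rewrite !feval_var /= kcX.
  rewrite (exprM Z n1) ZY -rmorphXn -!rmorphM /=; congr (f _).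
  rewrite -!mulrA mulrCA; congr (_ * _).
  rewrite [LHS]mulrA -[RHS]mul1r; congr (_ * _).
  transitivity (cF (ze^-1 ^+ (n1 * i * g) * ze ^+ (n1 * i * g))).
    exact/esym/rmorphM.
  by rewrite -exprMn mulVf // expr1n rmorph1.
have r_unit : r%:R != 0 :> k.
  by rewrite (prim_root_dvd_eq0 ze_prim) // dvdn_mull.
rewrite sumr_const card_ord -[LHS]mulr_natl rmorphM mulrA -(rmorph_nat f).
by rewrite -(rmorph_nat cF) -!rmorphM mulfV // !rmorph1 mul1r.
Qed.

(** The value of b is computed in F2, where Z and the al_j exist, and pulled back along the
    injective f. The lift of p takes the value p(x) at [root_point]; so does q at the al_j^e =
    f(a_j), which are also the values of the generic orbits at [kummer_point]. *)
Lemma generic_lift p : (forall g, g \in G -> coord_action g p = p) ->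
  exists (q : R1) (b : {mpoly k[#|{: BV}|]}),
    [/\ feval (@mpolyC _ k) (@kummer_powers k J coef_vars e) q =
          mmap (@mpolyC _ k) generic_coord p,
        feval (@mpolyC _ k) (@base_powers k J coef_vars r n1) b =
          feval (@mpolyC _ k) (@base_subst k J coef_vars sJ r n1 ze) q
      & feval cF base_point b = mmap cF x p].
Proof.
move=> p_inv.
have [||q [b [qE bE]]] := @invariant_descent k J coef_vars sJ e r n1 om ze
    r_gt0 n1_gt0 e_gt0 sJr om_prim ze_prim (mmap (@mpolyC _ k) generic_coord p).
- by move=> j; have [y Gy yE] := generic_coord_scale j; apply: (invariant_generic p_inv Gy yE).
- exact: (invariant_generic p_inv tauG generic_coord_rotate).
exists q, b; split=> //; apply: (fmorph_inj f).
rewrite [RHS](@mmap_morph _ _ _ _ _ f (f \o cF)) //.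
transitivity (feval (f \o cF) root_point (mmap (@mpolyC _ k) generic_coord p)).
  rewrite -qE feval_comp; transitivity (feval (f \o cF) kummer_point
    (feval (@mpolyC _ k) (@base_powers k J coef_vars r n1) b)).
    rewrite feval_comp /feval (@mmap_morph _ _ _ _ _ f (f \o cF)) //.
    apply: mmap_ext => // v /=; rewrite -[RHS]/(feval (f \o cF) kummer_point _).
    case: (enum_val v) => [w|[t|]].
    - by rewrite /= feval_var.
    - by rewrite /= feval_var.
    by rewrite /= [feval _ _ _]rmorphXn /= feval_var /= exprM ZY rmorphXn.
  rewrite bE feval_comp; apply: feval_ext => -[j|[t|]] /=.
  - by rewrite eval_generic_orbit rmorphXn /= feval_var al_a.
  - by rewrite !feval_var.
  - by rewrite !feval_var.
rewrite (@mmap_morph _ _ _ _ _ (feval (f \o cF) root_point) (f \o cF)).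
  by apply: mmap_ext => // i /=; apply: eval_generic_coord.
by move=> d; apply/esym/fevalC.
Qed.

End GenericLift.

(** * Construction of the lifting data *)

Section DescentData.
Variables (k : fieldType) (n : nat) (gT : finGroupType) (G H : {group gT}) (tau : gT).
Variables (e0 : nat) (om ze : k).
Local Notation e := e0.+1.
Local Notation m := #[tau]%g.
Local Notation D := (chr H e0).
Hypotheses (nHG : (H <| G)%g) (abH : abelian H) (tauG : tau \in G).
Hypothesis genG : forall g, g \in G -> exists a, exists2 h, h \in H & g = (tau ^+ a * h)%g.
Hypothesis eH : (exponent H %| e)%N.
Hypothesis om_prim : e.-primitive_root om.
Hypothesis ze_prim : m.-primitive_root ze.
Hypothesis G_unit : #|G|%:R != 0 :> k.

Variables (F : fieldType) (cF : {rmorphism k -> F}) (act : gT -> {rmorphism F -> F}).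
Hypothesis actM : {in G &, forall g g' x, act (g * g')%g x = act g (act g' x)}.
Hypothesis act_cF : forall g c, g \in G -> act g (cF c) = cF c.
Hypothesis act_inj : {in G, forall g, (forall x, act g x = x) -> g = 1%g}.

Variables (M : gT -> 'M[k]_n) (x : 'I_n -> F).
Hypothesis MM : {in G &, forall g g', M (g * g')%g = M g' *m M g}.
Hypothesis M1 : M 1%g = 1%:M.
Hypothesis act_x : forall g i, g \in G -> act g (x i) = \sum_j cF (M g i j) * x j.

Local Notation r := (tau_index H tau).
Local Notation n1 := (tau_coindex H tau).
Let nG : {in G, forall g, g \in 'N(H)%g}.
Proof. by move=> g Gg; apply: (subsetP (normal_norm nHG)). Qed.
Let HG : {in H, forall h, h \in G}.
Proof. by move=> h; apply: (subsetP (normal_sub nHG)). Qed.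

Let s : {additive D -> D} := HB.pack_for {additive D -> D} (chrJ tau)
  (GRing.isZmodMorphism.Build _ _ _ (chrJ_is_zmod_morphism (nG tauG))).

Let iter_s a chi : iter a s chi = chrJ (tau ^+ a)%g chi.
Proof.
elim: a => [|a IHa]; first by rewrite expg0 chrJ1.
by rewrite iterS IHa expgS chrJM ?nG ?groupX.
Qed.

Let iter_s_r chi : iter r s chi = chi.
Proof. by rewrite iter_s chrJ_abelian // (tau_expH nHG tauG) dvdnn. Qed.

Let chrJ_iter g : g \in G -> exists a, chrJ g =1 iter a s.
Proof.
move=> Gg; have [a [h Hh ->]] := genG Gg; exists a => chi.
rewrite iter_s chrJM; first by rewrite [chrJ h chi]chrJ_abelian.
  exact/nG/groupX.
exact/nG/HG.
Qed.

(** Injectivity of [pw1] and [pw2] is what later carries relations among invariants over to the q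
    and then to the b. *)
Lemma descent_data : exists (I1 I2 : finType) (xt : 'I_n -> {mpoly k[#|I1|]})
    (pw1 : I1 -> {mpoly k[#|I1|]}) (sub : I1 -> {mpoly k[#|I2|]})
    (pw2 : I2 -> {mpoly k[#|I2|]}) (pt : I2 -> F),
  [/\ injective (feval (@mpolyC _ k) pw1), injective (feval (@mpolyC _ k) pw2),
      forall v g, g \in G -> act g (pt v) = pt v
    & forall p, (forall g, g \in G -> coord_action M g p = p) ->
      exists q b, [/\ feval (@mpolyC _ k) pw1 q = mmap (@mpolyC _ k) xt p,
        feval (@mpolyC _ k) pw2 b = feval (@mpolyC _ k) sub q
      & feval cF pt b = mmap cF x p]].
Proof.
have [J [sJ [h [iota [u [sJr hs iotas iota0 [hD uD us hiu]]]]]]] :=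
  perm_pairing_data (tau_index_gt0 H tau) (ltn0Sn e0) (@chr_mulrn gT H e0) iter_s_r.
have cj := compat_jexp nHG tauG om_prim ze_prim.
have jJ g chi := fun Gg => @jexp_chrJ _ _ _ _ _ e0 om ze nHG abH tauG genG g chi Gg.
have [w0 [w0_neq0 w0J]] := twisted_family nHG abH tauG genG om_prim ze_prim
  actM act_cF act_inj (fun chi => cj chi) (fun g chi Gg => congr1 Posz (jJ g chi Gg)).
have [Y Y_neq0 YJ] := exists_kummer_generator nHG abH tauG genG om_prim ze_prim
  actM act_cF act_inj.
have n1_gt0 : (0 < n1)%N by apply: (tau_coindex_gt0 nHG tauG).
have ze_prim' : (n1 * r).-primitive_root ze by rewrite (tau_coindexK nHG tauG).
pose tm := twisted_monomial tau om ze w0 Y.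
pose a j := tm 0 (iota j).
pose l (chi : D) (i : 'I_r) : nat := (jexp tau om ze chi + n1 * i)%N.
pose X chi i := tm (l chi i)%:Z (u chi).
pose kp g chi i := kap tau om ze (l chi i)%:Z chi g.
have c0 v := compat0 e0 om nHG tauG ze_prim v.
have l_compat chi i : compat tau om ze (l chi i)%:Z chi.
  have := compatD om_prim ze_prim (cj chi) (_ : compat tau om ze (n1%:Z * (i : nat)%:Z) 0).
  by rewrite addr0 PoszD PoszM; apply; rewrite c0 dvdz_mulr.
have act_a g v' j : g \in G -> (forall psi, v' (chrJ g psi) = iota j psi) ->
    act g (a j) = tm 0 v'.
  move=> Gg v'J; rewrite /a /tm.
  rewrite (act_twisted_monomial nHG abH tauG genG om_prim ze_prim w0J YJ Gg _ v'J).
    by rewrite iota0 kap0 rmorph1 mul1r.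
  by rewrite iota0 c0 dvdz0.
have a_H j : {in H, forall y, act y (a j) = a j}.
  by move=> y Hy; apply: act_a => [|psi]; [apply: HG | rewrite chrJ_abelian].
have a_tau j : act tau (a j) = a (sJ j).
  by apply: act_a => // psi; apply: iotas.
have uJ g chi psi : g \in G -> u (chrJ g chi) (chrJ g psi) = u chi psi.
  case/chrJ_iter=> b bE; rewrite !bE.
  by elim: b {bE} => //= b IHb; rewrite us.
have l_dJ g chi i : g \in G -> l (chrJ g chi) i = l chi i.
  by move=> Gg; rewrite /l jJ.
have act_X g chi i : g \in G ->
    act g (X chi i) = cF (kp g chi i) * X (chrJ g chi) i.
  move=> Gg; rewrite /X l_dJ // /tm.
  rewrite (act_twisted_monomial nHG abH tauG genG om_prim ze_prim w0J YJ Gg _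
            (fun psi => uJ g chi psi Gg)); first by rewrite uD.
  by rewrite uD.
have dJ_scale j : exists2 y, y \in G & forall g chi i, g \in G ->
    chrJ (y * g)%g chi = chrJ g chi /\
    kp (y * g)%g chi i = om ^+ h j (chrJ g chi) * kp g chi i.
  (* Modulo e, h_j is a homomorphism from D to Z/e, hence evaluation at an element of H. *)
  have hM : {morph (fun chi : D => inZp (h j chi) : 'I_e) : f g / f + g}.
    by move=> f g; apply: val_inj; rewrite /= hD modnDm.
  have [y Hy yE] := chr_dual_eval abH eH hM.
  exists y; first exact: HG.
  move=> g chi i Gg.
  split; first by rewrite chrJM ?nG ?(HG Hy) // chrJ_abelian.
  rewrite /kp (kapM nHG abH tauG genG om_prim ze_prim) ?l_compat ?(HG Hy) //.
  rewrite (kap_H nHG tauG om_prim ze_prim) ?(compat_chrJ om ze nHG abH tauG genG) //.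
  by rewrite -yE /= (prim_expr_mod om_prim).
have dJ_tau g (chi : D) : g \in G -> chrJ (tau * g)%g chi = chrJ tau (chrJ g chi).
  by move=> Gg; rewrite chrJM ?nG.
have kp_tau g0 chi i : g0 \in G -> kp (tau * g0)%g chi i = ze ^+ l chi i * kp g0 chi i.
  move=> Gg; rewrite /kp (kapM nHG abH tauG genG om_prim ze_prim) //.
  by rewrite (kap_tau nHG tauG om_prim ze_prim) ?(compat_chrJ om ze nHG abH tauG genG).
have h_tau j psi : h (sJ j) (chrJ tau psi) = h j psi by apply: hs.
have /fin_all_exists[cx cxP] (i' : 'I_n) : exists c : D -> 'I_r -> F,
    (forall chi i, fixedG G act (c chi i)) /\
    x i' = \sum_chi \sum_i c chi i * X chi i.
  have [c cG cE] := twisted_decomposition nHG abH tauG genG om_prim ze_prim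
    actM act_cF w0_neq0 w0J Y_neq0 YJ eH uD (x i').
  by exists c.
have [F1 [f1 [Z ZY]]] := exists_root_extension Y n1_gt0.
(* The nu psi are e-th roots of w_psi Z^(-jexp psi); their products with exponents [iota j] will be
   the al_j. *)
have [F3 [f2 [nu nuE]]] := exists_roots_extension
  (fun psi => f1 (w0 psi) * Z ^ (- (jexp tau om ze psi)%:Z)) (ltn0Sn e0).
have nu_neq0 psi : nu psi != 0.
  have Z0 : Z != 0.
    apply: contraNneq Y_neq0 => Z0.
    by rewrite -(fmorph_eq0 f1) -ZY Z0 expr0n gtn_eqF.
  have : nu psi ^+ e != 0.
    by rewrite nuE fmorph_eq0 mulf_neq0 ?expfz_neq0 ?fmorph_eq0.
  by rewrite expf_eq0.
pose f : {rmorphism F -> F3} := f2 \o f1.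
pose al j := \prod_psi nu psi ^ iota j psi.
have f_tm v chi : compat tau om ze v chi -> forall w, divisor_degree w = chi ->
    f (tm v w) = f2 Z ^ v * \prod_psi nu psi ^ (e%:Z * w psi).
  move=> cv w wE; rewrite /f /= /tm.
  rewrite (twisted_monomial_extension nHG tauG om_prim ze_prim w0 Y_neq0 ZY) ?wE //.
  rewrite rmorphM fmorphXz rmorph_prod; congr (_ * _); apply: eq_bigr => psi _.
  by rewrite fmorphXz -nuE -exprz_exp.
have al_a j : al j ^+ e = f (a j).
  rewrite /a (@f_tm 0 0) ?c0 ?dvdz0 ?iota0 // expr0z mul1r.
  rewrite /al -prodrXl; apply: eq_bigr => psi _.
  by rewrite exprnP exprz_exp mulrC.
(* The pairing identity, sum over j of h_j iota_j equal to e u, matches the exponents of each nu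
   psi. *)
have al_X chi i : f2 Z ^+ l chi i * \prod_j al j ^+ h j chi = f (X chi i).
  rewrite /X (f_tm _ chi) ?uD //; congr (_ * _).
  rewrite /al; under eq_bigr do rewrite -prodrXl.
  rewrite exchange_big /=; apply: eq_bigr => psi _.
  rewrite -hiu; under eq_bigr => j _ do rewrite exprnP exprz_exp.
  rewrite -(big_morph (fun b : int => nu psi ^ b)
    (fun b b' => expfzDr b b' (nu_neq0 psi)) (expr0z _)).
  by congr (_ ^ _); apply: eq_bigr => j _; apply: mulrC.
pose kc j (i : 'I_r) := kcomp H tau ze cF act Y i (a j).

pose IC := coef_vars n D r.
exists (root_vars J IC), (base_vars J IC r).
exists (generic_coord G M h (@chrJ gT H e0) l kp).
exists (@kummer_powers k J IC e), (@base_subst k J IC sJ r n1 ze).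
exists (@base_powers k J IC r n1), (base_point G cF Y cx kc).
split; [exact: kummer_powers_inj | exact: (base_powers_inj (tau_index_gt0 H tau) n1_gt0) | |].
  move=> v g Gg; rewrite /base_point; case: v => [[j i]|[t|]] /=.
  - rewrite rmorphM act_cF // /kc.
    by rewrite (kcomp_fixed nHG tauG genG om_prim ze_prim actM act_cF YJ i (@a_H j) Gg).
  - by rewrite rmorphM act_cF // (cxP _).1.
  (* Y^r has weight (n1 r, 0), and n1 r is the order of ze, so the cocycle is trivial. *)
  rewrite rmorphXn /= YJ // exprMn.
  rewrite -rmorphXn [X in cF X](_ : _ = 1) ?rmorph1 ?mul1r //.
  rewrite exprnP -(kapMz om_prim ze_prim).
  have -> : (0 : D) *~ r%:Z = 0 by apply: mul0rz.
  have [b [y Hy ->]] := genG Gg.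
  rewrite (kapE nHG tauG om_prim ze_prim) // ?c0 ?dvdz_mulr //.
  rewrite ffunE expr0 mulr1; apply/eqP; rewrite (ze_exprz_eq1 ze_prim).
  by rewrite -PoszM (tau_coindexK nHG tauG) dvdz_mulr.
have kc_sum j : a j = \sum_i kc j i * Y ^+ i.
  by rewrite (kcomp_sum nHG tauG ze_prim cF actM Y_neq0).
have kc_tau j i : kc (sJ j) i = cF (ze ^+ (n1 * i)) * kc j i.
  by rewrite /kc -a_tau; apply: (kcomp_tau nHG tauG ze_prim actM act_cF Y i (@a_H j)).
have ZY2 : f2 Z ^+ n1 = f Y by rewrite -rmorphXn ZY.
move=> p p_inv.
have := generic_lift MM M1 act_x G_unit (tau_index_gt0 H tau) n1_gt0 (ltn0Sn e0)
  sJr om_prim ze_prim' tauG dJ_scale dJ_tau kp_tau h_tau l_dJ act_X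
  (fun i' => (cxP i').1) (fun i' => (cxP i').2) kc_sum kc_tau ZY2 al_a al_X p_inv.
exact.
Qed.
End DescentData.

(** * Faithful actions, and reduction to them *)

Section FaithfulAction.
Variables (k : fieldType) (n : nat) (gT : finGroupType) (G H : {group gT}) (tau : gT).
Variables (e0 : nat) (om ze : k).
Local Notation e := e0.+1.
Local Notation m := #[tau]%g.
Local Notation P := {mpoly k[n]}.
Local Notation F := {fraction {mpoly k[n]}}.
Hypotheses (nHG : (H <| G)%g) (abH : abelian H) (tauG : tau \in G).
Hypothesis genG : forall g, g \in G -> exists a, exists2 h, h \in H & g = (tau ^+ a * h)%g.
Hypothesis eH : (exponent H %| e)%N.
Hypothesis om_prim : e.-primitive_root om.
Hypothesis ze_prim : m.-primitive_root ze.

Variables (M : gT -> 'M[k]_n) (act : gT -> {rmorphism F -> F}).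
Hypothesis MM : {in G &, forall g g', M (g * g')%g = M g' *m M g}.
Hypothesis M1 : M 1%g = 1%:M.
Hypothesis M_faithful : {in G, forall g, M g = 1%:M -> g = 1%g}.
Hypothesis act_tofrac : forall g p, g \in G ->
  act g (tofrac p) = tofrac (coord_action M g p).

(** For every g the power g^m lies in H, so the exponent of G divides m e, which is invertible in k
    since both roots of unity are primitive. *)
Lemma card_extension_unit : #|G|%:R != 0 :> k.
Proof.
have me : (m * e)%:R != 0 :> k.
  by rewrite natrM mulf_neq0 ?(prim_root_natf_neq0 ze_prim) ?(prim_root_natf_neq0 om_prim).
rewrite -pcharf'_nat; rewrite -pcharf'_nat in me.
apply: sub_in_pnat (pnat_pi (cardG_gt0 G)) => p _.
rewrite -[in X in X -> _]pi_of_exponent => p_exp.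
apply: (pnatPpi me); apply: pi_of_dvd p_exp; last by rewrite muln_gt0 order_gt0.
apply/exponentP => g Gg; have [a [h Hh gE]] := genG Gg.
have nG : {in G, forall g, g \in 'N(H)%g}.
  by move=> g' Gg'; apply: (subsetP (normal_norm nHG)).
have HG : {in H, forall g, g \in G} by move=> y; apply: (subsetP (normal_sub nHG)).
have Hgm : (g ^+ m)%g \in H.
  have gH : coset H g = (coset H tau ^+ a)%g.
    rewrite gE morphM ?nG ?groupX ?(HG h) //.
    by rewrite /= (coset_id Hh) mulg1 morphX ?nG.
  apply: coset_idr; first exact/groupX/nG.
  rewrite morphX ?nG //= gH -expgM mulnC expgM.
  have -> : (coset H tau ^+ m = 1)%g by rewrite -morphX ?nG //= expg_order morph1.
  by rewrite expg1n.
by rewrite expgM (exponentP eH).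
Qed.

Lemma coord_actionX g i : coord_action M g 'X_i = \sum_j M g i j *: 'X_j.
Proof. by rewrite /coord_action mmapX mmap1U. Qed.

Lemma coord_actionM g g' p : g \in G -> g' \in G ->
  coord_action M (g * g')%g p = coord_action M g (coord_action M g' p).
Proof.
move=> Gg Gg'; rewrite /coord_action mmap_comp; apply: mmap_ext => // i.
rewrite raddf_sum /= MM //.
under eq_bigr do rewrite mxE scaler_suml.
rewrite exchange_big; apply: eq_bigr => l _ /=.
rewrite mmapZ mmapX mmap1U mul_mpolyC scaler_sumr.
by apply: eq_bigr => j _; rewrite scalerA.
Qed.

Lemma coord_actionC g c : coord_action M g c%:MP = c%:MP.
Proof. by rewrite /coord_action mmapC. Qed.

Lemma fraction_morph_eq (f f' : {rmorphism F -> F}) :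
  (forall p, f (tofrac p) = f' (tofrac p)) -> f =1 f'.
Proof. by move=> ff' x; rewrite (fracE x) !fmorph_div !ff'. Qed.

Let cF : {rmorphism k -> F} := (@tofrac P \o @mpolyC n k).

Lemma act_fractionM :
  {in G &, forall g g' x, act (g * g')%g x = act g (act g' x)}.
Proof.
move=> g g' Gg Gg'; apply: (@fraction_morph_eq _ (act g \o act g')) => p /=.
rewrite (@act_tofrac _ _ (groupM Gg Gg')) (@act_tofrac _ _ Gg') (@act_tofrac _ _ Gg).
by congr tofrac; apply: coord_actionM.
Qed.

Lemma act_fraction_cst g c : g \in G -> act g (cF c) = cF c.
Proof. by move=> Gg; rewrite /= act_tofrac // coord_actionC. Qed.

Lemma act_fraction_faithful : {in G, forall g, (forall x, act g x = x) -> g = 1%g}.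
Proof.
move=> g Gg gx; apply: M_faithful => //; apply/matrixP => i j.
have := gx (tofrac 'X_i); rewrite act_tofrac // coord_actionX => /eqP.
rewrite tofrac_eq => /eqP/(congr1 (mcoeff U_(j)%MM)).
rewrite mcoeffXU mxE => <-; rewrite raddf_sum /= (bigD1 j) //=.
rewrite mcoeffZ mcoeffXU eqxx mulr1 big1 ?addr0 // => l ne.
by rewrite mcoeffZ mcoeffXU (negPf ne) mulr0.
Qed.

Lemma act_fractionX g i : g \in G ->
  act g (tofrac 'X_i) = \sum_j cF (M g i j) * tofrac 'X_j.
Proof.
move=> Gg; rewrite act_tofrac // coord_actionX rmorph_sum /=.
by apply: eq_bigr => j _; rewrite -mul_mpolyC tofracM.
Qed.

Variables (L : fieldType) (iL : {rmorphism k -> L}) (emb : {rmorphism L -> F}).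
Hypothesis emb_cst : forall c, emb (iL c) = tofrac c%:MP.
Hypothesis emb_fixed : forall y g, g \in G -> act g (emb y) = emb y.
Hypothesis fixed_emb : forall z, (forall g, g \in G -> act g z = z) ->
  exists y, emb y = z.

Let s g : {rmorphism P -> P} := mmap (@mpolyC n k) (fun i => \sum_j M g i j *: 'X_j).

Let sM : {in G &, forall g h p, s (g * h)%g p = s g (s h p)}.
Proof. by move=> g h Gg Gh p; apply: coord_actionM. Qed.
Let s1 p : s 1%g p = p.
Proof.
rewrite -[RHS]mmap_id; apply: mmap_ext => // i.
rewrite (bigD1 i) //= M1 mxE eqxx scale1r big1 ?addr0 // => j ne.
by rewrite mxE eq_sym (negPf ne) scale0r.
Qed.
Let sC g c : g \in G -> s g c%:MP = c%:MP.
Proof. by move=> _; apply: coord_actionC. Qed.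

Lemma tofrac_mmap p : mmap cF (fun i => tofrac 'X_i) p = tofrac p.
Proof.
apply: (@mpoly_morphism_eq _ _ _ (mmap cF (fun i => tofrac 'X_i)) (@tofrac P)).
  by move=> c; rewrite /= mmapC.
by move=> i; rewrite /= mmapX mmap1U.
Qed.

(** Multiplying by the other conjugates of the denominator makes the denominator a norm; the
    numerator is then invariant too. *)
Lemma fixed_fraction z : (forall g, g \in G -> act g z = z) ->
  exists p q : P, [/\ q != 0, z = tofrac p / tofrac q &
    forall g, g \in G -> s g p = p /\ s g q = q].
Proof.
move=> zG; have [a [b [b0 zE]]] : exists a b : P, b != 0 /\ z = tofrac a / tofrac b.
  by do 2!eexists; split; last exact: fracE; apply: denom_ratioP.
have sb0 g : g \in G -> s g b != 0.
  by move=> Gg; rewrite -tofrac_eq0 -[s g b]/(coord_action M g b) -act_tofrac // fmorph_eq0 tofrac_eq0.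
pose q' := \prod_(g in G | g != 1%g) s g b; pose q := \prod_(g in G) s g b.
have qE : q = b * q' by rewrite /q (bigD1 1%g) ?group1 //= s1.
have q'0 : q' != 0 by apply/prodf_neq0 => g /andP[Gg _]; apply: sb0.
have q0 : q != 0 by apply/prodf_neq0 => g Gg; apply: sb0.
have sq g : g \in G -> s g q = q.
  move=> Gg; rewrite [LHS]rmorph_prod [RHS](reindex_inj (mulgI g)).
  apply: eq_big => h; first by rewrite groupMl.
  by move=> Gh; apply/esym/sM.
have zpq : z = tofrac (a * q') / tofrac q.
  by rewrite qE !tofracM -mulf_div divff ?tofrac_eq0 // mulr1.
exists (a * q'), q; split; [exact: q0 | exact: zpq | move=> g Gg].
split; last exact: sq.
apply/eqP; rewrite -tofrac_eq; apply/eqP.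
have pz : tofrac (a * q') = z * tofrac q by rewrite zpq divfK ?tofrac_eq0.
rewrite -[s g _]/(coord_action M g _) -act_tofrac // pz rmorphM zG //; congr (_ * _).
by rewrite act_tofrac //; congr tofrac; apply: sq.
Qed.

Lemma faithful_retract_rational : retract_rational iL.
Proof.
have [I1 [I2 [xt [pw1 [sub [pw2 [pt [pw1_inj pw2_inj pt_fixed lift]]]]]]]] :=
  descent_data nHG abH tauG genG eH om_prim ze_prim card_extension_unit
    act_fractionM act_fraction_cst act_fraction_faithful MM M1 act_fractionX.
pose og := @orbit_gens k n gT G (fun g => s g).
have og_fixed i g : g \in G -> s g (og i) = og i.
  by move=> Gg; apply: (orbit_gens_fixed sM sC).
have /fin_all_exists[a aE] (i : 'I_#|{: orbit_gens_idx n G}|) :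
    exists a, emb a = tofrac (og (enum_val i)).
  by apply: fixed_emb => g Gg; rewrite act_tofrac //; congr tofrac; apply: og_fixed.
have /fin_all_exists[u uE] (i : 'I_#|I2|) : exists u, emb u = pt (enum_val i).
  by apply: fixed_emb => g Gg; apply: pt_fixed.
have og_lift (i : 'I_#|{: orbit_gens_idx n G}|) :=
  lift (og (enum_val i)) (fun g Gg => og_fixed (enum_val i) g Gg).
have [q qP] := fin_all_exists og_lift.
have /fin_all_exists[b bP] := qP.
have emb_mmap Q : emb (mmap iL a Q) = tofrac (feval (@mpolyC n k) og Q).
  rewrite (@mmap_morph _ _ _ _ _ emb cF) //.
  rewrite /feval (@mmap_morph _ _ _ _ _ (@tofrac P) cF) //.
  exact: mmap_ext.
apply: (@retract_criterion _ _ iL _ _ a u b).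
- move=> y; have [|p [p' [p'0 yE pG]]] := @fixed_fraction (emb y).
    by move=> g; apply: emb_fixed.
  have [Q QE] := invariants_generated sM s1 sC card_extension_unit (fun g Gg => (pG g Gg).1).
  have [Q' QE'] := invariants_generated sM s1 sC card_extension_unit (fun g Gg => (pG g Gg).2).
  exists Q, Q'; rewrite -(fmorph_eq0 emb) emb_mmap -QE' tofrac_eq0; split=> //.
  by apply: (fmorph_inj emb); rewrite fmorph_div !emb_mmap -QE -QE'.
- move=> i; apply: (fmorph_inj emb); rewrite aE -tofrac_mmap.
  have [_ _ <-] := bP i.
  rewrite (@mmap_morph _ _ _ _ _ emb cF) //.
  exact: mmap_ext.
(* The relation Q passes from the invariants to their lifts, then to the q by [pw1_inj] and to the b
   by [pw2_inj]. *)
move=> Q /(congr1 emb); rewrite rmorph0 emb_mmap => /eqP; rewrite tofrac_eq0 => /eqP Q0.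
have q0 : mmap (@mpolyC _ k) q Q = 0.
  apply: pw1_inj; rewrite [RHS]rmorph0 /feval mmap_comp.
  transitivity (mmap (@mpolyC _ k) xt (feval (@mpolyC n k) og Q)).
    by rewrite mmap_comp; apply: mmap_ext => // i; have [] := bP i.
  by rewrite Q0 rmorph0.
apply: pw2_inj; rewrite [RHS]rmorph0 /feval mmap_comp.
transitivity (feval (@mpolyC _ k) sub (mmap (@mpolyC _ k) q Q)).
  by rewrite /feval mmap_comp; apply: mmap_ext => // i; have [] := bP i.
by rewrite q0 rmorph0.
Qed.

End FaithfulAction.

Lemma generator_decomposition (gT : finGroupType) (G H : {group gT}) tau :
  (H <| G)%g -> tau \in G -> generator (G / H)%g (coset H tau) ->
  forall g, g \in G -> exists a, exists2 h, h \in H & g = (tau ^+ a * h)%g.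
Proof.
move=> nHG tauG /eqP genH g Gg.
have nG : {in G, forall g, g \in 'N(H)%g}.
  by move=> y Gy; apply: (subsetP (normal_norm nHG)).
have := mem_quotient H Gg; rewrite genH => /cycleP[a ga].
exists a, (tau ^- a * g)%g; last by rewrite mulKVg.
apply: coset_idr; first by rewrite groupM ?groupV ?groupX ?nG.
by rewrite morphM ?morphV ?morphX ?groupV ?groupX ?nG //= ga mulVg.
Qed.

Section LinearReduction.
Variables (k : fieldType) (n : nat) (gT : finGroupType) (G H : {group gT}) (tau : gT).
Variables (e0 : nat) (om ze : k).
Local Notation F := {fraction {mpoly k[n]}}.
Hypotheses (nHG : (H <| G)%g) (abH : abelian H) (tauG : tau \in G).
Hypothesis genG : forall g, g \in G -> exists a, exists2 h, h \in H & g = (tau ^+ a * h)%g.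
Hypothesis eH : (exponent H %| e0.+1)%N.
Hypothesis om_prim : (e0.+1).-primitive_root om.
Hypothesis ze_prim : (#[tau]%g).-primitive_root ze.
Variables (rG : mx_representation k G n) (act : gT -> {rmorphism F -> F}).
Hypothesis act_tofrac : forall g p, g \in G ->
  act g (tofrac p) = tofrac (coord_action (fun g => rG g^-1%g) g p).
Variables (L : fieldType) (iL : {rmorphism k -> L}) (emb : {rmorphism L -> F}).
Hypothesis emb_cst : forall c, emb (iL c) = tofrac c%:MP.
Hypothesis emb_fixed : forall y g, g \in G -> act g (emb y) = emb y.
Hypothesis fixed_emb : forall z, (forall g, g \in G -> act g z = z) ->
  exists y, emb y = z.
Local Notation K := (rker rG).

Let reprG x : x \in (G / K)%g -> repr x \in G.
Proof.
case/morphimP=> g nKg Gg xE.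
have : repr x \in (K :* g)%g by rewrite -val_coset // -xE mem_repr_coset.
case/rcosetP=> h Kh ->; rewrite groupM //.
by case/rkerP: Kh.
Qed.

Let kquo_repr_repr x : x \in (G / K)%g -> kquo_repr rG x^-1%g = rG (repr x)^-1%g.
Proof.
move=> Gx; rewrite -kquo_repr_coset ?groupV ?reprG // morphV; first by rewrite /= coset_reprK.
exact: (subsetP (rker_norm rG) _ (reprG Gx)).
Qed.

(** The kernel K acts trivially, so L is also the fixed field of G/K. The image of tau has order
    dividing that of tau, so a power of ze serves, and the exponent of the image of H still divides
    e. *)
Lemma linear_retract_rational : retract_rational iL.
Proof.
have nK := rker_norm rG.
have nG : {in G, forall g, g \in 'N(K)%g} by move=> g Gg; apply: (subsetP nK).
have dv : (#[coset K tau]%g %| #[tau]%g)%N by apply: morph_order; apply: nG.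
have eH' : (exponent (H / K)%g %| e0.+1)%N by apply: dvdn_trans (exponent_quotient _ _) eH.
have HG : {in H, forall g, g \in G} by move=> y; apply: (subsetP (normal_sub nHG)).
have coset_tofrac g p : g \in G -> act (repr (coset K g)) (tofrac p) = act g (tofrac p).
  move=> Gg; have GKg : coset K g \in (G / K)%g by apply: mem_quotient.
  rewrite (@act_tofrac _ _ (reprG GKg)) (@act_tofrac _ _ Gg); congr tofrac; apply: mmap_ext => // i.
  apply: eq_bigr => j _; rewrite -kquo_repr_repr // -kquo_repr_coset ?groupV //.
  by rewrite morphV ?nG.
apply: (@faithful_retract_rational _ _ _ (G / K)%G (H / K)%G (coset K tau) e0 om _
  _ _ _ _ _ _ (dvdn_prim_root ze_prim dv) (fun x => kquo_repr rG x^-1%g)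
  (fun x => act (repr x)) _ _ _ _ _ iL emb) => //.
- exact: quotient_normal.
- exact: quotient_abelian.
- exact: mem_quotient.
- move=> _ /morphimP[g nKg Gg ->]; have [a [h Hh gE]] := genG Gg.
  exists a, (coset K h); first exact: mem_quotient.
  by rewrite gE /= morphM ?morphX ?nG ?groupX ?(HG _ Hh).
- by move=> x y Gx Gy /=; rewrite invMg repr_mxM ?groupV.
- by rewrite invg1 repr_mx1.
- move=> x Gx x1; apply/eqP; rewrite -invg_eq1 -in_set1.
  by apply: (subsetP (kquo_mx_faithful rG)); apply/rkerP; rewrite groupV.
- move=> x p Gx; rewrite (@act_tofrac _ _ (reprG Gx)); congr tofrac; apply: mmap_ext => // i.
  by apply: eq_bigr => j _; rewrite kquo_repr_repr.
- by move=> y x Gx; apply: emb_fixed; apply: reprG.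
move=> z zK; apply: fixed_emb => g Gg.
rewrite -[RHS](zK (coset K g)) ?mem_quotient //.
by apply: fraction_morph_eq => p; rewrite coset_tofrac.
Qed.
End LinearReduction.

Section Reductions.
Variables (k : fieldType) (gT : finGroupType) (G H : {group gT}) (tau : gT).
Variables (e0 : nat) (om ze : k).
Hypotheses (nHG : (H <| G)%g) (abH : abelian H) (tauG : tau \in G).
Hypothesis genG : forall g, g \in G -> exists a, exists2 h, h \in H & g = (tau ^+ a * h)%g.
Hypothesis eH : (exponent H %| e0.+1)%N.
Hypothesis om_prim : (e0.+1).-primitive_root om.
Hypothesis ze_prim : (#[tau]%g).-primitive_root ze.

Lemma kV_retract_rational n (rG : mx_representation k G n) :
  retract_rational (kV_cst rG).
Proof.
pose act g : {rmorphism {fraction {mpoly k[n]}} -> {fraction {mpoly k[n]}}} :=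
  ratfun_act (dual_tuple_inj (rG := rG)) (subg G g).
have act_tofrac g p : g \in G -> act g (tofrac p) =
    tofrac (coord_action (fun g => rG g^-1%g) g p).
  move=> Gg; rewrite [LHS]frac_map_tofrac; congr tofrac.
  by apply: mmap_ext => // i; rewrite tnth_mktuple subgK.
apply: (linear_retract_rational nHG abH tauG genG eH om_prim ze_prim act_tofrac
  (emb := (\val : {rmorphism kV_fixed rG -> _}))) => //.
- by move=> y g Gg; apply: (fixed_predP _ _ (fixed_valP y)).
move=> z zG; have zP : z \in fixed_pred (ratfun_act (dual_tuple_inj (rG := rG))).
  by apply/fixed_predP => g; rewrite -[g]sgvalK; apply/zG/subgP.
by exists (FixedField zP).
Qed.

Lemma kG_retract_rational : retract_rational (kG_cst k G).
Proof.
pose act g : {rmorphism {fraction {mpoly k[#|G|]}} -> {fraction {mpoly k[#|G|]}}} :=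
  ratfun_act (noether_tuple_inj (k := k) (G := G)) (subg G g).
pose sh (g : gT) (i : 'I_#|G|) := gring_index G (g * enum_val i)%g.
(* Left translation as a permutation matrix; it is faithful because g = 1 can be read off from the
   image of the variable of 1. *)
pose M g : 'M[k]_#|G| := \matrix_(i, j) (j == sh g i)%:R.
have sum_sh (V : lmodType k) g i (f : 'I_#|G| -> V) : \sum_j M g i j *: f j = f (sh g i).
  rewrite (bigD1 (sh g i)) //= mxE eqxx scale1r big1 ?addr0 // => j ne.
  by rewrite mxE (negPf ne) scale0r.
have shK g i : g \in G -> enum_val (sh g i) = (g * enum_val i)%g.
  by move=> Gg; rewrite gring_indexK ?groupM ?enum_valP.
have act_tofrac g p : g \in G -> act g (tofrac p) = tofrac (coord_action M g p).
  move=> Gg; rewrite [LHS]frac_map_tofrac; congr tofrac.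
  by apply: mmap_ext => // i; rewrite tnth_mktuple subgK // sum_sh.
apply: (faithful_retract_rational nHG abH tauG genG eH om_prim ze_prim _ _ _ act_tofrac
  (emb := (\val : {rmorphism kG_fixed k G -> _}))) => //.
- move=> g g' Gg Gg'; apply/matrixP => i j; rewrite !mxE.
  rewrite (sum_sh k^o g' i (fun l => M g l j)) mxE.
  by rewrite /sh shK // mulgA.
- apply/matrixP => i j; rewrite !mxE /sh mul1g gring_valK.
  by rewrite eq_sym.
- move=> g Gg /matrixP/(_ (gring_index G 1%g) (gring_index G 1%g)).
  rewrite !mxE eqxx; case: eqP => [|_ /eqP]; last by rewrite eq_sym oner_eq0.
  move=> e _; have := congr1 enum_val e; rewrite shK // gring_indexK ?group1 //.
  by rewrite mulg1.
- by move=> y g Gg; apply: (fixed_predP _ _ (fixed_valP y)).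
move=> z zG; have zP : z \in fixed_pred (ratfun_act (noether_tuple_inj (k := k) (G := G))).
  by apply/fixed_predP => g; rewrite -[g]sgvalK; apply/zG/subgP.
by exists (FixedField zP).
Qed.
End Reductions.

Theorem theorem5p10 (k : fieldType) (gT : finGroupType) (G H : {group gT})
    (tau : gT) (k_infinite : infinite_field k)
    (nHG : (H <| G)%g) (abH : abelian H) (cycGH : cyclic (G / H)%g)
    (tauG : tau \in G) (gen_tau : generator (G / H)%g (coset H tau))
    (zeta_k : has_zeta k (lcmn (exponent H) #[tau]%g)) :
  (forall (n : nat) (rG : mx_representation k G n),
     retract_rational (kV_cst rG)) /\
  retract_rational (kG_cst k G).
Proof.
have [_ [z z_prim]] := zeta_k.
have genG := generator_decomposition nHG tauG gen_tau.
(* Z/e is an ordinal type whose group structure needs the modulus written as a successor. *)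
have eH : (exponent H %| (exponent H).-1.+1)%N by rewrite prednK ?exponent_gt0.
have om_prim := dvdn_prim_root z_prim (dvdn_lcml _ _).
rewrite -[X in X.-primitive_root _]prednK ?exponent_gt0 // in om_prim.
have ze_prim := dvdn_prim_root z_prim (dvdn_lcmr _ _).
split=> [n rG|].
  exact: (kV_retract_rational nHG abH tauG genG eH om_prim ze_prim).
exact: (kG_retract_rational nHG abH tauG genG eH om_prim ze_prim).
Qed.
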